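(* Let $L>0$, $n\ge1$, let $V\in C^1([-L,L],\mathbb{R}^{n\times n})$ with $V=V^\top$, and fix $\tau\in(0,1]$ and $\theta\in[0,2\pi)$. Let $\lambda^\infty\in\mathbb{R}$ be such that $\operatorname{Spec}(H_\theta(t))\subset(\lambda^\infty,\infty)$ for all $t\in(0,1]$. Then for any $r>\lambda^\infty$, $$\mathcal{N}(r,\tau)-\mathcal{N}(r,1)=\tfrac12\,\operatorname{Mas}\big(\{\mathcal{G}_{r,t}\}_{\tau\le t\le1},\ \mathcal{F}^1_\theta\big),$$ the right-hand side being the Maslov index of the path $t\mapsto\mathcal{G}_{r,t}$, $t\in[\tau,1]$, of Lagrangian planes in $\mathbb{R}^{8n}$ relative to the fixed Lagrangian plane $\mathcal{F}^1_\theta$.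
   Context: Operators. For $t\in(0,1]$, $H_\theta(t)u=-u''+V|_{[-tL,tL]}u$ is the self-adjoint operator on $L^2([-tL,tL],\mathbb{C}^n)$ with domain $\{u:u,u'\in AC,\ u''\in L^2,\ u(tL)=e^{i\theta}u(-tL),\ u'(tL)=e^{i\theta}u'(-tL)\}$. Its spectrum is discrete and bounded from below uniformly in $t\in(0,1]$, so a number $\lambda^\infty$ as in the statement exists. Put $\mathcal{N}(r,t)=\sum_{\lambda<r}\dim_{\mathbb{C}}\ker(H_\theta(t)-\lambda)$. Lagrangian planes. Let $J=\begin{pmatrix}0&1\\-1&0\end{pmatrix}$, $M_\theta=\begin{pmatrix}\cos\theta&-\sin\theta\\ \sin\theta&\cos\theta\end{pmatrix}$, $I_k$ the $k\times k$ identity, $\otimes$ the Kronecker product ($A\otimes B$ has blocks $a_{ij}B$). On $\mathbb{R}^{8n}$ use the symplectic form $\omega(p,q)=(p,(J\otimes I_{4n})q)_{\mathbb{R}^{8n}}$. Define the planes, Lagrangian for $\omega$, $$\mathcal{F}^1_\theta=\{(p,(I_n\otimes M_\theta)p,-q,(I_n\otimes M_\theta)q)^\top:p,q\in\mathbb{R}^{2n}\},$$ $$\mathcal{G}_{\lambda,t}=\{(y(-L),y(L),-y'(-L),y'(L))^\top:\ y:[-L,L]\to\mathbb{R}^{2n},\ -y''(x)+t^2(V(tx)\otimes I_2)y(x)=t^2\lambda y(x)\}.$$ Maslov index. Let $\mathbb{R}^{2m}$ carry a symplectic form $\omega$ and let $\Omega$ be the operator with $\Omega^2=-I$, $\Omega^\top=-\Omega$,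 $\omega(u,v)=(\Omega u,v)_{\mathbb{R}^{2m}}$ (so here $\Omega=-(J\otimes I_{4n})$). Regard $\mathbb{R}^{2m}$ as a complex vector space with $(\alpha+i\beta)u=\alpha u+\beta\Omega u$ and Hermitian product $(u,v)_\omega=(u,v)_{\mathbb{R}^{2m}}-i\omega(u,v)$. For Lagrangian planes $\mathcal{X},\mathcal{Y}$ with orthogonal projections $P_{\mathcal{X}},P_{\mathcal{Y}}$ put $S_{\mathcal{X}}(\mathcal{Y})=(I-2P_{\mathcal{Y}})(2P_{\mathcal{X}}-I)$, a unitary operator on this complex space. For a continuous path $\Upsilon$ of Lagrangian planes on $[c,d]$ let $\upsilon(t)=S_{\mathcal{X}}(\Upsilon(t))$. There are a partition $c=t_0<\dots<t_N=d$ and $\varepsilon_j\in(0,\pi)$ with $e^{i(\pi+\varepsilon_j)}\notin\operatorname{Spec}(\upsilon(t))$ for $t\in[t_{j-1},t_j]$. With $k(t,\varepsilon)=\sum_{0\le\alpha\le\varepsilon}\dim_{\mathbb{C}}\ker(\upsilon(t)-e^{i(\pi+\alpha)})$, define $$\operatorname{Mas}(\Upsilon,\mathcal{X})=\sum_{j=1}^N\big(k(t_j,\varepsilon_j)-k(t_{j-1},\varepsilon_j)\big),$$ which is independent of the choices (and equal to $0$ if $c=d$). *)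

(* Defs.v *)
From HB Require Import structures.
From mathcomp Require Import all_boot all_order all_algebra.
From mathcomp Require Import all_classical all_reals all_analysis.
From mathcomp Require Export complex mxtens.

Set Implicit Arguments.
Unset Strict Implicit.
Unset Printing Implicit Defensive.

Import Order.TTheory GRing.Theory Num.Theory.
Import numFieldNormedType.Exports.

Local Open Scope classical_set_scope.
Local Open Scope ring_scope.

(* A function on [a, b] is represented by a function on R of which only the
   values on [a, b] matter: the difference quotient is restricted to [a, b],
   hence the derivative is one-sided at the end points. *)
Definition derive_at (R : realType) (W : normedModType R) (a b : R)
    (f : R -> W) (x : R) (l : W) : Prop :=
  (y - x)^-1 *: (f y - f x) @[y --> within `[a, b] x^'] --> l.

Definition derive_on (R : realType) (W : normedModType R) (a b : R)
    (f f' : R -> W) : Prop :=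
  forall x, x \in `[a, b] -> derive_at a b f x (f' x).

Definition C1_on (R : realType) (W : normedModType R) (a b : R)
    (f : R -> W) : Prop :=
  exists f' : R -> W, derive_on a b f f' /\ {within `[a, b], continuous f'}.

Definition AC_on (R : realType) (W : normedModType R) (a b : R)
    (f : R -> W) : Prop :=
  forall e : R, 0 < e -> exists2 d : R, 0 < d &
    forall (k : nat) (l u : 'I_k -> R),
      (forall i, a <= l i /\ l i <= u i /\ u i <= b) ->
      trivIset setT (fun i => `]l i, u i[%classic) ->
      \sum_i (u i - l i) < d -> \sum_i `|f (u i) - f (l i)| < e.

Definition expi (R : realType) (x : R) : R[i] := Complex (cos x) (sin x).

Definition realv (R : realType) (n : nat) (u : R -> 'cV[R[i]]_n) (x : R) :
  'cV[R]_n := map_mx (@complex.Re R) (u x).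

Definition imagv (R : realType) (n : nat) (u : R -> 'cV[R[i]]_n) (x : R) :
  'cV[R]_n := map_mx (@complex.Im R) (u x).

Definition sqnorm (R : realType) (n : nat) (z : 'cV[R[i]]_n) : R :=
  \sum_j (complex.Re (z j 0) ^+ 2 + complex.Im (z j 0) ^+ 2).

Definition L2sqnorm (R : realType) (n : nat) (a b : R)
    (u : R -> 'cV[R[i]]_n) : \bar R :=
  (\int[lebesgue_measure]_(x in `[a, b]) (sqnorm (u x))%:E)%E.

Definition L2 (R : realType) (n : nat) (a b : R)
    (u : R -> 'cV[R[i]]_n) : Prop :=
  (forall j, measurable_fun `[a, b] (fun x => realv u x j 0) /\
             measurable_fun `[a, b] (fun x => imagv u x j 0)) /\
  (L2sqnorm a b u < +oo)%E.

Definition ae_eq_on (R : realType) (n : nat) (a b : R)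
    (u v : R -> 'cV[R[i]]_n) : Prop :=
  {ae lebesgue_measure, forall x : R, x \in `[a, b] -> u x = v x}.

(* Largest number of vectors of E that are linearly independent over R[i]
   modulo N.  The scaling is explicit because it is also used for the complex
   structure that a symplectic form induces on a real vector space. *)
Definition cdim (R : realType) (U : zmodType) (scale : R[i] -> U -> U)
    (N E : set U) : \bar R :=
  ereal_sup [set (k%:R)%:E | k in [set k : nat |
    exists e : 'I_k -> U, (forall i, E (e i)) /\
      forall c : 'I_k -> R[i],
        N (\sum_i scale (c i) (e i)) -> forall i, c i = 0]].

(* An operator on L^2([a, b], C^n) is represented by its graph, a relation
   between functions: T u f means that u is in the domain and T u = f in L^2.
   Equality of elements of L^2 is [ae_eq_on]. *)

Definition resolvent_set (R : realType) (n : nat) (a b : R)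
    (T : (R -> 'cV[R[i]]_n) -> (R -> 'cV[R[i]]_n) -> Prop) : set R[i] :=
  [set z | exists M : R, forall f, L2 a b f ->
    exists u, [/\ T u (f + z *: u),
      (L2sqnorm a b u <= M%:E * L2sqnorm a b f)%E &
      forall v, T v (f + z *: v) -> ae_eq_on a b v u]].

Definition spectrum (R : realType) (n : nat) (a b : R)
    (T : (R -> 'cV[R[i]]_n) -> (R -> 'cV[R[i]]_n) -> Prop) : set R[i] :=
  ~` resolvent_set a b T.

Definition eigendim (R : realType) (n : nat) (a b : R)
    (T : (R -> 'cV[R[i]]_n) -> (R -> 'cV[R[i]]_n) -> Prop) (z : R[i]) :
  \bar R :=
  cdim (fun c (u : R -> 'cV[R[i]]_n) => c *: u)
       [set u | ae_eq_on a b u 0] [set u | T u (z *: u)].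

(* Here u1 is u' and u2 is u'', which exists only almost everywhere. *)
Definition H_theta (R : realType) (n : nat) (L : R) (V : R -> 'M[R]_n)
    (theta t : R) (u f : R -> 'cV[R[i]]_n) : Prop :=
  let a := - (t * L) in let b := t * L in
  exists u1 u2 : R -> 'cV[R[i]]_n,
    [/\ [/\ AC_on a b (realv u), AC_on a b (imagv u),
            derive_on a b (realv u) (realv u1) & derive_on a b (imagv u) (imagv u1)],
        [/\ AC_on a b (realv u1), AC_on a b (imagv u1) &
            {ae lebesgue_measure, forall x : R, x \in `[a, b] ->
              derive_at a b (realv u1) x (realv u2 x) /\
              derive_at a b (imagv u1) x (imagv u2 x)}],
        L2 a b u2,
        u b = expi theta *: u a /\ u1 b = expi theta *: u1 a &
        L2 a b f /\
        ae_eq_on a b f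
          (fun x => - u2 x + map_mx (fun y => y%:C%C) (V x) *m u x)].

(* The sum has values in [0, +oo]; its finiteness is not presupposed. *)
Definition eigencount (R : realType) (n : nat) (L : R) (V : R -> 'M[R]_n)
    (theta r t : R) : \bar R :=
  let dim_ker lam :=
    eigendim (- (t * L)) (t * L) (H_theta L V theta t) lam%:C%C in
  (\esum_(lam in [set lam : R | (lam < r)%R]) dim_ker lam)%E.

(* R^d carries the symplectic form (Om u, v), where Om^2 = - 1 and Om^T = - Om;
   a plane is given as the set of its vectors. *)

Definition sympl (R : realType) (d : nat) (Om : 'M[R]_d) (u v : 'cV[R]_d) : R :=
  ((Om *m u)^T *m v) 0 0.

Definition lagrangian (R : realType) (d : nat) (Om : 'M[R]_d)
    (X : set 'cV[R]_d) : Prop :=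
  X = [set u | forall v, X v -> sympl Om u v = 0].

Definition orthproj (R : realType) (d : nat) (X : set 'cV[R]_d) : 'M[R]_d :=
  xget 0 [set P : 'M[R]_d |
    [/\ P^T = P, P *m P = P & X = range (fun u : 'cV[R]_d => P *m u)]].

Definition souriau (R : realType) (d : nat) (X Y : set 'cV[R]_d) : 'M[R]_d :=
  (1%:M - 2%:R *: orthproj Y) *m (2%:R *: orthproj X - 1%:M).

Definition omscale (R : realType) (d : nat) (Om : 'M[R]_d)
    (z : R[i]) (u : 'cV[R]_d) : 'cV[R]_d :=
  complex.Re z *: u + complex.Im z *: (Om *m u).

Definition omker (R : realType) (d : nat) (Om S : 'M[R]_d) (z : R[i]) :
  set 'cV[R]_d := [set u | S *m u = omscale Om z u].

Definition omspec (R : realType) (d : nat) (Om S : 'M[R]_d) : set R[i] :=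
  [set z | exists2 u : 'cV[R]_d, u != 0 & omker Om S z u].

Definition arc_count (R : realType) (d : nat) (Om S : 'M[R]_d) (eps : R) :
  \bar R :=
  let dim_ker alpha :=
    cdim (omscale Om) [set 0] (omker Om S (expi (pi + alpha))) in
  (\esum_(alpha in `[0%R, eps]) dim_ker alpha)%E.

(* The partition points are s 0 < ... < s N; N = 0 occurs exactly when c = d. *)
Definition maslov_value (R : realType) (d : nat) (Om : 'M[R]_d) (c e : R)
    (Y : R -> set 'cV[R]_d) (X : set 'cV[R]_d) : set (\bar R) :=
  [set mu | exists (N : nat) (s eps : nat -> R),
    [/\ s 0%N = c, s N = e,
        forall j, (j < N)%N -> s j < s j.+1 /\ 0 < eps j < pi,
        forall j t, (j < N)%N -> t \in `[s j, s j.+1] ->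
          ~ omspec Om (souriau X (Y t)) (expi (pi + eps j)) &
        mu = (\sum_(j < N)
          (arc_count Om (souriau X (Y (s j.+1))) (eps j) -
           arc_count Om (souriau X (Y (s j))) (eps j)))%E]].

(* The index is assigned only to continuous paths of Lagrangian planes; the
   value is independent of the choices, so any admissible one is taken. *)
Definition Mas (R : realType) (d : nat) (Om : 'M[R]_d) (c e : R)
    (Y : R -> set 'cV[R]_d) (X : set 'cV[R]_d) : \bar R :=
  xget 0%E [set mu |
    [/\ lagrangian Om X,
        forall t, t \in `[c, e] -> lagrangian Om (Y t),
        {within `[c, e], continuous (fun t => orthproj (Y t))} &
        maslov_value Om c e Y X mu]].

Definition Jmx (R : realType) : 'M[R]_2 :=
  block_mx (0 : 'M[R]_1) (1%:M : 'M[R]_1) (- (1%:M : 'M[R]_1)) (0 : 'M[R]_1).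

Definition rotmx (R : realType) (theta : R) : 'M[R]_2 :=
  block_mx ((cos theta)%:M : 'M[R]_1) ((- sin theta)%:M : 'M[R]_1)
           ((sin theta)%:M : 'M[R]_1) ((cos theta)%:M : 'M[R]_1).

Definition Omega (R : realType) (n : nat) : 'M[R]_(2 * (4 * n)) :=
  - (Jmx R *t (1%:M : 'M[R]_(4 * n))).

Lemma sympl_Omega (R : realType) (n : nat) (p q : 'cV[R]_(2 * (4 * n))) :
  sympl (Omega R n) p q =
  (p^T *m ((Jmx R *t (1%:M : 'M[R]_(4 * n))) *m q)) 0 0.
Proof.
rewrite /sympl /Omega mulNmx linearN /= trmx_mul trmx_tens trmx1.
have -> : (Jmx R)^T = - Jmx R.
  apply/matrixP => -[[|[|//]] hi] -[[|[|//]] hj]; rewrite !mxE;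
    do ?(case: splitP => k; rewrite [k]ord1 //= => {k} _; rewrite !mxE);
    by rewrite ?mulr1n ?oppr0 ?opprK.
have -> : (- Jmx R) *t (1%:M : 'M[R]_(4 * n)) = - (Jmx R *t 1%:M).
  by apply/matrixP => i j; rewrite !mxE mulNr.
by rewrite mulmxN opprK mulmxA.
Qed.

Fact stack4_dim (n : nat) : (n * 2 + n * 2 + (n * 2 + n * 2) = 2 * (4 * n))%N.
Proof. by rewrite -!mulnDr mulnC mulnA mulnC. Qed.

Definition stack4 (R : realType) (n : nat) (a b c d : 'cV[R]_(n * 2)) :
  'cV[R]_(2 * (4 * n)) :=
  castmx (stack4_dim n, erefl) (col_mx (col_mx a b) (col_mx c d)).

Definition planeF (R : realType) (n : nat) (theta : R) :
  set 'cV[R]_(2 * (4 * n)) :=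
  let M := (1%:M : 'M[R]_n) *t rotmx theta in
  [set w | exists p q : 'cV[R]_(n * 2),
    w = stack4 p (M *m p) (- q) (M *m q)].
Arguments planeF {R} n theta _.

Definition planeG (R : realType) (n : nat) (L : R) (V : R -> 'M[R]_n)
    (lam t : R) : set 'cV[R]_(2 * (4 * n)) :=
  [set w | exists y y1 y2 : R -> 'cV[R]_(n * 2),
    [/\ derive_on (- L) L y y1, derive_on (- L) L y1 y2,
        forall x, x \in `[- L, L] ->
          - y2 x + t ^+ 2 *: ((V (t * x) *t (1%:M : 'M[R]_2)) *m y x) =
          (t ^+ 2 * lam) *: y x &
        w = stack4 (y (- L)) (y L) (- y1 (- L)) (y1 L)]].

(* Main.v *)
Require Import Defs.
From HB Require Import structures.
From mathcomp Require Import all_boot all_order all_algebra.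
From mathcomp Require Import all_classical all_reals all_analysis.
From mathcomp Require Import ring lra zify.

Set Implicit Arguments.
Unset Strict Implicit.
Unset Printing Implicit Defensive.

Import Order.TTheory GRing.Theory Num.Theory.
Import numFieldNormedType.Exports.

Local Open Scope classical_set_scope.
Local Open Scope ring_scope.

Lemma cousin (R : realType) (P : R -> R -> Prop) (a b : R) : a <= b ->
  (forall x y z, x <= y -> y <= z -> P x y -> P y z -> P x z) ->
  (forall x, a <= x <= b -> exists2 d, 0 < d & forall u v,
     a <= u -> x - d < u -> u <= x -> x <= v -> v < x + d -> v <= b -> P u v) ->
  P a b.
Proof.
move=> ab Ptrans Ploc.
pose S := [set x | a <= x <= b /\ P a x].
have Sa : S a.
  split; first by rewrite lexx ab.
  have [|d d0 H] := Ploc a; first by rewrite lexx.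
  by apply: H => //; lra.
have ubS : ubound S b by move=> x [/andP[]].
have hsS : has_sup S by split; [exists a | exists b].
pose s := sup S.
have as_ : a <= s by apply: ub_le_sup => //; exists b.
have sb : s <= b by apply: ge_sup => //; exists a.
have [|d d0 Hd] := Ploc s; first by rewrite as_ sb.
have [x [/andP[ax xb] Pax] sx] := sup_adherent d0 hsS.
have xs : x <= s by apply: ub_le_sup; [exists b | split => //; rewrite ax].
pose v := Num.min b (s + d / 2).
have sv : s <= v by rewrite le_min sb; lra.
have vb : v <= b by rewrite ge_min lexx.
have vs : v <= s + d / 2 by rewrite ge_min lexx orbT.
have Pav : P a v.
  have xv : x <= v by lra.
  by apply: (Ptrans _ _ _ ax xv) => //; apply: Hd => //; rewrite -/s; lra.
have : v <= s by apply: ub_le_sup; [exists b | split => //; rewrite vb andbT; lra].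
move=> vs'; have vE : v = s by apply/eqP; rewrite eq_le vs'.
have [bs|bs] := leP b (s + d / 2).
  by have -> : b = v by rewrite /v; rewrite min_l.
by have : v = s + d / 2; [rewrite /v min_r // ltW | lra].
Qed.

Lemma locally_constant (R : realType) (T : Type) (f : R -> T) (a b : R) :
  a <= b ->
  (forall x, a <= x <= b -> exists2 d, 0 < d & forall y,
     a <= y <= b -> `|y - x| < d -> f y = f x) ->
  f a = f b.
Proof.
move=> ab floc; apply: (@cousin R (fun u v => f u = f v)) => //.
  by move=> x y z _ _ -> ->.
move=> x /floc[d d0 Hd]; exists d => // u v au xu ux xv vx vb.
by rewrite !Hd //; rewrite ?ltr_norml; apply/andP; split; lra.
Qed.

Section derive_at.
Variables (R : realType) (W : normedModType R) (a b : R).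
Implicit Types f : R -> W.

Lemma derive_atP f x l : derive_at a b f x l <->
  forall e, 0 < e -> exists2 d, 0 < d & forall y, a <= y <= b -> `|y - x| < d ->
    `|f y - f x - (y - x) *: l| <= e * `|y - x|.
Proof.
split=> [/cvgrPdist_le H e e0|H].
  have := H e e0.
  rewrite near_withinE => /nbhs_ballP[d /= d0 Hd]; exists d => // y yab yxd.
  have [->|yx] := eqVneq y x; first by rewrite !subrr scale0r subr0 !normr0 mulr0.
  have yx0 : y - x != 0 by rewrite subr_eq0.
  have := Hd y; rewrite /= -ball_normE /= distrC yxd => /(_ isT yx).
  rewrite in_itv /= => /(_ yab) {}Hd.
  have -> : f y - f x - (y - x) *: l = - ((y - x) *: (l - (y - x)^-1 *: (f y - f x))).
    by rewrite scalerBr scalerA mulfV // scale1r opprB.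
  by rewrite normrN normrZ mulrC ler_pM2r // normr_gt0.
apply/cvgrPdist_le => e e0; have [d d0 Hd] := H e e0.
rewrite near_withinE; apply/nbhs_ballP; exists d => //= y.
rewrite -ball_normE /= distrC => yxd yx; rewrite in_itv /= => yab.
have yx0 : y - x != 0 by rewrite subr_eq0.
have := Hd y yab yxd.
have -> : f y - f x - (y - x) *: l = - ((y - x) *: (l - (y - x)^-1 *: (f y - f x))).
  by rewrite scalerBr scalerA mulfV // scale1r opprB.
by rewrite normrN normrZ mulrC ler_pM2r // normr_gt0.
Qed.

Lemma derive_at_cont f x l : derive_at a b f x l ->
  forall e, 0 < e -> exists2 d, 0 < d & forall y, a <= y <= b -> `|y - x| < d ->
    `|f y - f x| < e.
Proof.
move=> /derive_atP/(_ 1 ltr01)[d d0 Hd] e e0.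
have l0 : 0 <= `|l| by [].
pose d' := Num.min d (e / (2 + `|l|)).
have c0 : 0 < 2 + `|l| by lra.
exists d'; first by rewrite lt_min d0 divr_gt0.
move=> y yab; rewrite lt_min ltr_pdivlMr // => /andP[yd ye].
have := Hd y yab yd; rewrite mul1r => H1.
have : `|f y - f x| <= `|f y - f x - (y - x) *: l| + `|(y - x) *: l|.
  by rewrite -{1}(subrK ((y - x) *: l) (f y - f x)) ler_normD.
rewrite normrZ => H2.
have yx0 : 0 <= `|y - x| by [].
have [yx00|yx00] := eqVneq `|y - x| 0.
  by rewrite yx00 mul0r in H2; rewrite yx00 in H1; lra.
have : 0 < `|y - x| by rewrite lt_neqAle eq_sym yx00.
nra.
Qed.

Lemma within_contP f : {within `[a, b], continuous f} <->
  forall x, a <= x <= b -> forall e, 0 < e -> exists2 d, 0 < d &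
    forall y, a <= y <= b -> `|y - x| < d -> `|f y - f x| < e.
Proof.
split=> [/subspace_continuousP H x xab e e0|H].
  have /H/cvgrPdist_lt/(_ e e0) : `[a, b]%classic x by rewrite /= in_itv.
  rewrite near_withinE => /nbhs_ballP[d /= d0 Hd]; exists d => // y yab yxd.
  rewrite distrC; apply: Hd; first by rewrite /= -ball_normE /= distrC.
  by rewrite /= in_itv.
apply/subspace_continuousP => x /=; rewrite in_itv /= => xab.
apply/cvgrPdist_lt => e e0; have [d d0 Hd] := H x xab e e0.
rewrite near_withinE; apply/nbhs_ballP; exists d => //= y.
rewrite -ball_normE /= distrC => yxd; rewrite in_itv /= => yab.
by rewrite distrC; exact: Hd.
Qed.

Lemma derive_on_within f f' : derive_on a b f f' ->
  {within `[a, b], continuous f}.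
Proof.
move=> df; apply/within_contP => x xab; apply: derive_at_cont.
by apply: df; rewrite in_itv.
Qed.

End derive_at.

Section absolutely_continuous.
Variable R : realType.
Implicit Types (a b c e x y z : R) (g : R -> R) (O : set R).

Lemma sum_lengths_le (k : nat) (l u : 'I_k -> R) O :
  measurable O -> (forall i, l i <= u i) ->
  (forall i, `]l i, u i[ `<=` O) ->
  trivIset setT (fun i => `]l i, u i[%classic) ->
  ((\sum_i (u i - l i))%:E <= lebesgue_measure O)%E.
Proof.
move=> mO lu luO triv.
have -> : ((\sum_i (u i - l i))%:E =
    lebesgue_measure (\big[setU/set0]_(i < k) `]l i, u i[%classic) :> \bar R)%E.
  have mI i : measurable (`]l i, u i[%classic : set R) by exact: measurable_itv.
  rewrite (measure_bigsetU_ord lebesgue_measure predT mI triv) -sumEFin; apply: eq_bigr => i _.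
  rewrite [RHS](lebesgue_measure_itv `]l i, u i[) /= lte_fin; case: ltP => //.
  by move=> ui; have -> : l i = u i; [apply/eqP; rewrite eq_le lu | rewrite subrr].
apply: le_measure; rewrite ?inE //.
  by apply: bigsetU_measurable => i _; exact: measurable_itv.
by elim/big_ind : _ => // A B AO BO x [/AO|/BO].
Qed.

Definition covered O g (e x y : R) : Prop :=
  exists (k : nat) (l u : 'I_k -> R),
    [/\ forall i, [/\ x <= l i, l i <= u i, u i <= y & `]l i, u i[ `<=` O],
        trivIset setT (fun i => `]l i, u i[%classic) &
        `|g y - g x| <= e * (y - x) + \sum_i `|g (u i) - g (l i)|].

Lemma covered_trans O g e x y z : x <= y -> y <= z ->
  covered O g e x y -> covered O g e y z -> covered O g e x z.
Proof.
move=> xy yz [k1 [l1 [u1 [H1 T1 S1]]]] [k2 [l2 [u2 [H2 T2 S2]]]].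
exists (k1 + k2)%N.
pose f (h1 : 'I_k1 -> R) (h2 : 'I_k2 -> R) (i : 'I_(k1 + k2)) :=
  match fintype.split i with inl j => h1 j | inr j => h2 j end.
exists (f l1 l2), (f u1 u2); split.
- rewrite /f => i; case: (fintype.split i) => j.
    by have [? ? ? ?] := H1 j; split => //; lra.
  by have [? ? ? ?] := H2 j; split => //; lra.
- move=> i j _ _ [w /=]; rewrite !in_itv /= => -[].
  rewrite /f => wi wj; rewrite -(splitK i) -(splitK j).
  case: (fintype.split i) wi => i'; case: (fintype.split j) wj => j' wj wi; congr unsplit.
  + by congr inl; apply: T1 => //; exists w; rewrite /= !in_itv.
  + have [? ? ? _] := H1 i'; have [? ? ? _] := H2 j'.
    by case/andP: wi => ? ?; case/andP: wj => ? ?; exfalso; lra.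
  + have [? ? ? _] := H2 i'; have [? ? ? _] := H1 j'.
    by case/andP: wi => ? ?; case/andP: wj => ? ?; exfalso; lra.
  + by congr inr; apply: T2 => //; exists w; rewrite /= !in_itv.
- rewrite big_split_ord /=.
  have fl h1 h2 i : f h1 h2 (lshift k2 i) = h1 i.
    by rewrite /f (_ : lshift _ _ = unsplit (inl i)) ?unsplitK.
  have fr h1 h2 i : f h1 h2 (rshift k1 i) = h2 i.
    by rewrite /f (_ : rshift _ _ = unsplit (inr i)) ?unsplitK.
  under eq_bigr do rewrite !fl.
  under [X in _ + (_ + X)]eq_bigr do rewrite !fr.
  have : `|g z - g x| <= `|g z - g y| + `|g y - g x|.
    by rewrite (_ : g z - g x = (g z - g y) + (g y - g x)); [exact: ler_normD|ring].
  move: S1 S2; set s1 := \sum_(i < k1) _; set s2 := \sum_(i < k2) _.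
  lra.
Qed.

Theorem AC_derive0_const a b g : a <= b -> AC_on a b g ->
  {ae lebesgue_measure, forall x, x \in `[a, b] -> derive_at a b g x 0} ->
  forall c, a <= c <= b -> g c = g a.
Proof.
move=> ab acg [Z [mZ Z0 HZ]] c /andP[ac cb].
suff H e : 0 < e -> `|g c - g a| <= e * (c - a) + e.
  apply/eqP; rewrite -subr_eq0 -normr_le0; apply/ler_addgt0Pr => e e0.
  have c1 : 0 < 1 + (c - a) by lra.
  have := H (e / (1 + (c - a))) (divr_gt0 e0 c1).
  suff -> : e / (1 + (c - a)) * (c - a) + e / (1 + (c - a)) = e by rewrite add0r.
  by field; rewrite gt_eqF.
move=> e0; have [d d0 Hd] := acg e e0.
have [|U [oU ZU muU]] := @lebesgue_regularity_outer R Z d mZ _ d0.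
  by rewrite [X in (X < _)%E]Z0.
have mU : measurable U by exact: measurable_realfun.open_measurable.
have {}muU : (lebesgue_measure U < d%:E)%E.
  have -> : U = (U `\` Z) `|` Z by rewrite setUC setDUK.
  rewrite measureU //; [|exact: measurableD|by rewrite setDE -setIA setICl setI0].
  by rewrite [X in (_ + X < _)%E]Z0 adde0.
have [k [l [u [Hlu triv S]]]] : covered U g e a c.
  apply: cousin => //; first by move=> x y z; exact: covered_trans.
  move=> x /andP[ax xc]; have [xZ|xZ] := pselect (Z x).
    move: oU => /(_ x (ZU _ xZ))/nbhs_ballP[r /= r0 Hr]; exists r => // v w av xv vx xw wx wc.
    exists 1%N, (fun=> v), (fun=> w); split.
    - move=> _; split => //; first by lra.
      move=> y /=; rewrite in_itv /= => /andP[vy yw]; apply: Hr.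
      by rewrite -ball_normE /= ltr_norml; apply/andP; split; lra.
    - by move=> i j _ _ _; rewrite !ord1.
    - by rewrite big_ord1 lerDr mulr_ge0 //; lra.
  have /derive_atP : derive_at a b g x 0.
    apply: contrapT => nd; apply: xZ; apply: HZ => /= H; apply: nd; apply: H.
    by rewrite in_itv /= ax; lra.
  move=> /(_ e e0)[r r0 Hr]; exists r => // v w av xv vx xw wx wc.
  exists 0%N, (fun=> v), (fun=> w); split; [by case|by move=> -[]|].
  rewrite big_ord0 addr0.
  have Ev : `|v - x| = x - v by rewrite distrC ger0_norm //; lra.
  have Ew : `|w - x| = w - x by rewrite ger0_norm //; lra.
  have Hv : `|g v - g x| <= e * (x - v).
    have := Hr v; rewrite scaler0 subr0 Ev => H; apply: H; last by lra.
    by apply/andP; split; lra.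
  have Hw : `|g w - g x| <= e * (w - x).
    have := Hr w; rewrite scaler0 subr0 Ew => H; apply: H; last by lra.
    by apply/andP; split; lra.
  have : `|g w - g v| <= `|g w - g x| + `|g v - g x|.
    rewrite -(normrN (g v - g x)).
    by rewrite (_ : g w - g v = (g w - g x) + (- (g v - g x))); [exact: ler_normD|ring].
  lra.
apply: (le_trans S); rewrite lerD2l; apply/ltW/Hd => //.
  by move=> i; have [? ? ? _] := Hlu i; split => //; split => //; lra.
rewrite -lte_fin; apply: le_lt_trans muU; apply: sum_lengths_le => //.
  by move=> i; have [] := Hlu i.
by move=> i; have [] := Hlu i.
Qed.

End absolutely_continuous.

Section scalar_derivatives.
Variable R : realType.
Implicit Types (f g F G : R -> R) (a b c d x y l : R).

Lemma is_deriveP f x l : is_derive x 1 f l <->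
  forall e, 0 < e -> exists2 d, 0 < d & forall y, `|y - x| < d ->
    `|f y - f x - (y - x) * l| <= e * `|y - x|.
Proof.
have quot y : y != x ->
    f y - f x - (y - x) * l = - ((y - x) * (l - (y - x)^-1 * (f y - f x))).
  by move=> yx; field; rewrite subr_eq0.
split=> [[dfx dl] e e0|H].
  have /cvgrPdist_le/(_ e e0) :
      h^-1 *: ((f \o shift x) (h *: (1:R)) - f x) @[h --> 0^'] --> l by rewrite -dl.
  rewrite near_withinE => /nbhs_ballP[d /= d0 Hd]; exists d => // y yxd.
  have [->|yx] := eqVneq y x; first by rewrite !subrr mul0r subr0 !normr0 mulr0.
  have yx0 : y - x != 0 by rewrite subr_eq0.
  have := Hd (y - x); rewrite /= -ball_normE /= sub0r normrN yxd => /(_ isT yx0).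
  rewrite scaler1 subrK => {}Hd.
  by rewrite quot // normrN normrM mulrC ler_pM2r // normr_gt0.
have cvgl : h^-1 *: ((f \o shift x) (h *: (1:R)) - f x) @[h --> 0^'] --> l.
  apply/cvgrPdist_le => e e0; have [d d0 Hd] := H e e0.
  rewrite near_withinE; apply/nbhs_ballP; exists d => //= h.
  rewrite -ball_normE /= sub0r normrN => hd h0.
  have := Hd (h + x); rewrite addrK => /(_ hd).
  have hx : h + x != x by rewrite -subr_eq0 addrK.
  have := quot _ hx; rewrite addrK => ->.
  by rewrite normrN normrM mulrC ler_pM2r ?normr_gt0 // scaler1.
apply: DeriveDef; first by apply/cvg_ex; exists l.
exact/cvg_lim.
Qed.

Lemma is_derive_mul_cst c x : is_derive x 1 (fun y => c * y) c.
Proof.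
apply/is_deriveP => e e0; exists 1 => // y _.
rewrite (_ : c * y - c * x - (y - x) * c = 0) ?normr0 ?mulr_ge0 //; last by ring.
exact: ltW.
Qed.

Lemma is_derive_derive_at a b f x l : is_derive x 1 f l -> derive_at a b f x l.
Proof.
move=> /is_deriveP H; apply/derive_atP => e /H[d d0 Hd].
by exists d => // y _ /Hd.
Qed.

Lemma derive_at_is_derive a b f x l : a < x < b -> derive_at a b f x l ->
  is_derive x 1 f l.
Proof.
move=> /andP[ax xb] /derive_atP H; apply/is_deriveP => e /H[d d0 Hd].
exists (Num.min d (Num.min (x - a) (b - x))).
  by rewrite !lt_min d0; apply/andP; split; lra.
move=> y; rewrite !lt_min => /and3P[yd]; rewrite !ltr_norml => /andP[? ?] /andP[? ?].
by apply: Hd => //; apply/andP; split; lra.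
Qed.

Lemma is_derive_cont f x l : is_derive x 1 f l -> {for x, continuous f}.
Proof.
by move=> [df _]; apply/differentiable_continuous; exact/derivable1_diffP.
Qed.

Lemma cont_within a b f : (forall x, a <= x <= b -> {for x, continuous f}) ->
  {within `[a, b], continuous f}.
Proof.
move=> cf; apply/within_contP => x /cf /cvgrPdist_lt H e e0.
have /nbhs_ballP[d /= d0 Hd] := H e e0; exists d => // y _ yx.
by rewrite distrC; apply: Hd; rewrite -ball_normE /= distrC.
Qed.

Lemma within_sub a b c d f : a <= c -> d <= b ->
  {within `[a, b], continuous f} -> {within `[c, d], continuous f}.
Proof. by move=> ac db; apply: continuous_subspaceW => x /=; rewrite !in_itv /=; lra. Qed.

Lemma within_bounded a b f : a <= b -> {within `[a, b], continuous f} ->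
  exists2 M, 0 < M & forall x, a <= x <= b -> `|f x| <= M.
Proof.
move=> ab cf; have ncf : {within `[a, b], continuous (fun x => `|f x|)}.
  by move=> x; apply: cvg_norm; exact: cf.
have [c cab Hc] := EVT_max ab ncf.
exists (`|f c| + 1) => [|x xab]; first by rewrite ltr_pwDr.
by apply: (le_trans (Hc x _)); rewrite ?in_itv // lerDl.
Qed.

Lemma primitive a b f : a < b -> {within `[a, b], continuous f} ->
  exists F, [/\ F a = 0, {within `[a, b], continuous F} &
    forall x, a < x < b -> is_derive x 1 F (f x)].
Proof.
move=> ab cf; exists (parameterized_integral lebesgue_measure a ^~ f).
have intf : lebesgue_measure.-integrable `[a, b] (EFin \o f).
  by apply: continuous_compact_integrable => //; exact: segment_compact.
split; first by rewrite /parameterized_integral set_itv1 Rintegral_set1.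
  by apply: parameterized_integral_continuous => //; exact: ltW.
move=> x /andP[ax xb].
have cfx : {for x, continuous f}.
  have := within_continuous_continuous ab cf; apply.
  by rewrite in_itv /= ax xb.
have [dF F'] := continuous_FTC1_closed xb intf ax cfx.
by apply: DeriveDef => //; rewrite -derive1E.
Qed.

(* increments are controlled by the derivative *)
Lemma derive_le_incr a b F G f g : a <= b ->
  {within `[a, b], continuous F} -> {within `[a, b], continuous G} ->
  (forall x, a < x < b -> is_derive x 1 F (f x)) ->
  (forall x, a < x < b -> is_derive x 1 G (g x)) ->
  (forall x, a < x < b -> f x <= g x) ->
  F b - F a <= G b - G a.
Proof.
move=> ab cF cG dF dG fg.
have dGF x : a < x < b -> is_derive x 1 (G - F) (g x - f x).
  by move=> xab; apply: is_deriveB; [exact: dG|exact: dF].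
have := @ger0_derive1_le_cc R (G - F) a b.
have H1 x : x \in `]a, b[ -> derivable (G - F) x 1.
  by rewrite in_itv /= => xab; case: (dGF x xab).
have H2 x : x \in `]a, b[ -> 0 <= derive1 (G - F) x.
  rewrite in_itv /= => xab; rewrite derive1E (@derive_val _ _ _ _ _ _ _ (dGF x xab)).
  by rewrite subr_ge0 fg.
move=> /(_ H1 H2) H3.
have {}H3 : (G - F) a <= (G - F) b.
  apply: H3; rewrite ?in_itv /= ?lexx ?ab //.
  by move=> x; apply: (cvgB (cG x) (cF x)).
by rewrite !fctE in H3; lra.
Qed.

Lemma derive_abs_incr a b F G f g : a <= b ->
  {within `[a, b], continuous F} -> {within `[a, b], continuous G} ->
  (forall x, a < x < b -> is_derive x 1 F (f x)) ->
  (forall x, a < x < b -> is_derive x 1 G (g x)) ->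
  (forall x, a < x < b -> `|f x| <= g x) ->
  `|F b - F a| <= G b - G a.
Proof.
move=> ab cF cG dF dG fg; rewrite ler_norml; apply/andP; split; last first.
  by apply: derive_le_incr dF dG _ => // x /fg; rewrite ler_norml => /andP[].
have cNF : {within `[a, b], continuous (- F)}.
  by move=> x; apply: (cvgN (cF x)).
have dNF x : a < x < b -> is_derive x 1 (- F) (- f x).
  by move=> xab; apply: is_deriveN; exact: dF.
suff : (- F) b - (- F) a <= G b - G a by rewrite !fctE; lra.
by apply: derive_le_incr dNF dG _ => // x /fg; rewrite ler_norml lerNl => /andP[].
Qed.

Lemma derive0_const a b F : a <= b -> {within `[a, b], continuous F} ->
  (forall x, a < x < b -> is_derive x 1 F 0) -> F b = F a.
Proof.
move=> ab cF dF; apply/eqP; rewrite -subr_eq0 -normr_le0.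
rewrite -[leRHS](subrr (0 : R)).
apply: (@derive_abs_incr a b F (cst 0) (cst 0) (cst 0)) => //.
- by move=> x; exact: cvg_cst.
- by move=> x _; rewrite /cst normr0.
Qed.

Lemma derive_on_Lipschitz a b f f' M :
  (forall x, a <= x <= b -> derive_at a b f x (f' x)) ->
  (forall x, a <= x <= b -> `|f' x| <= M) ->
  forall x y, a <= x -> x <= y -> y <= b -> `|f y - f x| <= M * (y - x).
Proof.
move=> df f'M x y ax xy yb; rewrite mulrBr.
apply: (@derive_abs_incr x y f (fun z => M * z) f' (cst M)) => //.
- apply: (@within_sub a b) => //; apply: (@derive_on_within _ _ _ _ _ f').
  by move=> z; rewrite in_itv /=; exact: df.
- by apply: cont_within => z _; apply: cvgM; [exact: cvg_cst|exact: cvg_id].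
- move=> z /andP[xz zy]; apply: (@derive_at_is_derive a b); last by apply: df; lra.
  by apply/andP; split; lra.
- by move=> z _; exact: is_derive_mul_cst.
- by move=> z ?; apply: f'M; lra.
Qed.

End scalar_derivatives.

Section matrix_functions.
Variable R : realType.
Implicit Types (a b x : R).

Definition derive_mx m p (x : R) (F : R -> 'M[R]_(m, p)) (L : 'M[R]_(m, p)) :=
  forall i j, is_derive x 1 (fun y => F y i j) (L i j).

Definition within_cont_mx m p a b (F : R -> 'M[R]_(m, p)) :=
  forall i j, {within `[a, b], continuous (fun x => F x i j)}.

Lemma is_derive_bigsum I (r : seq I) (h : I -> R -> R) (dh : I -> R) (x : R) :
  (forall i, is_derive x 1 (h i) (dh i)) ->
  is_derive x 1 (fun y => \sum_(i <- r) h i y) (\sum_(i <- r) dh i).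
Proof.
move=> H; rewrite (_ : (fun y => _) = \sum_(i <- r) h i); last first.
  by apply/funext => y; rewrite fct_sumE.
elim/big_ind2 : _ => //.
  exact: (is_derive_cst (0 : R)).
by move=> *; exact: is_deriveD.
Qed.

Lemma derive_mx_mul m p q x (F : R -> 'M[R]_(m, p)) (G : R -> 'M[R]_(p, q)) F' G' :
  derive_mx x F F' -> derive_mx x G G' ->
  derive_mx x (fun y => F y *m G y) (F' *m G x + F x *m G').
Proof.
move=> dF dG i j; rewrite !mxE -big_split /=.
rewrite (_ : (fun y => _) = (fun y => \sum_k F y i k * G y k j)); last first.
  by apply/funext => y; rewrite mxE.
apply: is_derive_bigsum => k.
apply: is_derive_eq; first exact: (is_deriveM (dF i k) (dG k j)).
by rewrite /GRing.scale /=; ring.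
Qed.

Lemma derive_mx_cst m p x (C : 'M[R]_(m, p)) : derive_mx x (fun=> C) 0.
Proof. by move=> i j; rewrite mxE; exact: (is_derive_cst (C i j)). Qed.

Lemma derive_mx_tr m p x (F : R -> 'M[R]_(m, p)) F' :
  derive_mx x F F' -> derive_mx x (fun y => (F y)^T) F'^T.
Proof.
move=> dF i j; rewrite mxE (_ : (fun y => _) = (fun y => F y j i)) //.
by apply/funext => y; rewrite mxE.
Qed.

Lemma derive_mx_D m p x (F G : R -> 'M[R]_(m, p)) F' G' :
  derive_mx x F F' -> derive_mx x G G' -> derive_mx x (fun y => F y + G y) (F' + G').
Proof.
move=> dF dG i j; rewrite mxE (_ : (fun y => _) = (fun y => F y i j) + (fun y => G y i j)).
  exact: is_deriveD (dF i j) (dG i j).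
by apply/funext => y; rewrite mxE.
Qed.

Lemma derive_mx_N m p x (F : R -> 'M[R]_(m, p)) F' :
  derive_mx x F F' -> derive_mx x (fun y => - F y) (- F').
Proof.
move=> dF i j; rewrite mxE (_ : (fun y => _) = - (fun y => F y i j)).
  exact: is_deriveN (dF i j).
by apply/funext => y; rewrite mxE.
Qed.

Lemma within_ext a b (f g : R -> R) : f =1 g ->
  {within `[a, b], continuous g} -> {within `[a, b], continuous f}.
Proof. by move=> /funext ->. Qed.

Lemma within_cont_cst a b (c : R) : {within `[a, b], continuous (fun=> c)}.
Proof. by move=> x; exact: cvg_cst. Qed.

Lemma within_cont_mx_cst m p a b (C : 'M[R]_(m, p)) :
  within_cont_mx a b (fun=> C).
Proof. by move=> i j; exact: within_cont_cst. Qed.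

Lemma cvg_sumr (T I : Type) (F : set_system T) (r : seq I) (f : I -> T -> R)
    (l : I -> R) : Filter F -> (forall i, f i x @[x --> F] --> l i) ->
  (\sum_(i <- r) f i x) @[x --> F] --> \sum_(i <- r) l i.
Proof.
move=> FF H; elim: r => [|i r IH].
  by under eq_fun do rewrite big_nil; rewrite big_nil; exact: cvg_cst.
under eq_fun do rewrite big_cons; rewrite big_cons; exact: cvgD.
Qed.

Lemma within_cont_tr m p a b (F : R -> 'M[R]_(m, p)) : within_cont_mx a b F ->
  within_cont_mx a b (fun y => (F y)^T).
Proof. by move=> cF i j; apply: within_ext (cF j i) => x; rewrite mxE. Qed.

Lemma within_cont_sub m p a b (F G : R -> 'M[R]_(m, p)) : within_cont_mx a b F ->
  within_cont_mx a b G -> within_cont_mx a b (fun y => F y - G y).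
Proof.
move=> cF cG i j; apply: (@within_ext _ _ _ (fun y => F y i j - G y i j)).
  by move=> x; rewrite mxE [X in _ + X]mxE.
by move=> x; exact: (cvgB (cF i j x) (cG i j x)).
Qed.

Lemma within_cont_mul m p q a b (F : R -> 'M[R]_(m, p)) (G : R -> 'M[R]_(p, q)) :
  within_cont_mx a b F -> within_cont_mx a b G ->
  within_cont_mx a b (fun y => F y *m G y).
Proof.
move=> cF cG i j; rewrite (_ : (fun y => _) = (fun y => \sum_k F y i k * G y k j)).
  move=> x; apply: cvg_sumr => k; exact: (cvgM (cF i k x) (cG k j x)).
by apply/funext => y; rewrite mxE.
Qed.

Lemma within_cont_mx_bounded m p a b (F : R -> 'M[R]_(m, p)) : a <= b ->
  within_cont_mx a b F ->
  exists2 M, 0 < M & forall x i j, a <= x <= b -> `|F x i j| <= M.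
Proof.
move=> ab cF; have H ij : exists M, 0 < M /\ forall x, a <= x <= b ->
    `|F x ij.1 ij.2| <= M.
  by have [M M0 HM] := within_bounded ab (cF ij.1 ij.2); exists M.
have [M HM] := choice H.
exists (1 + \sum_ij M ij).
  by rewrite ltr_pwDl // sumr_ge0 // => ij _; apply/ltW; case: (HM ij).
move=> x i j xab; apply: (le_trans ((HM (i, j)).2 x xab)).
rewrite (bigD1 (i, j)) //= addrCA lerDl addr_ge0 // sumr_ge0 // => ij _.
by apply/ltW; case: (HM ij).
Qed.

Lemma mulmx_bound m p q (A : 'M[R]_(m, p)) (B : 'M[R]_(p, q)) M d :
  0 <= M -> 0 <= d ->
  (forall i j, `|A i j| <= M) -> (forall i j, `|B i j| <= d) ->
  forall i j, `|(A *m B) i j| <= p%:R * M * d.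
Proof.
move=> M0 d0 HA HB i j; rewrite mxE; apply: (le_trans (ler_norm_sum _ _ _)).
rewrite -mulrA mulr_natl -[p in leRHS]card_ord -sumr_const.
by apply: ler_sum => k _; rewrite normrM; apply: ler_pM.
Qed.

Lemma dyadic_limit (u : nat -> R) (c : R) :
  (forall k, `|u k.+1 - u k| <= c / 2 ^+ k.+1) ->
  exists l, forall k, `|l - u k| <= c / 2 ^+ k.
Proof.
move=> Hu.
have half k : c / 2 ^+ k = 2 * (c / 2 ^+ k.+1).
  by rewrite exprS; field; rewrite expf_neq0.
have c0 : 0 <= c.
  have := Hu 0%N; have := normr_ge0 (u 1%N - u 0%N); rewrite expr1; lra.
have lo k m : (k <= m)%N -> u k - c / 2 ^+ k <= u m - c / 2 ^+ m.
  elim: m => [|m IH]; first by rewrite leqn0 => /eqP ->.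
  rewrite leq_eqVlt => /predU1P[->//|]; rewrite ltnS => /IH.
  have := Hu m; rewrite (half m) ler_norml; lra.
have hi k m : (k <= m)%N -> u m + c / 2 ^+ m <= u k + c / 2 ^+ k.
  elim: m => [|m IH]; first by rewrite leqn0 => /eqP ->.
  rewrite leq_eqVlt => /predU1P[->//|]; rewrite ltnS => /IH.
  have := Hu m; rewrite (half m) ler_norml; lra.
have pos m : 0 <= c / 2 ^+ m by rewrite divr_ge0 // exprn_ge0.
have lohi k m : u k - c / 2 ^+ k <= u m + c / 2 ^+ m.
  have [km|/ltnW mk] := leqP k m.
    by have := lo _ _ km; have := pos m; lra.
  by have := hi _ _ mk; have := pos k; lra.
pose S := range (fun k => u k - c / 2 ^+ k).
exists (sup S) => k; rewrite ler_norml; apply/andP; split.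
  have : u k - c / 2 ^+ k <= sup S.
    apply: ub_le_sup; last by exists k.
    by exists (u 0%N + c / 2 ^+ 0) => _ [m _ <-]; exact: lohi.
  lra.
have : sup S <= u k + c / 2 ^+ k.
  apply: ge_sup; first by exists (u 0%N - c / 2 ^+ 0); exists 0%N.
  by move=> _ [m _ <-]; exact: lohi.
lra.
Qed.

Lemma le_dyadic (x c d : R) : (forall k, x <= c / 2 ^+ k + d) -> x <= d.
Proof.
move=> H; rewrite leNgt; apply/negP => dx.
have [c0|c0] := leP c 0.
  by have := H 0%N; rewrite expr0 divr1; lra.
have [k Hk] : exists k, c / (x - d) < 2 ^+ k.
  exists (Num.bound (c / (x - d))).
  apply: (lt_le_trans (archi_boundP _)); first by rewrite divr_ge0; lra.
  by rewrite -natrX ler_nat ltnW // ltn_expl.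
have p0 : 0 < (2 : R) ^+ k by rewrite exprn_gt0.
have : c / 2 ^+ k < x - d.
  by rewrite ltr_pdivrMr // mulrC -ltr_pdivrMr // subr_gt0.
by have := H k; lra.
Qed.

End matrix_functions.

Section linear_ode.
Variables (R : realType) (a b : R).
Hypothesis ab : a < b.
Variables (N : nat) (M : R).
Hypothesis M0 : 0 < M.

Let K : R := 2 * (N.+1%:R * M).
Let K0 : 0 < K. Proof. by rewrite !mulr_gt0. Qed.

Definition weight (x : R) := expR (K * (x - a)).

Lemma weight_ge1 x : a <= x -> 1 <= weight x.
Proof. by move=> ax; rewrite -expR0 ler_expR mulr_ge0 // ?subr_ge0 // ltW. Qed.

Lemma weight_le x : x <= b -> weight x <= weight b.
Proof. by move=> xb; rewrite ler_expR ler_pM2l // lerD2r. Qed.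

Lemma is_derive_weight (x : R) : is_derive x 1 weight (K * weight x).
Proof.
have d1 : is_derive x 1 (fun y => K * (y - a)) K.
  apply/is_deriveP => e e0; exists 1 => // y _.
  rewrite (_ : _ - _ = 0) ?normr0 ?mulr_ge0 //; last by ring.
  exact: ltW.
rewrite mulrC; exact: (@is_derive1_comp R expR (fun y => K * (y - a)) x _ _ (is_derive_expR _) d1).
Qed.

Lemma weighted_bound (F f : R -> R) (c g z : R) : 0 <= c -> 0 <= g ->
  {within `[a, b], continuous F} ->
  (forall x, a < x < b -> is_derive x 1 F (f x)) ->
  `|F a| <= z -> (forall x, a < x < b -> `|f x| <= K * c * weight x + g) ->
  forall x, a <= x <= b -> `|F x| <= (z + g * (b - a) + c) * weight x.
Proof.
move=> c0 g0 cF dF Fa ff x /andP[ax xb].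
pose G (y : R) : R := c * weight y + g * y.
have dG (y : R) : is_derive y 1 G (K * c * weight y + g).
  rewrite (_ : G = (fun y => c * weight y) + (fun y => g * y)); last exact/funext.
  apply: is_deriveD; last exact: is_derive_mul_cst.
  rewrite [K * c]mulrC -mulrA.
  exact: (@is_derive1_comp R (fun y => c * y) weight y _ _
    (is_derive_mul_cst c _) (is_derive_weight y)).
have : `|F x - F a| <= G x - G a.
  apply: (@derive_abs_incr _ a x F G f) => //.
  - exact: (@within_sub _ a b).
  - by apply: cont_within => y _; exact: is_derive_cont (dG y).
  - by move=> y /andP[ay yx]; apply: dF; rewrite ay (lt_le_trans yx).
  - by move=> y /andP[ay yx]; apply: ff; rewrite ay (lt_le_trans yx).
rewrite /G (_ : weight a = 1); last by rewrite /weight subrr mulr0 expR0.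
have w1 := weight_ge1 ax.
have : `|F x| <= `|F x - F a| + `|F a| by rewrite -{1}(subrK (F a) (F x)) ler_normD.
have : 0 <= z by exact: le_trans Fa.
have : g * (x - a) <= g * (b - a) by rewrite ler_wpM2l // lerD2r.
have : 0 <= g * (b - a) by rewrite mulr_ge0 // subr_ge0 ltW.
have := normr_ge0 (F x); have := normr_ge0 (F a).
nra.
Qed.

Section step.
Variables (p : nat) (A : R -> 'M[R]_N).
Hypothesis AM : forall x i j, a <= x <= b -> `|A x i j| <= M.
Implicit Types D G : R -> 'M[R]_(N, p).

Lemma weighted_bound_mx D D1 G (c g z : R) : 0 <= c -> 0 <= g ->
  within_cont_mx a b D ->
  (forall x, a < x < b -> derive_mx x D (A x *m D1 x + G x)) ->
  (forall i j, `|D a i j| <= z) ->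
  (forall x i j, a <= x <= b -> `|D1 x i j| <= c * weight x) ->
  (forall x i j, a <= x <= b -> `|G x i j| <= g) ->
  forall x i j, a <= x <= b -> `|D x i j| <= (z + g * (b - a) + c / 2) * weight x.
Proof.
move=> c0 g0 cD dD Da D1c Gg x i j.
apply: (@weighted_bound (fun x => D x i j) (fun x => (A x *m D1 x + G x) i j)) => //.
- by rewrite divr_ge0.
- by move=> y yab; exact: dD.
- move=> y /andP[ay yb]; rewrite mxE; apply: (le_trans (ler_normD _ _)).
  have yab : a <= y <= b by rewrite !ltW.
  apply: lerD; last exact: Gg.
  have w1 : 1 <= weight y by apply: weight_ge1; exact: ltW.
  have cw0 : 0 <= c * weight y by rewrite mulr_ge0 //; lra.
  apply: le_trans (mulmx_bound (ltW M0) cw0 (fun k l => AM k l yab)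
    (fun k l => D1c y k l yab) i j) _.
  rewrite (_ : K * (c / 2) * weight y = N.+1%:R * M * (c * weight y)); last first.
    by rewrite /K; field.
  apply: ler_wpM2r; first by rewrite mulr_ge0 //; lra.
  by apply: ler_wpM2r; [exact: ltW|rewrite ler_nat].
Qed.

(* a-priori estimate *)
Lemma linear_ode_bound D G (g z : R) : 0 <= g -> within_cont_mx a b D ->
  (forall x, a < x < b -> derive_mx x D (A x *m D x + G x)) ->
  (forall i j, `|D a i j| <= z) ->
  (forall x i j, a <= x <= b -> `|G x i j| <= g) ->
  forall x i j, a <= x <= b -> `|D x i j| <= 2 * (z + g * (b - a)) * weight b.
Proof.
move=> g0 cD dD Da Gg x i j xab.
have z0 : 0 <= z by apply: le_trans (Da i j).
have [C C0 HC] := within_cont_mx_bounded (ltW ab) cD.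
pose h := z + g * (b - a).
have h0 : 0 <= h by rewrite addr_ge0 // mulr_ge0 // subr_ge0 ltW.
suff H k : forall x i j, a <= x <= b -> `|D x i j| <= (C / 2 ^+ k + 2 * h) * weight x.
  have := xab => /andP[ax xb]; have w1 := weight_ge1 ax.
  apply: (@le_trans _ _ (2 * h * weight x)); last first.
    by apply: ler_wpM2l; [rewrite mulr_ge0|exact: weight_le].
  apply: (@le_dyadic _ _ (C * weight x)) => k.
  by have := H k x i j xab; rewrite mulrDl mulrAC.
elim: k => [|k IH] {xab}x {}i {}j xab.
  have := xab => /andP[ax xb]; have w1 := weight_ge1 ax.
  apply: (le_trans (HC x i j xab)); rewrite expr0 divr1.
  by rewrite -[leLHS]mulr1; apply: ler_pM => //; [exact: ltW|rewrite lerDl mulr_ge0].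
have c0 : 0 <= C / 2 ^+ k + 2 * h.
  by rewrite addr_ge0 ?divr_ge0 ?mulr_ge0 ?exprn_ge0 // ltW.
have := weighted_bound_mx c0 g0 cD dD Da IH Gg i j xab.
suff -> : z + g * (b - a) + (C / 2 ^+ k + 2 * h) / 2 = C / 2 ^+ k.+1 + 2 * h by [].
by rewrite -/h exprS; field; rewrite expf_neq0.
Qed.

Hypothesis cA : within_cont_mx a b A.
Variable Z0 : 'M[R]_(N, p).

Let prim (f : R -> R) : R -> R := get [set F | [/\ F a = 0,
  {within `[a, b], continuous F} & forall x, a < x < b -> is_derive x 1 F (f x)]].

Let primP (f : R -> R) : {within `[a, b], continuous f} -> [/\ prim f a = 0,
  {within `[a, b], continuous (prim f)} &
  forall x, a < x < b -> is_derive x 1 (prim f) (f x)].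
Proof. by move=> cf; have := getPex (primitive ab cf). Qed.

Let T (Z : R -> 'M[R]_(N, p)) (x : R) : 'M[R]_(N, p) :=
  \matrix_(i, j) (Z0 i j + prim (fun y => (A y *m Z y) i j) x).

Let TP Z : within_cont_mx a b Z -> [/\ T Z a = Z0, within_cont_mx a b (T Z) &
  forall x, a < x < b -> derive_mx x (T Z) (A x *m Z x)].
Proof.
move=> cZ; have cAZ : within_cont_mx a b (fun y => A y *m Z y).
  exact: within_cont_mul.
have TE i j : (fun x => T Z x i j) = cst (Z0 i j) + prim (fun y => (A y *m Z y) i j).
  by apply/funext => x; rewrite mxE.
split.
- by apply/matrixP => i j; rewrite mxE; have [-> _ _] := primP (cAZ i j); rewrite addr0.
- move=> i j; rewrite TE; have [_ cp _] := primP (cAZ i j) => x.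
  exact: (cvgD (@within_cont_cst R a b (Z0 i j) x) (cp x)).
- move=> x xab i j; rewrite TE -[(A x *m Z x) i j]add0r.
  apply: is_deriveD.
  by have [_ _ dp] := primP (cAZ i j); exact: dp.
Qed.

Let T_contract Z1 Z2 (c : R) : 0 <= c -> within_cont_mx a b Z1 -> within_cont_mx a b Z2 ->
  (forall x i j, a <= x <= b -> `|(Z1 x - Z2 x) i j| <= c * weight x) ->
  forall x i j, a <= x <= b -> `|(T Z1 x - T Z2 x) i j| <= c / 2 * weight x.
Proof.
move=> c0 c1 c2 H x i j xab; have [a1 ct1 d1] := TP c1; have [a2 ct2 d2] := TP c2.
have := @weighted_bound_mx (fun y => T Z1 y - T Z2 y) (fun y => Z1 y - Z2 y) (fun=> 0)
  c 0 0 c0 (lexx 0).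
rewrite mul0r !add0r; apply => //.
- move=> k l; rewrite (_ : (fun x => _) = (fun x => T Z1 x k l) - (fun x => T Z2 x k l)).
    by move=> y; exact: (cvgB (ct1 k l y) (ct2 k l y)).
  by apply/funext => y; rewrite [LHS]mxE [X in _ + X = _]mxE.
- move=> y yab; rewrite addr0 mulmxBr.
  by apply: derive_mx_D; [exact: d1|apply: derive_mx_N; exact: d2].
- by move=> k l; rewrite a1 a2 subrr mxE normr0.
- by move=> y k l _; rewrite mxE normr0.
Qed.

Theorem linear_ode : exists Z : R -> 'M[R]_(N, p),
  [/\ Z a = Z0, within_cont_mx a b Z &
    forall x, a < x < b -> derive_mx x Z (A x *m Z x)].
Proof.
pose u k := iter k T (fun=> Z0).
have cu k : within_cont_mx a b (u k).
  elim: k => [|k IH]; first exact: within_cont_mx_cst.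
  by have [_ + _] := TP IH.
pose C : R := \sum_ij `|Z0 ij.1 ij.2|.
have C0 : 0 <= C by rewrite sumr_ge0.
have Z0C i j : `|Z0 i j| <= C.
  by rewrite /C (bigD1 (i, j)) //= lerDl sumr_ge0.
have step k x i j : a <= x <= b ->
    `|(u k.+1 x - u k x) i j| <= C / 2 ^+ k.+1 * weight x.
  elim: k x i j => [|k IH] x i j xab; last first.
    rewrite (_ : C / 2 ^+ k.+2 = C / 2 ^+ k.+1 / 2); last first.
      by rewrite [2 ^+ k.+2]exprSr; field; rewrite expf_neq0.
    have c0 : 0 <= C / 2 ^+ k.+1 by rewrite divr_ge0 ?exprn_ge0.
    exact: (T_contract c0 (cu k.+1) (cu k) IH).
  rewrite expr1.
  have := @T_contract (fun=> Z0) (fun=> 0) C C0 (cu 0%N).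
  have [_ _ d0] := @TP (fun=> 0) (@within_cont_mx_cst R N p a b 0).
  have T0 y : a <= y <= b -> T (fun=> 0) y = Z0.
    move=> /andP[ay yb]; have [a0 ct0 dt0] := @TP (fun=> 0) (@within_cont_mx_cst R N p a b 0).
    apply/matrixP => k l; rewrite -[in RHS]a0.
    apply: (@derive0_const _ a y (fun z => T (fun=> 0) z k l)) => //.
      exact: (@within_sub _ a b).
    move=> z /andP[az zy]; have := dt0 z; rewrite az (lt_le_trans zy yb) => /(_ isT k l).
    by rewrite mulmx0 mxE.
  move=> /(_ (@within_cont_mx_cst R N p a b 0)) H; have := H _ x i j xab.
  rewrite T0 //; apply => y k l /andP[ay yb]; rewrite subr0.
  have w1 := weight_ge1 ay.
  by rewrite -[leLHS]mulr1; apply: ler_pM.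
have [Z HZ] : exists Z : R -> 'M[R]_(N, p), forall x i j k, a <= x <= b ->
    `|Z x i j - u k x i j| <= C / 2 ^+ k * weight x.
  have lim x : exists Zx : 'M[R]_(N, p), a <= x <= b -> forall i j k,
      `|Zx i j - u k x i j| <= C / 2 ^+ k * weight x.
    have [xab|] := boolP (a <= x <= b); last by exists 0.
    have H (ij : 'I_N * 'I_p) : exists l, forall k,
        `|l - u k x ij.1 ij.2| <= C * weight x / 2 ^+ k.
      apply: dyadic_limit => k; have := step k x ij.1 ij.2 xab.
      by rewrite !mxE mulrAC.
    have [l Hl] := choice H; exists (\matrix_(i, j) l (i, j)) => _ i j k.
    by rewrite mxE mulrAC; exact: (Hl (i, j)).
  by have [Z HZ] := choice lim; exists Z => x i j k xab; exact: HZ.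
have cZ : within_cont_mx a b Z.
  move=> i j; apply/within_contP => x xab e e0.
  have [k Hk] : exists k, C / 2 ^+ k * weight b < e / 3.
    apply: contrapT => /forallNP H.
    have : e / 3 <= 0.
      apply: (@le_dyadic _ _ (C * weight b)) => k; rewrite addr0 leNgt.
      by apply/negP; rewrite mulrAC; exact: H.
    lra.
  have /within_contP/(_ x xab (e / 3)) := cu k i j.
  move=> [|d d0 Hd]; first by lra.
  exists d => // y yab yx.
  have Ck : 0 <= C / 2 ^+ k by rewrite divr_ge0 ?exprn_ge0.
  have bound w : a <= w <= b -> `|Z w i j - u k w i j| < e / 3.
    move=> wab; apply: le_lt_trans (HZ w i j k wab) _; apply: le_lt_trans Hk.
    by apply: ler_wpM2l => //; apply: weight_le; case/andP: wab.
  have := bound x xab; have := bound y yab; have := Hd y yab yx.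
  rewrite !ltr_norml => /andP[? ?] /andP[? ?] /andP[? ?].
  by apply/andP; split; lra.
have [Ta cT dT] := TP cZ.
have TZ x : a <= x <= b -> T Z x = Z x.
  move=> xab; apply/matrixP => i j; apply/eqP.
  rewrite -subr_eq0 -normr_le0; apply: (@le_dyadic _ _ (C * weight x)) => k.
  rewrite addr0.
  have Ck : 0 <= C / 2 ^+ k by rewrite divr_ge0 ?exprn_ge0.
  have H0 y m l : a <= y <= b -> `|(Z y - u k y) m l| <= C / 2 ^+ k * weight y.
    by move=> yab; rewrite !mxE; exact: HZ.
  have H1 : `|T Z x i j - u k.+1 x i j| <= C / 2 ^+ k / 2 * weight x.
    have := T_contract Ck cZ (cu k) H0 i j xab.
    by rewrite [X in `|X|]mxE [X in _ + X]mxE.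
  have := HZ x i j k.+1 xab.
  rewrite (_ : C / 2 ^+ k.+1 = C / 2 ^+ k / 2); last first.
    by rewrite exprSr; field; rewrite expf_neq0.
  move=> H2.
  have -> : T Z x i j - Z x i j =
    (T Z x i j - u k.+1 x i j) - (Z x i j - u k.+1 x i j) by ring.
  apply: le_trans (ler_normB _ _) _.
  apply: le_trans (lerD H1 H2) _.
  by rewrite le_eqVlt; apply/orP; left; apply/eqP; field; rewrite expf_neq0.
exists (T Z); split => // x /[dup] xab /andP[ax xb].
by rewrite TZ ?ltW //; exact: dT.
Qed.

End step.
End linear_ode.

Section fundamental_solution.
Variables (R : realType) (n : nat) (a b : R) (V : R -> 'M[R]_n).
Hypotheses (ab : a < b) (cV : within_cont_mx a b V).
Hypothesis symV : forall x, (V x)^T = V x.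

Definition schr_mx (lam x : R) : 'M[R]_(n + n) :=
  block_mx 0 1%:M (V x - lam%:M) 0.

Definition symp_mx : 'M[R]_(n + n) := block_mx 0 1%:M (- 1%:M) 0.
Definition pos_mx : 'M[R]_(n + n) := block_mx 1%:M 0 0 0.

Lemma symp_mx_sqr : symp_mx *m symp_mx = - 1%:M.
Proof.
rewrite /symp_mx mulmx_block !mulmx0 !mul0mx !add0r !addr0 mul1mx mulmx1.
by rewrite scalar_mx_block opp_block_mx !oppr0.
Qed.

Lemma schr_mx_symp lam mu x :
  (schr_mx lam x)^T *m symp_mx + symp_mx *m schr_mx mu x = (lam - mu) *: pos_mx.
Proof.
rewrite /schr_mx /symp_mx /pos_mx tr_block_mx !mulmx_block.
rewrite !trmx0 !trmx1 !mulmx0 !mul0mx !add0r !addr0 !mulmx1 !mul1mx !mulmxN !mulmx1.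
rewrite add_block_mx scale_block_mx !scaler0 !addr0 ?mulNmx ?mul1mx subrr.
congr block_mx; rewrite linearB /= symV tr_scalar_mx scalemx1 raddfB /=.
by rewrite opprK addrACA addNr add0r raddfB.
Qed.

Lemma within_cont_schr_mx lam : within_cont_mx a b (schr_mx lam).
Proof.
move=> i j; rewrite /schr_mx.
have [i'|i'] := split_ordP i => ->; have [j'|j'] := split_ordP j => ->.
- by apply: within_ext (@within_cont_cst R a b 0) => x; rewrite block_mxEul mxE.
- by apply: within_ext (@within_cont_cst R a b (1%:M i' j')) => x; rewrite block_mxEur.
- apply: (@within_ext _ _ _ _ (fun x => (V x - lam%:M) i' j')).
    by move=> x; rewrite block_mxEdl.
  exact: (within_cont_sub cV (@within_cont_mx_cst R n n a b lam%:M)).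
- by apply: within_ext (@within_cont_cst R a b 0) => x; rewrite block_mxEdr mxE.
Qed.

Lemma schr_mx_bound lam0 : exists2 M, 0 < M & forall lam, `|lam - lam0| <= 1 ->
  forall x i j, a <= x <= b -> `|schr_mx lam x i j| <= M.
Proof.
have [M M0 HM] := within_cont_mx_bounded (ltW ab) (@within_cont_schr_mx lam0).
exists (M + 1) => [|lam ll x i j xab]; first by rewrite addr_gt0.
have -> : schr_mx lam x i j =
    schr_mx lam0 x i j + (schr_mx lam x - schr_mx lam0 x) i j.
  by rewrite -[in LHS](subrK (schr_mx lam0 x) (schr_mx lam x)) mxE addrC.
apply: (le_trans (ler_normD _ _)); apply: lerD; first exact: HM.
rewrite /schr_mx opp_block_mx add_block_mx !subrr opprB addrC addrA subrK.
have [i'|i'] := split_ordP i => ->; have [j'|j'] := split_ordP j => ->.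
- by rewrite block_mxEul mxE normr0.
- by rewrite block_mxEur mxE normr0.
- rewrite block_mxEdl !mxE; case: eqP => _.
    by rewrite !mulr1n distrC.
  by rewrite !mulr0n subrr normr0.
- by rewrite block_mxEdr mxE normr0.
Qed.

Definition fund (lam : R) : R -> 'M[R]_(n + n) := get [set Z |
  [/\ Z a = 1%:M, within_cont_mx a b Z &
    forall x, a < x < b -> derive_mx x Z (schr_mx lam x *m Z x)]].

Lemma fundP lam : [/\ fund lam a = 1%:M, within_cont_mx a b (fund lam) &
  forall x, a < x < b -> derive_mx x (fund lam) (schr_mx lam x *m fund lam x)].
Proof.
have [M M0 HM] := schr_mx_bound lam.
have bnd x i j : a <= x <= b -> `|schr_mx lam x i j| <= M.
  by apply: HM; rewrite subrr normr0.
exact: (getPex (linear_ode ab M0 bnd (@within_cont_schr_mx lam) 1%:M)).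
Qed.

Lemma fund_lipschitz lam0 : exists2 C, 0 <= C & forall lam, `|lam - lam0| <= 1 ->
  forall x i j, a <= x <= b ->
    `|(fund lam x - fund lam0 x) i j| <= C * `|lam - lam0|.
Proof.
have [M M0 HM] := schr_mx_bound lam0.
have [za cz dz] := fundP lam0.
have [C C0 HC] := within_cont_mx_bounded (ltW ab) cz.
exists (2 * (b - a) * weight a (n + n) M b * C).
  by rewrite !mulr_ge0 ?expR_ge0 ?subr_ge0 // ltW.
move=> lam ll x i j xab; have [ya cy dy] := fundP lam.
pose D x := fund lam x - fund lam0 x.
pose G x := (lam0 - lam) *: (block_mx 0 0 1%:M 0 *m fund lam0 x) : 'M[R]_(n + n).
have AE y : schr_mx lam y - schr_mx lam0 y = (lam0 - lam) *: block_mx 0 0 1%:M 0.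
  rewrite /schr_mx opp_block_mx add_block_mx !subrr opprB addrC addrA subrK.
  by rewrite scale_block_mx !scaler0 scalemx1 raddfB.
have := @linear_ode_bound R a b ab (n + n) M M0 (n + n) (schr_mx lam) (HM lam ll)
  D G (C * `|lam - lam0|) 0.
rewrite add0r => H; have := H _ _ _ _ _ x i j xab.
have -> : 2 * (C * `|lam - lam0| * (b - a)) * weight a (n + n) M b =
  2 * (b - a) * weight a (n + n) M b * C * `|lam - lam0| by ring.
apply.
- by rewrite mulr_ge0 // ltW.
- exact: within_cont_sub.
- move=> y yab; rewrite (_ : _ + _ =
      schr_mx lam y *m fund lam y - schr_mx lam0 y *m fund lam0 y).
    by apply: derive_mx_D; [exact: dy|apply: derive_mx_N; exact: dz].
  rewrite /G scalemxAl -(AE y) /D mulmxBr mulmxBl.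
  by rewrite addrA subrK.
- by move=> k l; rewrite /D ya za subrr mxE normr0.
- move=> y k l yab; rewrite /G mxE normrM distrC mulrC ler_wpM2r //.
  rewrite -(vsubmxK (fund lam0 y)) mul_block_col !mul0mx !addr0 mul1mx.
  have [k'|k'] := split_ordP k => ->.
    by rewrite col_mxEu mxE normr0 ltW.
  by rewrite col_mxEd mxE; apply: HC.
Qed.

(* Lagrange identity, differential form *)
Lemma derive_wronskian lam mu x : a < x < b ->
  derive_mx x (fun y => (fund lam y)^T *m symp_mx *m fund mu y)
    ((lam - mu) *: ((fund lam x)^T *m pos_mx *m fund mu x)).
Proof.
move=> xab; have [_ _ dl] := fundP lam; have [_ _ dm] := fundP mu.
have := derive_mx_mul (derive_mx_mul (derive_mx_tr (dl x xab))
  (derive_mx_cst x symp_mx)) (dm x xab).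
rewrite mulmx0 addr0 trmx_mul -!mulmxA -mulmxDr !mulmxA -mulmxDl.
by rewrite schr_mx_symp // -scalemxAl -scalemxAr mulmxA.
Qed.

Lemma within_wronskian lam mu :
  within_cont_mx a b (fun y => (fund lam y)^T *m symp_mx *m fund mu y).
Proof.
have [_ cl _] := fundP lam; have [_ cm _] := fundP mu.
apply: within_cont_mul => //; apply: within_cont_mul; last exact: within_cont_mx_cst.
exact: within_cont_tr.
Qed.

Lemma fund_symplectic lam x : a <= x <= b ->
  (fund lam x)^T *m symp_mx *m fund lam x = symp_mx.
Proof.
move=> /andP[ax xb]; have [za _ _] := fundP lam.
have E : (fund lam a)^T *m symp_mx *m fund lam a = symp_mx.
  by rewrite za trmx1 mul1mx mulmx1.
rewrite -[RHS]E {E}.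
apply/matrixP => i j; apply: (@derive0_const _ a x (fun y => ((fund lam y)^T *m symp_mx *m fund lam y) i j)) => //.
  by apply: (@within_sub _ a b) => //; exact: within_wronskian.
move=> y /andP[ay yx]; have := @derive_wronskian lam lam y.
by rewrite ay (lt_le_trans yx xb) subrr scale0r => /(_ isT i j); rewrite mxE.
Qed.

Lemma fund_inv lam x : a <= x <= b ->
  fund lam x *m (- symp_mx *m (fund lam x)^T *m symp_mx) = 1%:M.
Proof.
move=> xab; apply: mulmx1C; rewrite -!mulmxA [_^T *m _]mulmxA fund_symplectic //.
by rewrite mulNmx symp_mx_sqr opprK.
Qed.

(* every solution on a subinterval is a combination of the columns of fund *)
Lemma fund_complete lam c d (Y : R -> 'cV[R]_(n + n)) : a <= c -> d <= b ->
  within_cont_mx c d Y ->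
  (forall x, c < x < d -> derive_mx x Y (schr_mx lam x *m Y x)) ->
  exists w, forall x, c <= x <= d -> Y x = fund lam x *m w.
Proof.
move=> ac db cY dY; have [_ cl dl] := fundP lam.
pose W x := (fund lam x)^T *m symp_mx *m Y x.
exists (- symp_mx *m W c) => x /andP[cx xd].
have -> : W c = W x.
  apply/matrixP => i j; apply/esym; apply: (@derive0_const _ c x (fun y => W y i j)) => //.
    apply: (@within_sub _ c d) => //; apply: within_cont_mul => //.
    apply: within_cont_mul; last exact: within_cont_mx_cst.
    move=> k l; apply: (@within_sub _ a b) => //.
    exact: (within_cont_tr cl).
  move=> y /andP[cy yx]; have yab : a < y < b.
    by apply/andP; split; lra.
  have ycd : c < y < d by apply/andP; split; lra.
  have := derive_mx_mul (derive_mx_mul (derive_mx_tr (dl y yab))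
    (derive_mx_cst y symp_mx)) (dY y ycd).
  move=> /(_ i j); rewrite mulmx0 addr0 trmx_mul.
  have -> : (fund lam y)^T *m (schr_mx lam y)^T *m symp_mx *m Y y +
      (fund lam y)^T *m symp_mx *m (schr_mx lam y *m Y y) = 0.
    rewrite -!mulmxA -mulmxDr !mulmxA -mulmxDl schr_mx_symp //.
    by rewrite subrr scale0r mul0mx mulmx0.
  by rewrite mxE.
rewrite /W !mulmxA -[LHS]mul1mx -(@fund_inv lam x); last by apply/andP; split; lra.
by rewrite !mulmxA.
Qed.

End fundamental_solution.

Section symmetric_matrices.
Variable R : realType.
Implicit Types (m : nat).

Lemma symmetric_diag m (B : 'M[R]_m) : B^T = B ->
  exists (P : 'M[R]_m) (d : 'rV[R]_m), P \in unitmx /\ P *m B = diag_mx d *m P.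
Proof.
move=> symB; pose c := real_complex R; pose BC := map_mx c B.
have realc p q (A : 'M[R]_(p, q)) : map_mx c A \is a mxOver Num.real.
  by apply/mxOverP => i j; rewrite mxE; apply/complex_realP; exists (A i j).
have hermB : BC \is hermsymmx.
  apply: realsym_hermsym (realc _ _ B).
  apply/is_hermitianmxP; rewrite expr0 scale1r.
  by apply/matrixP => i j; rewrite !mxE -[in LHS]symB mxE.
have /mxOverP sp_real := hermitian_spectral_diag_real hermB.
have /orthomx_spectralP EB := hermitian_normalmx hermB.
have uP := spectral_unit BC.
set P := spectralmx BC in EB uP; set sp := spectral_diag BC in EB sp_real.
pose d : 'rV[R]_m := map_mx (@complex.Re R) sp.
have spE : sp = map_mx c d.
  by apply/matrixP => i j; rewrite !mxE; apply/esym/RRe_real.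
have sim : similar_in unitmx BC (map_mx c (diag_mx d)).
  exists P => //; apply/(similarP uP).
  by rewrite [in LHS]EB !mulmxA mulmxV // mul1mx map_diag_mx -spE.
have [Q /= /andP[/mxOverP realQ uQ] /(similarP uQ) EQ] :=
  real_similar sim (realc _ _ _) (realc _ _ _).
pose q : 'M[R]_m := map_mx (@complex.Re R) Q.
have QE : Q = map_mx c q.
  by apply/matrixP => i j; rewrite !mxE; apply/esym/RRe_real.
exists q, d; split; first by rewrite -(map_unitmx c) -QE.
by apply: (map_mx_inj (f := c)); rewrite !map_mxM -QE.
Qed.

Lemma rank_diag_mx m (d : 'rV[R]_m) : \rank (diag_mx d) = (\sum_i (d ord0 i != 0%R))%N.
Proof.
elim: m d => [|m IH] d; first by rewrite thinmx0 mxrank0 big_ord0.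
have dE : row_mx (lsubmx (d : 'rV_(1 + m))) (rsubmx (d : 'rV_(1 + m))) = d.
  by rewrite hsubmxK.
have -> : \rank (diag_mx d) = (\rank (diag_mx (lsubmx (d : 'rV_(1 + m)))) +
    \rank (diag_mx (rsubmx (d : 'rV_(1 + m)))))%N.
  by rewrite -rank_diag_block_mx -diag_mx_row dE.
rewrite big_ord_recl IH; congr addn.
  rewrite (_ : diag_mx _ = (d ord0 ord0)%:M); last first.
    apply/matrixP => i j; rewrite !mxE !ord1 eqxx !mulr1n; congr (d _ _).
    by apply/val_inj.
  rewrite rank_rV; congr (nat_of_bool (~~ _)); apply/eqP/eqP => [|->]; last exact: raddf0.
  by move=> /matrixP/(_ 0 0); rewrite !mxE mulr1n.
apply: eq_bigr => i _; rewrite !mxE; congr (nat_of_bool (d _ _ != 0%R)).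
by apply/val_inj.
Qed.


Definition form m (B : 'M[R]_m) (x : 'rV[R]_m) : R := (x *m B *m x^T) ord0 ord0.
Definition sqn m (x : 'rV[R]_m) : R := form 1%:M x.

Lemma formD m (A B : 'M[R]_m) x : form (A + B) x = form A x + form B x.
Proof. by rewrite /form mulmxDr mulmxDl mxE. Qed.

Lemma formN m (A : 'M[R]_m) x : form (- A) x = - form A x.
Proof. by rewrite /form mulmxN mulNmx mxE. Qed.

Lemma formZ m k (A : 'M[R]_m) x : form (k *: A) x = k * form A x.
Proof. by rewrite /form -scalemxAr -scalemxAl mxE. Qed.

Lemma form_congr m p (A : 'M[R]_p) (N : 'M[R]_(m, p)) x :
  form (N *m A *m N^T) x = form A (x *m N).
Proof. by rewrite /form trmx_mul !mulmxA. Qed.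

Lemma sqnE m (x : 'rV[R]_m) : sqn x = \sum_i x ord0 i ^+ 2.
Proof. by rewrite /sqn /form mulmx1 mxE; apply: eq_bigr => i _; rewrite mxE expr2. Qed.

Lemma sqn_ge0 m (x : 'rV[R]_m) : 0 <= sqn x.
Proof. by rewrite sqnE sumr_ge0 // => i _; exact: sqr_ge0. Qed.

Lemma sqn_gt0 m (x : 'rV[R]_m) : x != 0 -> 0 < sqn x.
Proof.
move=> x0; rewrite lt_neqAle sqn_ge0 andbT eq_sym; apply: contra_neq x0 => s0.
apply/rowP => i; rewrite mxE; apply/eqP; rewrite -sqrf_eq0 -normr_le0 -s0 sqnE.
rewrite (bigD1 i) //= ger0_norm ?sqr_ge0 // lerDl sumr_ge0 // => j _.
exact: sqr_ge0.
Qed.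

Lemma form_small m (E : 'M[R]_m) eta x : (forall i j, `|E i j| <= eta) ->
  `|form E x| <= m%:R * eta * sqn x.
Proof.
move=> HE; have -> : form E x = \sum_j \sum_i x ord0 i * E i j * x ord0 j.
  rewrite /form mxE; apply: eq_bigr => j _.
  by rewrite !mxE mulr_suml.
apply: (@le_trans _ _ (\sum_j \sum_i eta * ((x ord0 i ^+ 2 + x ord0 j ^+ 2) / 2))).
  apply: (le_trans (ler_norm_sum _ _ _)); apply: ler_sum => j _.
  apply: (le_trans (ler_norm_sum _ _ _)); apply: ler_sum => i _.
  rewrite !normrM; have := HE i j.
  set u := x ord0 i; set v := x ord0 j => He.
  rewrite -[u ^+ 2]real_normK ?num_real // -[v ^+ 2]real_normK ?num_real //.
  have := normr_ge0 u; have := normr_ge0 v; have := normr_ge0 (E i j).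
  move=> e0 v0 u0; rewrite mulrAC.
  have : `|u| * `|v| <= (`|u| ^+ 2 + `|v| ^+ 2) / 2.
    have := sqr_ge0 (`|u| - `|v|); nra.
  have : 0 <= `|u| * `|v| by rewrite mulr_ge0.
  move: (`|u| * `|v|) ((`|u| ^+ 2 + `|v| ^+ 2) / 2) => s t; nra.
rewrite (eq_bigr (fun j => eta / 2 * sqn x + m%:R * (eta / 2 * x ord0 j ^+ 2))); last first.
  move=> j _; have cst (c : R) : m%:R * c = \sum_(i < m) c.
    by rewrite sumr_const card_ord mulr_natl.
  rewrite sqnE mulr_sumr cst -big_split /=.
  by apply: eq_bigr => i _; field.
rewrite big_split /= sumr_const card_ord -!mulr_sumr -sqnE -mulr_natl.
by rewrite le_eqVlt; apply/orP; left; apply/eqP; field.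
Qed.

Section eigen.
Variables (m : nat) (B P : 'M[R]_m) (d : 'rV[R]_m).
Hypotheses (symB : B^T = B) (uP : P \in unitmx) (PB : P *m B = diag_mx d *m P).

Let G := P *m P^T.

Let G_comm i j : G i j != 0 -> d ord0 i = d ord0 j.
Proof.
have E : diag_mx d *m G = G *m diag_mx d.
  rewrite /G mulmxA -PB -mulmxA -[in RHS]mulmxA.
  rewrite -[P^T *m diag_mx d]trmxK trmx_mul trmxK tr_diag_mx -PB.
  by rewrite trmx_mul symB.
move=> Gij; have /matrixP/(_ i j) := E.
rewrite mul_diag_mx mul_mx_diag mxE [RHS]mxE [RHS]mulrC => H.
exact: (mulIf Gij).
Qed.

Lemma form_ge (c : 'rV[R]_m) delta : (forall i, c ord0 i != 0 -> delta <= d ord0 i) ->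
  delta * sqn (c *m P) <= form B (c *m P).
Proof.
move=> Hc; rewrite -subr_ge0.
pose s : 'rV[R]_m := \row_i (Num.sqrt (d ord0 i - delta) * c ord0 i).
suff -> : form B (c *m P) - delta * sqn (c *m P) = sqn (s *m P) by exact: sqn_ge0.
have expand (u v : 'rV[R]_m) : (u *m G *m v^T) ord0 ord0 =
    \sum_j \sum_i u ord0 i * G i j * v ord0 j.
  by rewrite mxE; apply: eq_bigr => j _; rewrite !mxE mulr_suml.
rewrite /sqn /form !mulmx1 !trmx_mul !mulmxA -!(mulmxA _ P P^T) -/G.
rewrite -(mulmxA c P B) PB !mulmxA -!(mulmxA _ P P^T) -/G !expand.
rewrite mulr_sumr -sumrB; apply: eq_bigr => j _.
rewrite mulr_sumr -sumrB; apply: eq_bigr => i _.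
have Ec k : (c *m diag_mx d) ord0 k = c ord0 k * d ord0 k by rewrite mul_mx_diag mxE.
have Es k : s ord0 k = Num.sqrt (d ord0 k - delta) * c ord0 k by rewrite mxE.
rewrite Ec !Es.
have [ci|ci] := eqVneq (c ord0 i) 0; first by rewrite ci !(mul0r, mulr0) subrr.
have [cj|cj] := eqVneq (c ord0 j) 0; first by rewrite cj !(mul0r, mulr0) subrr.
have [Gij|Gij] := eqVneq (G i j) 0; first by rewrite Gij !(mul0r, mulr0) subrr.
rewrite (G_comm Gij).
have := Hc j cj; rewrite -subr_ge0 => /sqr_sqrtr E.
rewrite -{1}[d ord0 j](subrK delta) -{1}E; ring.
Qed.

End eigen.
End symmetric_matrices.

Section inertia.
Variable R : realType.
Implicit Types (m : nat) (Q : pred R).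

Definition isneg : pred R := fun x => x < 0.
Definition ispos : pred R := fun x => 0 < x.
Definition isnpos : pred R := fun x => x <= 0.
Definition isnneg : pred R := fun x => 0 <= x.
Definition iszero : pred R := fun x => x == 0.

Definition cnt m Q (d : 'rV[R]_m) : nat := (\sum_i (Q (d ord0 i) : nat))%N.

Definition diagonalizes m (B P : 'M[R]_m) (d : 'rV[R]_m) :=
  [/\ B^T = B, P \in unitmx & P *m B = diag_mx d *m P].

Lemma diagonalizesN m (B P : 'M[R]_m) (d : 'rV[R]_m) :
  diagonalizes B P d -> diagonalizes (- B) P (- d).
Proof. by move=> [? ? E]; split => //; rewrite ?linearN //= ?mulmxN ?mulNmx ?E //; congr (- _). Qed.

Lemma eq_cnt m Q Q' (d d' : 'rV[R]_m) :
  (forall i, Q (d ord0 i) = Q' (d' ord0 i)) -> cnt Q d = cnt Q' d'.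
Proof. by move=> H; apply: eq_bigr => i _; rewrite H. Qed.

Lemma cnt_le m Q Q' (d : 'rV[R]_m) : (forall x, Q x -> Q' x) -> (cnt Q d <= cnt Q' d)%N.
Proof.
by move=> H; apply: leq_sum => i _; case: (Q _) (H (d ord0 i)) => // ->.
Qed.

Definition indic m Q (d : 'rV[R]_m) : 'M[R]_m :=
  diag_mx (\row_i (Q (d ord0 i))%:R).

Lemma rank_indic m Q (d : 'rV[R]_m) : \rank (indic Q d) = cnt Q d.
Proof.
by rewrite rank_diag_mx; apply: eq_bigr => i _; rewrite mxE; case: (Q _); rewrite ?oner_eq0 ?eqxx.
Qed.

Lemma mul_indic m Q (d c : 'rV[R]_m) i :
  (c *m indic Q d) ord0 i = c ord0 i * (Q (d ord0 i))%:R.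
Proof. by rewrite mul_mx_diag !mxE. Qed.

(* a subspace of dimension cnt Q d on which B' is negative definite *)
Lemma negative_subspace m (P B' P' : 'M[R]_m) (d d' : 'rV[R]_m) Q :
  P \in unitmx -> diagonalizes B' P' d' ->
  (forall c : 'rV[R]_m, (forall i, c ord0 i != 0 -> Q (d ord0 i)) -> c != 0 ->
     form B' (c *m P) < 0) ->
  (cnt Q d <= cnt isneg d')%N.
Proof.
move=> uP [symB' uP' PB'] Hneg; rewrite leqNgt; apply/negP => lt.
pose A := indic Q d *m P; pose F := invmx P' *m indic isneg d'.
have rA : \rank A = cnt Q d.
  by rewrite mxrankMfree ?rank_indic // row_free_unit.
have rF : (\rank (A *m F) <= cnt isneg d')%N.
  rewrite -(rank_indic isneg d').
  by apply: leq_trans (mxrankM_maxr _ _) _; rewrite mxrankM_maxr.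
have : (A :&: kermx F)%MS != 0.
  rewrite -mxrank_eq0 -lt0n -(ltn_add2l (\rank (A *m F))) addn0 mxrank_mul_ker rA.
  exact: leq_ltn_trans rF lt.
move=> /rowV0Pn[v vAF v0].
have /submxP[c0 vE] : (v <= A)%MS by apply: submx_trans vAF (capmxSl _ _).
have /sub_kermxP vF : (v <= kermx F)%MS by apply: submx_trans vAF (capmxSr _ _).
pose c := c0 *m indic Q d.
have vcP : v = c *m P by rewrite vE /A /c mulmxA.
have cQ i : c ord0 i != 0 -> Q (d ord0 i).
  by rewrite mul_indic; case: (Q _) => //; rewrite mulr0 eqxx.
have cn0 : c != 0 by apply: contra_neq v0 => c00; rewrite vcP c00 mul0mx.
have := Hneg c cQ cn0; rewrite -vcP.
pose c' := v *m invmx P'; have vE' : v = c' *m P' by rewrite mulmxKV.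
rewrite ltNge => /negP; apply; rewrite vE'.
have := form_ge symB' PB' (c := c') (delta := 0); rewrite mul0r; apply => i c'i.
have : (c' *m indic isneg d') ord0 i = 0.
  by rewrite -mulmxA vF mxE.
rewrite mul_indic /isneg; case: ltP => //= _ /eqP; rewrite mulr1.
by rewrite (negPf c'i).
Qed.

Lemma positive_subspace m (P B' P' : 'M[R]_m) (d d' : 'rV[R]_m) Q :
  P \in unitmx -> diagonalizes B' P' d' ->
  (forall c : 'rV[R]_m, (forall i, c ord0 i != 0 -> Q (d ord0 i)) -> c != 0 ->
     0 < form B' (c *m P)) ->
  (cnt Q d <= cnt ispos d')%N.
Proof.
move=> uP dB' H; have := negative_subspace uP (diagonalizesN dB') (d := d) (Q := Q).
rewrite (@eq_cnt _ isneg ispos (- d') d'); last first.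
  by move=> i; rewrite /isneg /ispos mxE oppr_lt0.
by apply => c cQ c0; rewrite formN oppr_lt0; exact: H.
Qed.

Lemma mul_unit_neq0 m (P : 'M[R]_m) (c : 'rV[R]_m) : P \in unitmx -> c != 0 -> c *m P != 0.
Proof.
move=> uP; apply: contra_neq => cP0.
by rewrite -(mulmxK uP c) cP0 mul0mx.
Qed.

(* strict monotonicity of the inertia *)
Lemma inertia_lt m (B P B' P' : 'M[R]_m) (d d' : 'rV[R]_m) :
  diagonalizes B P d -> diagonalizes B' P' d' ->
  (forall x, x != 0 -> form B x < form B' x) ->
  (cnt isnpos d' <= cnt isneg d)%N /\
  (cnt isnneg d <= cnt ispos d')%N.
Proof.
move=> dB dB' lt; split.
  have [_ uP' _] := dB'; apply: (negative_subspace uP' dB) => c cQ c0.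
  have [symNB uP2 PNB] := diagonalizesN dB'.
  apply: lt_le_trans (lt _ (mul_unit_neq0 uP' c0)) _.
  have := form_ge symNB PNB (c := c) (delta := 0).
  rewrite mul0r formN oppr_ge0; apply => i /cQ.
  by rewrite mxE oppr_ge0.
have [symB uP PB] := dB; apply: (positive_subspace uP dB') => c cQ c0.
apply: le_lt_trans (lt _ (mul_unit_neq0 uP c0)).
by have := form_ge symB PB (c := c) (delta := 0); rewrite mul0r; apply => i /cQ.
Qed.

Lemma spectral_gap m (d : 'rV[R]_m) : exists2 delta, 0 < delta &
  forall i, d ord0 i != 0 -> delta <= `|d ord0 i|.
Proof.
have H (s : seq 'I_m) : exists2 delta, 0 < delta &
    forall i, i \in s -> d ord0 i != 0 -> delta <= `|d ord0 i|.
  elim: s => [|j s [delta delta0 IH]]; first by exists 1.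
  have [dj|dj] := eqVneq (d ord0 j) 0.
    exists delta => // i; rewrite inE => /predU1P[->|/IH//].
    by rewrite dj eqxx.
  exists (Num.min delta `|d ord0 j|); first by rewrite lt_min delta0 normr_gt0.
  move=> i; rewrite inE ge_min => /predU1P[-> _|/IH H /H ->//].
  by rewrite lexx orbT.
have [delta delta0 Hd] := H (enum 'I_m).
by exists delta => // i; apply: Hd; rewrite mem_enum.
Qed.

(* lower semicontinuity of the inertia *)
Lemma inertia_near m (B P : 'M[R]_m) (d : 'rV[R]_m) : diagonalizes B P d ->
  exists2 eta, 0 < eta & forall (B' P' : 'M[R]_m) (d' : 'rV[R]_m),
    diagonalizes B' P' d' -> (forall i j, `|(B' - B) i j| <= eta) ->
    (cnt isneg d <= cnt isneg d')%N /\
    (cnt ispos d <= cnt ispos d')%N.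
Proof.
move=> dB; have [delta delta0 gap] := spectral_gap d.
pose eta := delta / (2 * (m.+1)%:R).
have m0 : 0 < 2 * (m.+1)%:R :> R by rewrite mulr_gt0.
have eta0 : 0 < eta by rewrite divr_gt0.
exists eta => // B' P' d' dB' HE.
have small x : x != 0 -> `|form (B' - B) x| < delta * sqn x.
  move=> x0; apply: (le_lt_trans (form_small x HE)).
  rewrite ltr_pM2r ?sqn_gt0 // /eta mulrA ltr_pdivrMr // [_ * delta]mulrC.
  by rewrite ltr_pM2l // -natrM ltr_nat mul2n -addnn ltn_addr.
have fE x : form B' x = form B x + form (B' - B) x.
  by rewrite -formD addrC subrK.
have [symB uP PB] := dB; have [symNB _ PNB] := diagonalizesN dB.
split.
  apply: (negative_subspace uP dB') => c cQ c0.
  have H : delta * sqn (c *m P) <= form (- B) (c *m P).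
    apply: (form_ge symNB PNB) => i /cQ /= di.
    by have := gap i; rewrite lt_eqF // mxE ltr0_norm //; apply.
  rewrite formN in H; rewrite fE; have := small _ (mul_unit_neq0 uP c0).
  rewrite ltr_norml => /andP[_]; lra.
apply: (positive_subspace uP dB') => c cQ c0.
have H : delta * sqn (c *m P) <= form B (c *m P).
  apply: (form_ge symB PB) => i /cQ /= di.
  by have := gap i; rewrite gt_eqF // gtr0_norm //; apply.
rewrite fE; have := small _ (mul_unit_neq0 uP c0).
rewrite ltr_norml => /andP[+ _]; lra.
Qed.

Lemma cnt_split3 m (d : 'rV[R]_m) :
  (cnt isneg d + cnt iszero d + cnt ispos d)%N = m.
Proof.
rewrite /cnt /isneg /ispos /isnpos /isnneg /iszero -!big_split /= -[RHS]card_ord -sum1_card.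
by apply: eq_bigr => i _; case: ltgtP.
Qed.

Lemma cnt_le0 m (d : 'rV[R]_m) :
  cnt isnpos d = (cnt isneg d + cnt iszero d)%N.
Proof.
by rewrite /cnt /isneg /ispos /isnpos /isnneg /iszero -!big_split /=; apply: eq_bigr => i _; case: ltgtP.
Qed.

Lemma cnt_ge0 m (d : 'rV[R]_m) :
  cnt isnneg d = (cnt ispos d + cnt iszero d)%N.
Proof.
by rewrite /cnt /isneg /ispos /isnpos /isnneg /iszero -!big_split /=; apply: eq_bigr => i _; case: ltgtP.
Qed.

Lemma posdef_coercive m (B : 'M[R]_m) : B^T = B -> (forall x, x != 0 -> 0 < form B x) ->
  exists2 delta, 0 < delta & forall x, delta * sqn x <= form B x.
Proof.
move=> symB pos; have [P [d [uP PB]]] := symmetric_diag symB.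
have [delta delta0 gap] := spectral_gap d; exists delta => // x.
have dpos i : 0 < d ord0 i.
  pose e : 'rV[R]_m := delta_mx ord0 i.
  have e0 : e != 0.
    by apply/eqP => /rowP/(_ i)/eqP; rewrite !mxE !eqxx oner_eq0.
  have H : - d ord0 i * sqn (e *m P) <= form (- B) (e *m P).
    have [symNB _ PNB] := diagonalizesN (And3 symB uP PB).
    apply: (form_ge symNB PNB) => j; rewrite !mxE eqxx /=.
    by case: (j =P i) => [->|]; rewrite ?eqxx.
  have eP := mul_unit_neq0 uP e0.
  rewrite formN mulNr lerN2 in H.
  by have := lt_le_trans (pos _ eP) H; rewrite pmulr_lgt0 // sqn_gt0.
rewrite -(mulmxKV uP x); apply: (form_ge symB PB) => i _.
by have := gap i; rewrite gt_eqF // gtr0_norm //; apply.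
Qed.

(* eigenvalue multiplicities as coranks *)
Lemma corank_diagonalizes m (B P : 'M[R]_m) (d : 'rV[R]_m) (u v : R) :
  diagonalizes B P d ->
  (m - \rank (u *: B + v%:M)%R)%N = cnt (fun x => u * x + v == 0)%R d.
Proof.
move=> [_ uP PB].
have E : P *m (u *: B + v%:M) = diag_mx (\row_i (u * d ord0 i + v)) *m P.
  rewrite mulmxDr -scalemxAr PB scalar_mxC scalemxAl -mulmxDl; congr (_ *m _).
  by apply/matrixP => i j; rewrite !mxE; case: eqP => _; rewrite ?mulr1n // !mulr0n mulr0 addr0.
have <- : \rank (P *m (u *: B + v%:M))%R = \rank (u *: B + v%:M)%R.
  have fP : row_full P by rewrite row_full_unit.
  by rewrite (eqmxMfull _ fP).
rewrite E mxrankMfree ?row_free_unit // rank_diag_mx.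
rewrite -[m in (m - _)%N]card_ord -sum1_card.
rewrite (eq_bigr (fun i : 'I_m => ((u * d ord0 i + v == 0)%R +
  ((\row_i0 (u * d ord0 i0 + v)) ord0 i != 0)%R)%N)); last first.
  by move=> i _; rewrite mxE; case: eqP.
by rewrite big_split /= addnK.
Qed.

End inertia.

Lemma ker_basis (F : fieldType) (q m : nat) (A : 'M[F]_(q, m)) :
  exists K : 'M[F]_(m, m - \rank A), [/\ A *m K = 0,
    forall c : 'cV_(m - \rank A), K *m c = 0 -> c = 0 &
    forall z : 'cV_m, A *m z = 0 -> exists c, z = K *m c].
Proof.
have rk : \rank (kermx A^T) = (m - \rank A)%N by rewrite mxrank_ker mxrank_tr.
case: _ / rk; exists (row_base (kermx A^T))^T; split.
- apply: trmx_inj; rewrite trmx_mul trmxK trmx0; apply/sub_kermxP.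
  by rewrite eq_row_base.
- move=> c /(congr1 trmx); rewrite trmx_mul trmxK trmx0 => Kc0.
  apply: trmx_inj; rewrite trmx0; apply/eqP.
  by rewrite -(mulmx_free_eq0 _ (row_base_free (kermx A^T))) Kc0.
- move=> z /(congr1 trmx); rewrite trmx_mul trmx0 => /sub_kermxP zK.
  have /submxP[c zE] : (z^T <= row_base (kermx A^T))%MS by rewrite eq_row_base.
  by exists c^T; rewrite -trmx_mul -zE trmxK.
Qed.

Lemma deficient_ker (F : fieldType) (r k : nat) (C : 'M[F]_(r, k)) :
  (\rank C < k)%N -> exists2 c : 'cV[F]_k, c != 0 & C *m c = 0.
Proof.
move=> rk; have [K [CK inj _]] := ker_basis C.
have pos : (0 < k - \rank C)%N by rewrite subn_gt0.
pose e : 'cV[F]_(k - \rank C) := delta_mx (Ordinal pos) 0.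
exists (K *m e); last by rewrite mulmxA CK mul0mx.
apply/eqP => /inj /matrixP/(_ (Ordinal pos) 0)/eqP.
by rewrite !mxE !eqxx oner_eq0.
Qed.

Lemma singular_ker (F : fieldType) (k : nat) (C : 'M[F]_k) :
  C \notin unitmx -> exists2 c : 'cV[F]_k, c != 0 & C *m c = 0.
Proof.
rewrite -row_free_unit => C0; apply: deficient_ker.
by rewrite ltn_neqAle rank_leq_row andbT.
Qed.

Section cdim.
Variables (R : realType) (U : zmodType) (scale : R[i] -> U -> U).
Implicit Types (N E : set U).

Lemma cdim_kernel (q m : nat) (A : 'M[R[i]]_(q, m)) N E
    (data : U -> 'cV[R[i]]_m) (sol : 'cV[R[i]]_m -> U) :
  (forall u, E u -> A *m data u = 0) ->
  (forall k (e : 'I_k -> U) (c : 'I_k -> R[i]), (forall i, E (e i)) ->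
     \sum_i c i *: data (e i) = 0 -> N (\sum_i scale (c i) (e i))) ->
  (forall z, A *m z = 0 -> E (sol z)) ->
  (forall k (z : 'I_k -> 'cV[R[i]]_m) (c : 'I_k -> R[i]),
     (forall i, A *m z i = 0) ->
     N (\sum_i scale (c i) (sol (z i))) -> \sum_i c i *: z i = 0) ->
  cdim scale N E = ((m - \rank A)%N%:R%:E).
Proof.
move=> Edata dataN solE solN; have [K [AK Kinj Kall]] := ker_basis A.
have mulK k (B : 'M[R[i]]_(m, k)) (c : 'cV[R[i]]_k) :
    B *m c = \sum_i c i 0 *: col i B.
  apply/matrixP => i j; rewrite ord1 mxE summxE; apply: eq_bigr => l _.
  by rewrite !mxE mulrC.
apply/eqP; rewrite eq_le; apply/andP; split.
  apply: ge_ereal_sup => _ [k [e [eE einj]] <-].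
  rewrite lee_fin ler_nat leqNgt; apply/negP => lt.
  have [g Hg] := choice (fun i => Kall _ (Edata _ (eE i))).
  have [c c0 Cc] := deficient_ker (leq_ltn_trans (rank_leq_row (\matrix_(i, j) g j i 0)) lt).
  case/eqP: c0; apply/matrixP => i j; rewrite ord1 mxE; apply: (einj (fun i => c i 0)).
  apply: dataN => //; under eq_bigr do rewrite Hg scalemxAr.
  rewrite -mulmx_sumr (_ : \sum_i _ = 0) ?mulmx0 //.
  apply: etrans Cc; apply/matrixP => p l; rewrite ord1 summxE mxE.
  by apply: eq_bigr => h _; rewrite !mxE mulrC.
apply: ereal_sup_ubound; exists (m - \rank A)%N => //.
have Kcol i : A *m col i K = 0 by rewrite colE mulmxA AK mul0mx.
exists (fun i => sol (col i K)); split => [i|c].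
  exact: solE.
move=> /solN => /(_ Kcol) Kc i.
have /Kinj/matrixP/(_ i 0) : K *m (\col_i c i) = 0.
  by rewrite mulK -[RHS]Kc; apply: eq_bigr => l _; rewrite mxE.
by rewrite !mxE.
Qed.

End cdim.

Lemma mulmx1C_dim (F : comUnitRingType) (p q : nat) (A : 'M[F]_(p, q)) (B : 'M[F]_(q, p)) :
  p = q -> A *m B = 1%:M -> B *m A = 1%:M.
Proof. by move=> e; case: q / e A B => A B; exact: mulmx1C. Qed.

Lemma sympl_tr (R : realType) (d : nat) (Om : 'M[R]_d) (u v : 'cV[R]_d) :
  sympl Om u v = (v^T *m Om *m u) 0 0.
Proof.
have E (A : 'M[R]_1) : A 0 0 = A^T 0 0 by rewrite mxE.
by rewrite /sympl E trmx_mul trmxK mulmxA.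
Qed.

Lemma complex_mulmx (R : realType) (p q : nat) (P : 'M[R]_(p, q)) (z : 'cV[R[i]]_q) i :
  (map_mx (real_complex R) P *m z) i 0 =
  Complex ((P *m map_mx (@complex.Re R) z) i 0) ((P *m map_mx (@complex.Im R) z) i 0).
Proof.
rewrite !mxE; elim/big_ind3 : _ => //= [x1 x2 x3 y1 y2 y3 -> ->//|j _].
by rewrite !mxE; case: (z j 0) => a b; congr Complex => /=; ring.
Qed.

Lemma complex_ker (R : realType) (p q : nat) (P : 'M[R]_(p, q)) (z : 'cV[R[i]]_q) :
  map_mx (real_complex R) P *m z = 0 <->
  P *m map_mx (@complex.Re R) z = 0 /\ P *m map_mx (@complex.Im R) z = 0.
Proof.
split=> [H|[H1 H2]].
  by split; apply/matrixP => i j; rewrite ord1 [RHS]mxE;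
    have := complex_mulmx P z i; rewrite H mxE => -[].
by apply/matrixP => i j; rewrite ord1 complex_mulmx H1 H2 !mxE.
Qed.

Section frames.
Variables (R : realType) (d D : nat) (Om : 'M[R]_d).
Hypotheses (dD : d = (D + D)%N) (Om2 : Om *m Om = - 1%:M) (OmT : Om^T = - Om).

Definition plane (Z : 'M[R]_(d, D)) : set 'cV[R]_d := range (fun w : 'cV_D => Z *m w).

Definition lagrangian_frame (Z : 'M[R]_(d, D)) :=
  Z^T *m Om *m Z = 0 /\ Z^T *m Z \in unitmx.

Definition frame_proj (Z : 'M[R]_(d, D)) := Z *m invmx (Z^T *m Z) *m Z^T.

Section one_frame.
Variable Z : 'M[R]_(d, D).
Hypothesis lagZ : lagrangian_frame Z.
Let G := Z^T *m Z.
Let ZOZ : Z^T *m Om *m Z = 0. Proof. by case: lagZ. Qed.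
Let uG : G \in unitmx. Proof. by case: lagZ. Qed.

Lemma frame_proj_complete : frame_proj Z - Om *m frame_proj Z *m Om = 1%:M.
Proof.
pose Q := row_mx Z (Om *m Z); pose H := block_mx (invmx G) 0 0 (invmx G).
have E : (H *m Q^T) *m Q = 1%:M.
  rewrite -mulmxA tr_row_mx mul_col_row !trmx_mul OmT !mulmxN !mulNmx.
  rewrite !mulmxA ZOZ -(mulmxA _ Om Om) Om2 !mulmxN mulmx1 mulNmx opprK oppr0.
  rewrite mulmx_block !mulmx0 !mul0mx !addr0 !add0r -/G mulVmx //.
  by rewrite scalar_mx_block.
have := mulmx1C_dim (esym dD) E.
rewrite tr_row_mx mul_block_col mul_row_col !mul0mx addr0 add0r.
by rewrite trmx_mul OmT !mulmxN !mulmxA /frame_proj.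
Qed.

Lemma frame_proj_sym : (frame_proj Z)^T = frame_proj Z.
Proof.
by rewrite /frame_proj !trmx_mul trmxK trmx_inv trmx_mul trmxK mulmxA.
Qed.

Lemma frame_projK : frame_proj Z *m Z = Z.
Proof. by rewrite /frame_proj -!mulmxA mulVmx // mulmx1. Qed.

Lemma frame_proj_idem : frame_proj Z *m frame_proj Z = frame_proj Z.
Proof. by rewrite {2}/frame_proj !mulmxA frame_projK. Qed.

Lemma plane_frame_proj : plane Z = range (fun u : 'cV_d => frame_proj Z *m u).
Proof.
apply/seteqP; split => u [w _ <-].
  by exists (Z *m w) => //; rewrite mulmxA frame_projK.
by exists (invmx G *m Z^T *m w) => //; rewrite /frame_proj !mulmxA.
Qed.

Lemma orthproj_plane : orthproj (plane Z) = frame_proj Z.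
Proof.
apply: xget_unique; first by split; [exact: frame_proj_sym|exact: frame_proj_idem|exact: plane_frame_proj].
move=> Q [symQ Q2 rQ].
have fix1 : Q *m frame_proj Z = frame_proj Z.
  apply/matrixP => i j; have : plane Z (col j (frame_proj Z)).
    by rewrite plane_frame_proj; exists (delta_mx j 0) => //; rewrite colE.
  rewrite rQ => -[u _ E].
  have : Q *m col j (frame_proj Z) = col j (frame_proj Z) by rewrite -E mulmxA Q2.
  move=> /matrixP/(_ i 0); rewrite [in RHS]mxE => <-.
  by rewrite colE mulmxA -colE [RHS]mxE.
have fix2 : frame_proj Z *m Q = Q.
  apply/matrixP => i j; have : plane Z (col j Q).
    by rewrite rQ; exists (delta_mx j 0) => //; rewrite colE.
  rewrite plane_frame_proj => -[u _ E].
  have : frame_proj Z *m col j Q = col j Q by rewrite -E mulmxA frame_proj_idem.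
  move=> /matrixP/(_ i 0); rewrite [in RHS]mxE => <-.
  by rewrite colE mulmxA -colE [RHS]mxE.
by rewrite -fix2 -[LHS]trmxK trmx_mul symQ frame_proj_sym fix1 frame_proj_sym.
Qed.

Lemma lagrangian_plane : lagrangian Om (plane Z).
Proof.
apply/seteqP; split => u /=.
  move=> [w _ <-] _ [v _ <-].
  by rewrite /sympl !trmx_mul OmT !mulmxA mulmxN !mulNmx -!(mulmxA w^T) ZOZ mul0mx mulmx0 oppr0 mxE.
move=> H.
have ZOu : Z^T *m Om *m u = 0.
  apply/matrixP => i j; rewrite ord1 [RHS]mxE.
  have := H (Z *m delta_mx i 0); rewrite sympl_tr trmx_mul trmx_delta.
  rewrite -!mulmxA -rowE mxE !mulmxA; apply.
  by exists (delta_mx i 0).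
exists (invmx G *m Z^T *m u) => //.
rewrite !mulmxA -/(frame_proj Z).
rewrite -[RHS]mul1mx -frame_proj_complete mulmxBl {2}/frame_proj -!mulmxA.
by rewrite [Z^T *m (Om *m u)]mulmxA ZOu !mulmx0 subr0.
Qed.

Lemma Om_frame_proj : Om *m frame_proj Z = (1%:M - frame_proj Z) *m Om.
Proof.
rewrite -frame_proj_complete addrAC subrr sub0r mulNmx -!mulmxA Om2.
by rewrite !mulmxN mulmx1 opprK /frame_proj !mulmxA.
Qed.

End one_frame.


Section two_frames.
Variables (X Z : 'M[R]_(d, D)).
Hypotheses (lagX : lagrangian_frame X) (XX : X^T *m X = 1%:M).
Hypothesis lagZ : lagrangian_frame Z.

Definition frame_re := X^T *m Z.
Definition frame_im := - (X^T *m Om *m Z).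
Definition pencil (x : R) := frame_im - x *: frame_re.

Let G := Z^T *m Z.
Let uG : G \in unitmx. Proof. by case: lagZ. Qed.
Let ZOZ : Z^T *m Om *m Z = 0. Proof. by case: lagZ. Qed.
Let XOX : X^T *m Om *m X = 0. Proof. by case: lagX. Qed.
Let PX := frame_proj X.
Let PZ := frame_proj Z.

Let PXE : PX = X *m X^T.
Proof. by rewrite /PX /frame_proj XX invmx1 mulmx1. Qed.

Lemma frame_decomp : Z = X *m frame_re + Om *m X *m frame_im.
Proof.
rewrite -[LHS]mul1mx -(frame_proj_complete lagX) -/PX PXE mulmxBl.
by rewrite /frame_re /frame_im mulmxN !mulmxA.
Qed.

Let coord (v : 'cV[R]_d) : 'cV[R]_D := invmx G *m Z^T *m v.

Let coordP v : v = Z *m coord v + Om *m Z *m coord (- (Om *m v)).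
Proof.
rewrite -[LHS]mul1mx -(frame_proj_complete lagZ) mulmxBl /coord /frame_proj.
by rewrite -/G !mulmxN !mulmxA.
Qed.

Let coordZ w : coord (Z *m w) = w.
Proof. by rewrite /coord !mulmxA -[invmx G *m Z^T *m Z]mulmxA mulVmx // mul1mx. Qed.

Let coordOZ w : coord (Om *m Z *m w) = 0.
Proof.
rewrite /coord !mulmxA -(mulmxA _ Z^T) -(mulmxA _ (Z^T *m Om)) ZOZ.
by rewrite mulmx0 mul0mx.
Qed.

Let rot (c s : R) (v : 'cV[R]_d) : 'cV[R]_d := c *: v + s *: (Om *m v).

Let OmOm (v : 'cV[R]_d) : Om *m (Om *m v) = - v.
Proof. by rewrite mulmxA Om2 mulNmx mul1mx. Qed.

Let rotD c s u v : rot c s (u + v) = rot c s u + rot c s v.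
Proof. by rewrite /rot mulmxDr !scalerDr addrACA. Qed.

Let rotOm c s v : rot c s (Om *m v) = Om *m rot c s v.
Proof. by rewrite /rot mulmxDr -!scalemxAr. Qed.

Let rotrot c s c' s' v : rot c s (rot c' s' v) = rot (c * c' - s * s') (c * s' + s * c') v.
Proof.
rewrite /rot mulmxDr -!scalemxAr OmOm; move: (Om *m v) => w.
by apply/matrixP => i j; rewrite !mxE; ring.
Qed.

Variables (c s : R).
Hypothesis cs1 : c ^+ 2 + s ^+ 2 = 1.
Hypothesis c0 : c != 0.

Let rotK v : rot c (- s) (rot c s v) = v.
Proof.
rewrite rotrot mulNr opprK -!expr2 cs1 mulNr [s * c]mulrC subrr.
by rewrite /rot scale1r scale0r addr0.
Qed.
Let rotK' v : rot c s (rot c (- s) v) = v.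
Proof.
rewrite rotrot mulrN opprK -!expr2 cs1 mulrN [s * c]mulrC addNr.
by rewrite /rot scale1r scale0r addr0.
Qed.

Let tau (P : 'M[R]_d) (v : 'cV[R]_d) : 'cV[R]_d := 2 *: (P *m v) - v.

Let tauOm (P : 'M[R]_d) v : Om *m P = (1%:M - P) *m Om -> tau P (Om *m v) = - (Om *m tau P v).
Proof.
move=> OP; rewrite /tau mulmxBr -scalemxAr !(mulmxA Om) OP mulmxA.
have -> : P *m Om = Om - (1%:M - P) *m Om by rewrite mulmxBl mul1mx opprB addrC subrK.
rewrite mulmxBl; move: (_ *m _ *m v) (Om *m v) => w w'.
by apply/matrixP => i j; rewrite !mxE; ring.
Qed.

Let tau_tau (P : 'M[R]_d) v : P *m P = P -> tau P (tau P v) = v.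
Proof.
move=> PP; rewrite /tau mulmxBr -scalemxAr !mulmxA PP; move: (P *m v) => w.
by apply/matrixP => i j; rewrite !mxE; ring.
Qed.

Let im_rot w : X^T *m Om *m rot c (- s) (Z *m w) = - c *: (pencil (s / c) *m w).
Proof.
rewrite /rot mulmxDr -!scalemxAr !mulmxA -[X^T *m Om *m Om]mulmxA Om2 mulmxN mulmx1.
rewrite mulNmx /pencil mulmxBl -scalemxAl /frame_im !mulNmx /frame_re.
move: (_ *m w) (_ *m w) => p q.
by apply/matrixP => i j; rewrite !mxE; field.
Qed.

Let rot_plane w : (X^T *m Om *m rot c (- s) (Z *m w) = 0) <-> pencil (s / c) *m w = 0.
Proof.
rewrite im_rot; split => [/eqP|->]; last by rewrite scaler0.
by rewrite scaler_eq0 oppr_eq0 (negPf c0) => /eqP.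
Qed.

Let in_X (x : 'cV[R]_d) : X^T *m Om *m x = 0 -> (1%:M - PX) *m x = 0.
Proof.
move=> H; have -> : 1%:M - PX = - (Om *m PX *m Om).
  by rewrite -(frame_proj_complete lagX) -/PX addrAC subrr sub0r.
by rewrite PXE mulNmx -!mulmxA [X^T *m _]mulmxA H !mulmx0 oppr0.
Qed.

(* v = Z w1 + i Z w2 is turned by the angle of (c, -s); the result is an
   eigenvector exactly when both rotated components lie in the plane of X *)
Lemma souriau_kernel u :
  (souriau (plane X) (plane Z) *m u = rot (- (c * c - s * s)) (- (c * s + s * c)) u) <->
  pencil (s / c) *m coord (rot c s u) = 0 /\
  pencil (s / c) *m coord (- (Om *m rot c s u)) = 0.
Proof.
have idX := frame_proj_idem lagX; have idZ := frame_proj_idem lagZ.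
have OX := Om_frame_proj lagX; have OZ := Om_frame_proj lagZ.
set v := rot c s u; set w1 := coord v; set w2 := coord _.
have vE : v = Z *m w1 + Om *m (Z *m w2) by rewrite mulmxA -coordP.
pose x1 := rot c (- s) (Z *m w1); pose x2 := rot c (- s) (Z *m w2).
have uE : u = x1 + Om *m x2 by rewrite -[LHS]rotK -/v vE rotD rotOm.
have sE : souriau (plane X) (plane Z) *m u = - tau PZ (tau PX u).
  rewrite /souriau !orthproj_plane // -/PX -/PZ -mulmxA.
  by rewrite !mulmxBl !mul1mx -!scalemxAl /tau opprB.
have rE : rot (- (c * c - s * s)) (- (c * s + s * c)) u = - rot c s v.
  by rewrite /v rotrot /rot !scaleNr opprD.
have tZ w : tau PZ (Z *m w) = Z *m w.
  by rewrite /tau mulmxA frame_projK // scaler_nat mulr2n addrK.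
have tvE : tau PZ (rot c s v) = x1 - Om *m x2.
  have tD a b p q : tau PZ (a *: p + b *: q) = a *: tau PZ p + b *: tau PZ q.
    rewrite /tau mulmxDr -!scalemxAr; move: (PZ *m p) (PZ *m q) => p' q'.
    by apply/matrixP => i j; rewrite !mxE; ring.
  have tv : tau PZ v = Z *m w1 - Om *m (Z *m w2).
    rewrite vE -[X in X + _]scale1r -[X in _ + X]scale1r tD !scale1r tauOm //.
    by rewrite !tZ.
  rewrite {1}/rot tD tauOm // tv.
  rewrite /x1 /x2 -rotOm /rot mulmxBr.
  move: (Z *m w1) (Om *m (Z *m w2)) => p q; move: (Om *m p) (Om *m q) => p' q'.
  by apply/matrixP => i j; rewrite !mxE; ring.
rewrite sE rE.
have eqv : (- tau PZ (tau PX u) = - rot c s v) <-> (tau PX u = x1 - Om *m x2).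
  split => [/oppr_inj E|E]; first by rewrite -tvE -E tau_tau.
  by congr (- _); rewrite -[RHS](tau_tau _ idZ) tvE E.
have key : (tau PX u = x1 - Om *m x2) <-> ((1%:M - PX) *m x1 = Om *m ((1%:M - PX) *m x2)).
  have t2 x : tau PX x = x - 2 *: ((1%:M - PX) *m x).
    rewrite /tau mulmxBl mul1mx; move: (PX *m x) => p.
    by apply/matrixP => i j; rewrite !mxE; ring.
  have tuE : tau PX u = x1 - Om *m x2 -
      2 *: ((1%:M - PX) *m x1 - Om *m ((1%:M - PX) *m x2)).
    have -> : tau PX u = tau PX x1 + tau PX (Om *m x2).
      by rewrite uE /tau mulmxDr scalerDr opprD addrACA.
    rewrite tauOm // !t2 mulmxBr -scalemxAr.
    move: (_ *m x1) (Om *m (_ *m x2)) (Om *m x2) => p q r.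
    by apply/matrixP => i j; rewrite !mxE; ring.
  rewrite tuE; split => [/eqP|->]; last by rewrite subrr scaler0 subr0.
  rewrite -[X in _ == X]addr0 (inj_eq (addrI _)) oppr_eq0 scaler_eq0 pnatr_eq0 /=.
  by rewrite subr_eq0 => /eqP.
have both : ((1%:M - PX) *m x1 = Om *m ((1%:M - PX) *m x2)) <->
    (X^T *m Om *m x1 = 0 /\ X^T *m Om *m x2 = 0).
  split=> [E|[/in_X -> /in_X ->]]; last by rewrite mulmx0.
  have XPX : X^T *m (1%:M - PX) = 0 by rewrite mulmxBr mulmx1 PXE mulmxA XX mul1mx subrr.
  have XOP : X^T *m Om *m (1%:M - PX) = X^T *m Om.
    by rewrite mulmxBr mulmx1 PXE !mulmxA XOX mul0mx subr0.
  have red (x : 'cV[R]_d) : X^T *m Om *m ((1%:M - PX) *m x) = X^T *m Om *m x.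
    by rewrite [LHS]mulmxA XOP.
  have zero (x : 'cV[R]_d) : X^T *m ((1%:M - PX) *m x) = 0.
    by rewrite mulmxA XPX mul0mx.
  split.
    rewrite -red E -mulmxA OmOm mulmxN zero oppr0 //.
  by rewrite -red -[LHS]mulmxA -E zero.
rewrite eqv key both /x1 /x2.
by split => -[/rot_plane ? /rot_plane ?].
Qed.


Let data (u : 'cV[R]_d) : 'cV[R[i]]_D :=
  \col_i Complex (coord (rot c s u) i 0) (coord (- (Om *m rot c s u)) i 0).

Let Re_data u : map_mx (@complex.Re R) (data u) = coord (rot c s u).
Proof. by apply/matrixP => i j; rewrite !mxE ord1. Qed.

Let Im_data u : map_mx (@complex.Im R) (data u) = coord (- (Om *m rot c s u)).
Proof. by apply/matrixP => i j; rewrite !mxE ord1. Qed.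

Let coordD a b u v : coord (a *: u + b *: v) = a *: coord u + b *: coord v.
Proof. by rewrite /coord mulmxDr -!scalemxAr. Qed.

Let coordN u : coord (- u) = - coord u.
Proof. by rewrite /coord mulmxN. Qed.

Let data_inj u : data u = 0 -> u = 0.
Proof.
move=> u0; rewrite -[LHS]rotK [rot c s u]coordP -Re_data -Im_data u0.
by rewrite !map_mx0 !mulmx0 addr0 /rot mulmx0 !scaler0 addr0.
Qed.

Let dataZ k u : data (omscale Om k u) = k *: data u.
Proof.
have E1 : rot c s (omscale Om k u) =
    complex.Re k *: rot c s u + complex.Im k *: (Om *m rot c s u).
  by rewrite /omscale /rot !mulmxDr -!scalemxAr OmOm; move: (Om *m u) => w;
    apply/matrixP => i j; rewrite !mxE; ring.
have E2 : - (Om *m rot c s (omscale Om k u)) =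
    complex.Re k *: - (Om *m rot c s u) + complex.Im k *: rot c s u.
  by rewrite E1 mulmxDr -!scalemxAr OmOm opprD scalerN scalerN opprK.
have F2 : coord (- (Om *m rot c s (omscale Om k u))) = complex.Re k *: coord (- (Om *m rot c s u)) +
    complex.Im k *: coord (rot c s u) by rewrite E2 coordD.
have F1 : coord (rot c s (omscale Om k u)) =
    complex.Re k *: coord (rot c s u) + complex.Im k *: coord (Om *m rot c s u).
  by rewrite E1 coordD.
apply/matrixP => i j; rewrite mxE F1 F2 {F1 F2}.
have -> : coord (Om *m rot c s u) = - coord (- (Om *m rot c s u)).
  by rewrite -coordN opprK.
rewrite /data; move: (coord (rot c s u)) (coord (- (Om *m rot c s u))) => p q; rewrite !mxE; move: (p i 0) (q i 0) => {}p {}q.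
by case: k {E1 E2} => a b; congr Complex => /=; ring.
Qed.

Let dataD u v : data (u + v) = data u + data v.
Proof.
have coordA x y : coord (x + y) = coord x + coord y by rewrite /coord mulmxDr.
have F1 : coord (rot c s (u + v)) = coord (rot c s u) + coord (rot c s v).
  by rewrite rotD coordA.
have F2 : coord (- (Om *m rot c s (u + v))) =
    coord (- (Om *m rot c s u)) + coord (- (Om *m rot c s v)).
  by rewrite rotD mulmxDr opprD coordA.
rewrite /data; apply/matrixP => i j; rewrite mxE F1 F2 {F1 F2}.
move: (coord (rot c s u)) (coord (- (Om *m rot c s u))) => p q.
move: (coord (rot c s v)) (coord (- (Om *m rot c s v))) => p' q'.
by rewrite !mxE.
Qed.

Let data_sum k (e : 'I_k -> 'cV[R]_d) (a : 'I_k -> R[i]) :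
  data (\sum_i omscale Om (a i) (e i)) = \sum_i a i *: data (e i).
Proof.
elim/big_ind2 : _ => [|x1 x2 y1 y2 <- <-|i _]; last exact: dataZ.
  have -> : 0 = omscale Om 0 (0 : 'cV[R]_d) by rewrite /omscale /= !scale0r addr0.
  by rewrite dataZ scale0r.
exact: dataD.
Qed.

Let sol (z : 'cV[R[i]]_D) : 'cV[R]_d :=
  rot c (- s) (Z *m map_mx (@complex.Re R) z + Om *m (Z *m map_mx (@complex.Im R) z)).

Let dataK z : data (sol z) = z.
Proof.
have coordA u v : coord (u + v) = coord u + coord v by rewrite /coord mulmxDr.
apply/matrixP => i j; rewrite mxE /sol rotK' mulmxDr OmOm opprD opprK.
rewrite !coordA coordZ mulmxA coordOZ coordN mulmxA coordOZ coordZ oppr0 add0r addr0.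
by rewrite !mxE ord1; case: (z i 0).
Qed.

Definition double_angle : R[i] := Complex (- (c * c - s * s)) (- (c * s + s * c)).

Let omker_data u : omker Om (souriau (plane X) (plane Z)) double_angle u <->
  map_mx (real_complex R) (pencil (s / c)) *m data u = 0.
Proof.
rewrite /omker /= complex_ker Re_data Im_data; exact: souriau_kernel.
Qed.

Theorem cdim_souriau :
  cdim (omscale Om) [set 0] (omker Om (souriau (plane X) (plane Z)) double_angle) =
  ((D - \rank (pencil (s / c)))%N%:R)%:E.
Proof.
rewrite -(mxrank_map (real_complex R)).
apply: (cdim_kernel (data := data) (sol := sol)).
- by move=> u /omker_data.
- by move=> k e a _ H; apply: data_inj; rewrite data_sum.
- by move=> z Az; apply/omker_data; rewrite dataK.
- move=> k z a _ /= H; have := data_sum (fun i => sol (z i)) a; rewrite H.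
  have -> : data 0 = 0.
    by have := data_sum (fun _ : 'I_0 => 0) (fun=> 0); rewrite !big_ord0.
  by move=> E; rewrite [RHS]E; apply: eq_bigr => i _; rewrite dataK.
Qed.

Theorem omspec_souriau :
  omspec Om (souriau (plane X) (plane Z)) double_angle <-> pencil (s / c) \notin unitmx.
Proof.
split=> [[u u0 /omker_data/complex_ker]|].
  rewrite Re_data Im_data => -[H1 H2]; apply/negP => uP.
  have inj w : pencil (s / c) *m w = 0 -> w = 0 :> 'cV_D.
    by move=> H; rewrite -(mulKmx uP w) H mulmx0.
  case/eqP: u0; apply: data_inj; apply/matrixP => i j.
  by rewrite mxE (inj _ H1) (inj _ H2) !mxE.
move=> /singular_ker[w w0 Pw].
pose z := map_mx (real_complex R) w.
have Re_z : map_mx (@complex.Re R) z = w by apply/matrixP => i j; rewrite !mxE.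
have Im_z : map_mx (@complex.Im R) z = 0 by apply/matrixP => i j; rewrite !mxE.
exists (sol z); last first.
  by apply/omker_data; rewrite dataK; apply/complex_ker; rewrite Re_z Im_z mulmx0.
apply: contra_neq w0 => s0; rewrite -Re_z -(dataK z) s0.
have -> : data 0 = 0.
  by have := data_sum (fun _ : 'I_0 => 0) (fun=> 0); rewrite !big_ord0.
by rewrite map_mx0.
Qed.

End two_frames.
End frames.

Section arcs.
Variables (R : realType) (d D : nat) (Om : 'M[R]_d).
Hypotheses (dD : d = (D + D)%N) (Om2 : Om *m Om = - 1%:M) (OmT : Om^T = - Om).
Variable X : 'M[R]_(d, D).
Hypotheses (lagX : lagrangian_frame Om X) (XX : X^T *m X = 1%:M).

(* half-angle tangent *)
Definition slope (al : R) : R := tan (al / 2).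

Lemma half_angle (al : R) : 0 <= al < pi -> - (pi / 2) < al / 2 < pi / 2.
Proof. by move=> /andP[? ?]; have p0 := pi_gt0 R; apply/andP; split; lra. Qed.

Lemma slope_ge0 (al : R) : 0 <= al < pi -> 0 <= slope al.
Proof.
move=> h; rewrite -tan0 /slope leNgt ltr_tan ?in_itv /= ?half_angle //.
  by case/andP: h => ? ?; rewrite -leNgt; lra.
by have p0 := pi_gt0 R; apply/andP; split; lra.
Qed.

Lemma slope_lt (al be : R) : 0 <= al < pi -> 0 <= be < pi -> (slope al < slope be) = (al < be).
Proof.
move=> ha hb; rewrite ltr_tan ?in_itv /= ?half_angle //.
by rewrite ltr_pM2r ?invr_gt0.
Qed.

Lemma slope_gt0 (al : R) : 0 < al < pi -> 0 < slope al.
Proof.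
move=> /andP[a0 ap]; have := @slope_lt 0 al; rewrite /slope mul0r tan0 => -> //.
  by rewrite lexx pi_gt0.
by rewrite ltW.
Qed.

Lemma slope_surj (x : R) : 0 <= x -> exists2 al, 0 <= al < pi & slope al = x.
Proof.
move=> x0; exists (2 * atan x); last by rewrite /slope mulrAC divff // mul1r atanK.
have := atan_ltpi2 x; rewrite ltr_pdivlMr // mulrC => ->; rewrite andbT.
rewrite mulr_ge0 // leNgt; apply/negP => a0.
have : tan (atan x) < tan 0.
  rewrite ltr_tan ?in_itv /= ?atan_gtNpi2 ?atan_ltpi2 //.
  by have p0 := pi_gt0 R; apply/andP; split; lra.
by rewrite atanK tan0; lra.
Qed.

Lemma expi_double (al : R) : expi (pi + al) =
  double_angle (cos (al / 2)) (sin (al / 2)).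
Proof.
rewrite /expi /double_angle addrC cosDpi sinDpi.
have -> : cos al = cos (al / 2 + al / 2) by congr cos; field.
have -> : sin al = sin (al / 2 + al / 2) by congr sin; field.
by rewrite cosD sinD; congr Complex; ring.
Qed.

Lemma cos_half_neq0 (al : R) : 0 <= al < pi -> cos (al / 2) != 0.
Proof. by move=> h; rewrite gt_eqF // cos_gt0_pihalf // half_angle. Qed.

Lemma cdim_souriau_slope Z (al : R) : lagrangian_frame Om Z -> 0 <= al < pi ->
  cdim (omscale Om) [set 0]
    (omker Om (souriau (plane X) (plane Z)) (expi (pi + al))) =
  ((D - \rank (pencil Om X Z (slope al)))%N%:R)%:E.
Proof.
by move=> lagZ h; rewrite expi_double cdim_souriau ?cos2Dsin2 ?cos_half_neq0.
Qed.

Lemma omspec_souriau_slope Z (al : R) : lagrangian_frame Om Z -> 0 <= al < pi ->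
  omspec Om (souriau (plane X) (plane Z)) (expi (pi + al)) <->
  pencil Om X Z (slope al) \notin unitmx.
Proof.
by move=> lagZ h; rewrite expi_double omspec_souriau ?cos2Dsin2 ?cos_half_neq0.
Qed.

Lemma frame_form Z Z' : lagrangian_frame Om Z -> lagrangian_frame Om Z' ->
  Z^T *m Om *m Z' = (frame_im Om X Z)^T *m frame_re X Z' -
                    (frame_re X Z)^T *m frame_im Om X Z'.
Proof.
move=> lagZ lagZ'; have [XOX _] := lagX.
have gen (a b a' b' : 'M[R]_D) :
    (X *m a + Om *m X *m b)^T *m Om *m (X *m a' + Om *m X *m b') = b^T *m a' - a^T *m b'.
  rewrite [(_ + _)^T]linearD /= !trmx_mul OmT mulmxDl mulmxDl !mulmxDr.
  have -> : a^T *m X^T *m Om *m (X *m a') = 0.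
    by rewrite !mulmxA -!(mulmxA a^T) XOX mul0mx mulmx0.
  have -> : a^T *m X^T *m Om *m (Om *m X *m b') = - (a^T *m b').
    rewrite !mulmxA -(mulmxA _ Om Om) Om2 mulmxN mulmx1 !mulNmx.
    by rewrite -(mulmxA a^T) XX mulmx1.
  have -> : b^T *m (X^T *m - Om) *m Om *m (X *m a') = b^T *m a'.
    rewrite !mulmxN !mulNmx !mulmxA -(mulmxA _ Om Om) Om2 mulmxN mulmx1 !mulNmx opprK.
    by rewrite -(mulmxA b^T) XX mulmx1.
  have -> : b^T *m (X^T *m - Om) *m Om *m (Om *m X *m b') = 0.
    rewrite !mulmxN !mulNmx !mulmxA -(mulmxA _ Om Om) Om2 mulmxN mulmx1 !mulNmx opprK.
    by rewrite -!(mulmxA b^T) XOX mul0mx mulmx0.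
  by rewrite add0r addr0 addrC.
have := gen (frame_re X Z) (frame_im Om X Z) (frame_re X Z') (frame_im Om X Z').
by rewrite -!frame_decomp.
Qed.

Section cayley.
Variables (Z : 'M[R]_(d, D)) (T : R).
Hypotheses (lagZ : lagrangian_frame Om Z) (T0 : 0 < T).
Hypothesis uN : pencil Om X Z T \in unitmx.

Let a := frame_re X Z.
Let b := frame_im Om X Z.
Let N := pencil Om X Z T.

Definition cayley := b *m invmx N.

Lemma cayleyK : cayley *m N = b.
Proof. by rewrite /cayley mulmxKV. Qed.

Lemma frame_sym : b^T *m a = a^T *m b.
Proof.
have := frame_form lagZ lagZ; have [-> _] := lagZ.
by move=> /esym/eqP; rewrite subr_eq0 => /eqP.
Qed.

Lemma cayley_sym : cayley^T = cayley.
Proof.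
have sQ : (N^T *m b)^T = N^T *m b.
  rewrite trmx_mul trmxK /N /pencil -/a -/b [(_ - _)^T]linearB /= [(_ *: _)^T]linearZ /= mulmxBr mulmxBl.
  by rewrite -scalemxAr -scalemxAl frame_sym.
have E : cayley = (invmx N)^T *m (N^T *m b) *m invmx N.
  by rewrite mulmxA -trmx_mul mulmxV // trmx1 mul1mx.
by move: (N^T *m b) sQ E => Q sQ ->; rewrite !trmx_mul sQ trmxK mulmxA.
Qed.

Lemma pencil_cayley x :
  pencil Om X Z x = ((1 - x / T) *: cayley + (x / T)%:M) *m N.
Proof.
rewrite mulmxDl -scalemxAl cayleyK mul_scalar_mx /N /pencil -/a -/b.
by apply/matrixP => i j; rewrite !mxE; field; rewrite gt_eqF.
Qed.

Lemma corank_pencil P dg x : diagonalizes cayley P dg ->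
  (D - \rank (pencil Om X Z x))%N =
  cnt (fun y => (1 - x / T) * y + x / T == 0)%R dg.
Proof.
by move=> dB; rewrite pencil_cayley mxrankMfree ?row_free_unit // (corank_diagonalizes _ _ dB).
Qed.

End cayley.

Lemma cayley_diff Z Z' T : lagrangian_frame Om Z -> lagrangian_frame Om Z' ->
  pencil Om X Z T \in unitmx -> pencil Om X Z' T \in unitmx ->
  cayley Z' T - cayley Z T =
  T *: ((invmx (pencil Om X Z T))^T *m (Z^T *m Om *m Z') *m invmx (pencil Om X Z' T)).
Proof.
move=> lagZ lagZ' uN uN'; set N := pencil Om X Z T; set N' := pencil Om X Z' T.
have E : N^T *m (cayley Z' T - cayley Z T) *m N' = T *: (Z^T *m Om *m Z').
  rewrite [N^T *m (_ - _)]mulmxBr [LHS]mulmxBl -[N^T *m cayley Z' T *m N']mulmxA cayleyK //.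
  have -> : N^T *m cayley Z T = (frame_im Om X Z)^T.
    by rewrite -{1}(cayley_sym lagZ uN) -trmx_mul cayleyK.
  rewrite frame_form // /N /N' /pencil [(_ - _)^T]linearB /= [(_ *: _)^T]linearZ /= mulmxBl mulmxBr.
  rewrite -scalemxAl -scalemxAr.
  move: (_ *m frame_im Om X Z') (_ *m frame_im Om X Z') (_ *m frame_re X Z') => p q r.
  by apply/matrixP => i j; rewrite !mxE; ring.
rewrite scalemxAl scalemxAr -E !mulmxA -trmx_mul mulmxV // trmx1 mul1mx.
by rewrite mulmxK.
Qed.

Lemma esum_unique (S : set R) (f : R -> bool) (q : bool) :
  (q -> exists2 x, S x & forall y, S y -> f y = (y == x)) ->
  (~~ q -> forall y, S y -> f y = false) ->
  (\esum_(x in S) ((f x)%:R)%:E = ((q : nat)%:R)%:E :> \bar R)%E.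
Proof.
case: q => [/(_ isT)[x Sx fx] _|_ /(_ isT) f0]; last first.
  by rewrite esum1 // => y /f0 ->.
rewrite (esumID [set x]); last by move=> i _; rewrite lee_fin.
rewrite [X in (_ + X)%E]esum1 ?adde0; last first.
  by move=> y [Sy /= yx]; rewrite fx //; case: eqP.
have -> : S `&` [set x] = [set x] by apply/seteqP; split => [y []//|y /= ->].
by rewrite esum_set1 ?lee_fin // fx // eqxx.
Qed.

Theorem arc_count_cayley Z (eps eps' : R) P dg :
  lagrangian_frame Om Z -> 0 <= eps <= eps' -> 0 < eps' < pi ->
  pencil Om X Z (slope eps') \in unitmx ->
  diagonalizes (cayley Z (slope eps')) P dg ->
  arc_count Om (souriau (plane X) (plane Z)) eps =
  ((cnt (fun y => (y <= 0) && (- y * slope eps' <= (1 - y) * slope eps)) dg)%:R)%:E.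
Proof.
move=> lagZ /andP[e0 ee] /andP[e0' ep] uN dB.
set T := slope eps'; have T0 : 0 < T by apply: slope_gt0; rewrite e0'.
have range al : `[0, eps]%classic al -> 0 <= al < pi.
  by rewrite /= in_itv /= => /andP[? ?]; apply/andP; split; lra.
rewrite /arc_count.
under eq_esum => al Hal do rewrite cdim_souriau_slope ?range //.
have -> : (\esum_(al in `[0%R, eps]) (((D - \rank (pencil Om X Z (slope al)))%N%:R)%:E : \bar R) =
  \esum_(al in `[0%R, eps]) \sum_(i < D)
    ((((1 - slope al / T) * dg ord0 i + slope al / T == 0)%:R)%:E : \bar R))%E.
  apply: eq_esum => al _; rewrite (corank_pencil T0 uN _ dB) natr_sum sumEFin //.
rewrite esum_sum => [|al i _ _]; last by rewrite lee_fin.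
rewrite natr_sum -sumEFin; apply: eq_bigr => i _.
apply: (esum_unique (f := fun al => (1 - slope al / T) * dg ord0 i + slope al / T == 0)).
  move=> /andP[y0 yT]; set y := dg ord0 i in y0 yT *.
  have y1 : 0 < 1 - y by lra.
  have [al al0 Eal] : exists2 al, 0 <= al < pi & slope al = T * (- y / (1 - y)).
    have q0 : 0 <= - y / (1 - y) by apply: divr_ge0; lra.
    by apply: slope_surj; apply: mulr_ge0 => //; exact: ltW.
  have solve x : ((1 - x / T) * y + x / T == 0) = (x == T * (- y / (1 - y))).
    apply/eqP/eqP => [H|->]; last by field; rewrite !gt_eqF.
    have -> : x = T * (x / T) by field; rewrite gt_eqF.
    congr (_ * _); apply: (mulIf (lt0r_neq0 y1)); rewrite divfK ?lt0r_neq0 //.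
    by move: H; move: (x / T) => k; nra.
  have ale : al <= eps.
    rewrite leNgt -slope_lt //; last by apply/andP; split; lra.
    rewrite -leNgt Eal mulrA ler_pdivrMr // mulrC [slope _ * _]mulrC //.
  exists al; first by rewrite /= in_itv /=; case/andP: al0 => -> _.
  move=> be /range hbe; rewrite solve -Eal.
  apply/eqP/eqP => [E|->//].
  by case: (ltgtP be al) => //; rewrite -slope_lt // E ltxx.
rewrite negb_and => H al hal; apply/negP => /eqP Hal.
have k0 : 0 <= slope al / T.
  by apply: divr_ge0; [apply: slope_ge0; exact: range|exact: ltW].
have heps : 0 <= eps < pi by apply/andP; split; lra.
have heps' : 0 <= eps' < pi by apply/andP; split; lra.
have ale : al <= eps by move: hal; rewrite /= in_itv /= => /andP[].
have hal' := range _ hal.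
have kT : slope al <= slope eps.
  by rewrite leNgt; apply/negP; rewrite slope_lt // ltNge ale.
have kT' : slope al <= T.
  by rewrite leNgt; apply/negP; rewrite slope_lt // ltNge (le_trans ale ee).
move: Hal H; set y := dg ord0 i; set k := slope al / T in k0 *.
have k1 : k <= 1 by rewrite ler_pdivrMr // mul1r.
have kE : slope al = k * T by rewrite divfK // gt_eqF.
move=> Hk; have y0 : y <= 0.
  rewrite leNgt; apply/negP => y0.
  have [kk|kk] := eqVneq k 1; first by rewrite kk in Hk; lra.
  have : k < 1 by rewrite lt_neqAle kk.
  nra.
rewrite y0 /=; apply/negP; rewrite negbK.
have -> : - y * T = (1 - y) * slope al - ((1 - k) * y + k) * T by rewrite kE; ring.
rewrite Hk mul0r subr0 ler_pM2l //; lra.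
Qed.

End arcs.

Section matrix_limits.
Variables (R : realType) (T : Type) (Fl : set_system T).
Context {FF : Filter Fl}.

Definition mxcvg m p (f : T -> 'M[R]_(m, p)) (A : 'M[R]_(m, p)) :=
  forall i j, f x i j @[x --> Fl] --> A i j.

Lemma mxcvg_cst m p (A : 'M[R]_(m, p)) : mxcvg (fun=> A) A.
Proof. by move=> i j; exact: cvg_cst. Qed.

Lemma mxcvg_ext m p (f g : T -> 'M[R]_(m, p)) A : f =1 g -> mxcvg g A -> mxcvg f A.
Proof. by move=> /funext ->. Qed.

Lemma mxcvg_near m p (f g : T -> 'M[R]_(m, p)) A :
  (\forall x \near Fl, f x = g x) -> mxcvg g A -> mxcvg f A.
Proof.
move=> fg cg i j; apply: cvg_trans (cg i j); apply: near_eq_cvg.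
by apply: filterS fg => x ->.
Qed.

Lemma mxcvg_mul m p q (f : T -> 'M[R]_(m, p)) (g : T -> 'M[R]_(p, q)) A B :
  mxcvg f A -> mxcvg g B -> mxcvg (fun x => f x *m g x) (A *m B).
Proof.
move=> cf cg i j; rewrite mxE; under eq_fun do rewrite mxE.
by apply: cvg_sumr => k; exact: cvgM (cf i k) (cg k j).
Qed.

Lemma mxcvg_tr m p (f : T -> 'M[R]_(m, p)) A : mxcvg f A -> mxcvg (fun x => (f x)^T) A^T.
Proof. by move=> cf i j; rewrite mxE; under eq_fun do rewrite mxE; exact: cf. Qed.

Lemma mxcvgD m p (f g : T -> 'M[R]_(m, p)) A B :
  mxcvg f A -> mxcvg g B -> mxcvg (fun x => f x + g x) (A + B).
Proof.
by move=> cf cg i j; rewrite mxE; under eq_fun do rewrite mxE; exact: cvgD (cf i j) (cg i j).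
Qed.

Lemma mxcvgN m p (f : T -> 'M[R]_(m, p)) A : mxcvg f A -> mxcvg (fun x => - f x) (- A).
Proof.
by move=> cf i j; rewrite mxE; under eq_fun do rewrite mxE; exact: cvgN (cf i j).
Qed.

Lemma mxcvgZ m p (k : T -> R) (l : R) (f : T -> 'M[R]_(m, p)) A :
  k x @[x --> Fl] --> l -> mxcvg f A -> mxcvg (fun x => k x *: f x) (l *: A).
Proof.
by move=> ck cf i j; rewrite mxE; under eq_fun do rewrite mxE; exact: cvgM ck (cf i j).
Qed.

Lemma cvg_prodr I (r : seq I) (f : I -> T -> R) (l : I -> R) :
  (forall i, f i x @[x --> Fl] --> l i) ->
  (\prod_(i <- r) f i x) @[x --> Fl] --> \prod_(i <- r) l i.
Proof.
move=> H; elim: r => [|i r IH].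
  by under eq_fun do rewrite big_nil; rewrite big_nil; exact: cvg_cst.
under eq_fun do rewrite big_cons; rewrite big_cons; exact: cvgM.
Qed.

Lemma cvg_det m (f : T -> 'M[R]_m) A : mxcvg f A -> \det (f x) @[x --> Fl] --> \det A.
Proof.
move=> cf; rewrite /determinant; apply: cvg_sumr => s.
apply: cvgM; first exact: cvg_cst.
by apply: cvg_prodr => i; exact: cf.
Qed.

Lemma mxcvg_unit m (f : T -> 'M[R]_m) A : mxcvg f A -> A \in unitmx ->
  \forall x \near Fl, f x \in unitmx.
Proof.
move=> cf; rewrite unitmxE unitfE => dA.
have /cvgrPdist_lt/(_ `|\det A|) := cvg_det cf.
rewrite normr_gt0 dA => /(_ isT); apply: filterS => x.
rewrite unitmxE unitfE; apply: contraTneq => ->.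
by rewrite subr0 ltxx.
Qed.

Lemma mxcvg_inv m (f : T -> 'M[R]_m) A : mxcvg f A -> A \in unitmx ->
  mxcvg (fun x => invmx (f x)) (invmx A).
Proof.
move=> cf uA; apply: (@mxcvg_near _ _ _ (fun x => (\det (f x))^-1 *: \adj (f x))).
  by apply: filterS (mxcvg_unit cf uA) => x ux; rewrite /invmx ux.
rewrite /invmx uA; apply: mxcvgZ.
  by apply: cvgV; [rewrite -unitfE -unitmxE|exact: cvg_det].
move=> i j; rewrite mxE; under eq_fun do rewrite mxE.
rewrite /cofactor; apply: cvgM; first exact: cvg_cst.
by apply: cvg_det => k l; rewrite !mxE; under eq_fun do rewrite !mxE; exact: cf.
Qed.

Lemma mxcvg_near_le m p (f : T -> 'M[R]_(m, p)) A e : mxcvg f A -> 0 < e ->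
  \forall x \near Fl, forall i j, `|(f x - A) i j| <= e.
Proof.
move=> cf e0.
have : \forall x \near Fl, forall ij : 'I_m * 'I_p, `|(f x - A) ij.1 ij.2| <= e.
  apply: filter_forall => -[i j] /=.
  have /cvgrPdist_le/(_ e e0) := cf i j; apply: filterS => x.
  by rewrite !mxE distrC.
by apply: filterS => x H i j; exact: (H (i, j)).
Qed.

End matrix_limits.

Section nonspectral.
Variables (R : realType) (D : nat) (a b : 'M[R]_D).
Hypotheses (ab : b^T *m a = a^T *m b) (uG : a^T *m a + b^T *m b \in unitmx).

Lemma regular_pencil : exists2 x : R, 0 < x & b - x *: a \in unitmx.
Proof.
pose p : {poly R} := \det (map_mx polyC b - 'X *: map_mx polyC a).
have pE x : p.[x] = \det (b - x *: a).
  rewrite /p -horner_evalE -det_map_mx /=; congr (\det _).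
  by apply/matrixP => i j; rewrite !mxE /= horner_evalE !hornerE.
have p0 : p != 0.
  apply/eqP => p0; pose c := real_complex R.
  have : \det (map_mx c b - 'i%C *: map_mx c a) = 0.
    have : (map_poly c p).['i%C] = 0 by rewrite p0 map_poly0 horner0.
    rewrite /p -det_map_mx -horner_evalE -det_map_mx /= => <-; congr (\det _).
    apply/matrixP => i j; rewrite !mxE /= rmorphB rmorphM /= map_polyX !map_polyC /=.
    by rewrite horner_evalE !hornerE.
  move=> d0; have : map_mx c b - 'i%C *: map_mx c a \notin unitmx.
    by rewrite unitmxE d0 unitr0.
  move=> /singular_ker[w w0 Hw].
  pose w1 := map_mx (@complex.Re R) w; pose w2 := map_mx (@complex.Im R) w.
  have E i : ((map_mx c b - 'i%C *: map_mx c a) *m w) i 0 =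
    Complex ((b *m w1 + a *m w2) i 0) ((b *m w2 - a *m w1) i 0).
    rewrite mulmxBl -scalemxAl mxE [X in _ + X]mxE [X in _ - X]mxE !complex_mulmx.
    have Dl (u v : 'cV[R]_D) k : (u + v) k 0 = u k 0 + v k 0 by rewrite mxE.
    have Bl (u v : 'cV[R]_D) k : (u - v) k 0 = u k 0 - v k 0 by rewrite !mxE.
    rewrite -/w1 -/w2 Dl Bl.
    move: ((b *m w1) i 0) ((b *m w2) i 0) ((a *m w1) i 0) ((a *m w2) i 0) => p1 p2 q1 q2.
    by congr Complex => /=; ring.
  have H1 : b *m w1 = - (a *m w2).
    apply/eqP; rewrite -subr_eq0 opprK; apply/eqP/matrixP => i j; rewrite ord1.
    by have := E i; rewrite Hw mxE => -[<- _]; rewrite mxE.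
  have H2 : b *m w2 = a *m w1.
    apply/eqP; rewrite -subr_eq0; apply/eqP/matrixP => i j; rewrite ord1.
    by have := E i; rewrite Hw mxE => -[_ <-]; rewrite mxE.
  have inj v : (a^T *m a + b^T *m b) *m v = 0 -> v = 0 :> 'cV_D.
    by move=> Gv; rewrite -(mulKmx uG v) Gv mulmx0.
  have w10 : w1 = 0.
    apply: inj; rewrite mulmxDl -!mulmxA H1 -H2 mulmxN.
    by rewrite !mulmxA ab subrr.
  have w20 : w2 = 0.
    apply: inj; rewrite mulmxDl -!mulmxA H2 -[a *m w2]opprK -H1 mulmxN.
    by rewrite !mulmxA ab addNr.
  case/eqP: w0; apply/matrixP => i j; rewrite ord1 [RHS]mxE.
  have := congr1 (fun M : 'cV_D => M i 0) w10; have := congr1 (fun M : 'cV_D => M i 0) w20.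
  by rewrite !mxE; case: (w i 0) => x y /= -> ->.
have rs_uniq : uniq [seq (k.+1%:R : R) | k <- iota 0 (size p)].
  by rewrite map_inj_uniq ?iota_uniq // => i j /eqP; rewrite eqr_nat => /eqP [].
have := contraNN (fun x => max_poly_roots p0 x rs_uniq).
rewrite size_map size_iota ltnn => /(_ isT) /allPn[x /mapP[k _ ->]].
rewrite rootE pE => H; exists k.+1%:R => //.
by rewrite unitmxE unitfE.
Qed.

End nonspectral.

Section eigenvalues.
Variable R : realType.

Definition eig m (B : 'M[R]_m) : 'rV[R]_m :=
  get [set d | exists P, diagonalizes B P d].

Lemma eigP m (B : 'M[R]_m) : B^T = B -> exists P, diagonalizes B P (eig B).
Proof.
move=> symB; have [P [d [uP PB]]] := symmetric_diag symB.
apply: (@getPex _ [set d | exists P, diagonalizes B P d]).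
by exists d, P.
Qed.

Lemma cnt_eig_zero m (B : 'M[R]_m) : B^T = B -> cnt (@iszero R) (eig B) = (m - \rank B)%N.
Proof.
move=> /eigP[P dB]; have := corank_diagonalizes 1 0 dB.
rewrite scale1r raddf0 addr0 => ->; apply: eq_cnt => i.
by rewrite /iszero mul1r addr0.
Qed.

Lemma near_ball (P : R -> Prop) (x : R) : (\forall y \near x, P y) ->
  exists2 d, 0 < d & forall y, `|y - x| < d -> P y.
Proof.
move=> /nbhs_ballP[d /= d0 H]; exists d => // y yx; apply: H.
by rewrite -ball_normE /= distrC.
Qed.

Lemma near_ball2 (P : R * R -> Prop) (x y : R) : (\forall p \near ((x, y) : R * R), P p) ->
  exists2 d, 0 < d & forall x' y', `|x' - x| < d -> `|y' - y| < d -> P (x', y').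
Proof.
move=> /nbhs_ballP[d /= d0 H]; exists d => // x' y' xx yy; apply: H.
by split; rewrite -ball_normE /= distrC.
Qed.

Lemma near_inertia m (T : Type) (Fl : set_system T) {FF : Filter Fl}
    (f : T -> 'M[R]_m) (A : 'M[R]_m) : mxcvg Fl f A -> A^T = A ->
  (\forall p \near Fl, (f p)^T = f p) ->
  \forall p \near Fl, (cnt (@isneg R) (eig A) <= cnt (@isneg R) (eig (f p)))%N /\
     (cnt (@ispos R) (eig A) <= cnt (@ispos R) (eig (f p)))%N.
Proof.
move=> cf symA symf; have [P dA] := eigP symA.
have [eta eta0 H] := inertia_near dA.
apply: filterS2 symf (mxcvg_near_le cf eta0) => p /eigP[Q dfp] small.
exact: H dfp small.
Qed.

Lemma near_inertia_regular m (T : Type) (Fl : set_system T) {FF : Filter Fl}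
    (f : T -> 'M[R]_m) (A : 'M[R]_m) : mxcvg Fl f A -> A^T = A -> \rank A = m ->
  (\forall p \near Fl, (f p)^T = f p) ->
  \forall p \near Fl, cnt (@isneg R) (eig (f p)) = cnt (@isneg R) (eig A) /\
    cnt (@isnpos R) (eig (f p)) = cnt (@isnpos R) (eig A).
Proof.
move=> cf symA rA symf; apply: filterS (near_inertia cf symA symf) => p [h1 h2].
have z0 : cnt (@iszero R) (eig A) = 0%N by rewrite cnt_eig_zero // rA subnn.
have := cnt_split3 (eig A); have := cnt_split3 (eig (f p)).
rewrite !cnt_le0 z0; lia.
Qed.

End eigenvalues.

Section flow.
Variables (R : realType) (d D : nat) (Om : 'M[R]_d).
Hypotheses (dD : d = (D + D)%N) (Om2 : Om *m Om = - 1%:M) (OmT : Om^T = - Om).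
Variable X : 'M[R]_(d, D).
Hypotheses (lagX : lagrangian_frame Om X) (XX : X^T *m X = 1%:M).

Lemma mxcvg_pencil (T : Type) (Fl : set_system T) {FF : Filter Fl}
    (f : T -> 'M[R]_(d, D)) A x : mxcvg Fl f A ->
  mxcvg Fl (fun p => pencil Om X (f p) x) (pencil Om X A x).
Proof.
move=> cf; apply: mxcvgD.
  by apply: mxcvgN; apply: mxcvg_mul => //; exact: mxcvg_cst.
apply: mxcvgN; apply: mxcvgZ; first exact: cvg_cst.
by apply: mxcvg_mul => //; exact: mxcvg_cst.
Qed.

Lemma mxcvg_cayley (T : Type) (Fl : set_system T) {FF : Filter Fl}
    (f : T -> 'M[R]_(d, D)) A x : mxcvg Fl f A -> pencil Om X A x \in unitmx ->
  mxcvg Fl (fun p => cayley Om X (f p) x) (cayley Om X A x).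
Proof.
move=> cf uA; apply: mxcvg_mul; last by apply: mxcvg_inv uA; exact: mxcvg_pencil.
by apply: mxcvgN; apply: mxcvg_mul => //; exact: mxcvg_cst.
Qed.

Definition arc_nb (Z : 'M[R]_(d, D)) (x : R) : nat :=
  cnt (@isnpos R) (eig (cayley Om X Z x)).

Lemma pencil0 Z : pencil Om X Z 0 = frame_im Om X Z.
Proof. by rewrite /pencil scale0r subr0. Qed.

Lemma cayley_zero Z x : lagrangian_frame Om Z -> 0 < x -> pencil Om X Z x \in unitmx ->
  cnt (@iszero R) (eig (cayley Om X Z x)) = (D - \rank (frame_im Om X Z))%N.
Proof.
move=> lagZ x0 uN; have [P dB] := eigP (cayley_sym dD Om2 OmT lagX XX lagZ uN).
rewrite -pencil0 (corank_pencil x0 uN 0 dB); apply: eq_cnt => i.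
by rewrite /iszero mul0r subr0 mul1r addr0.
Qed.

Lemma arc_count_nb Z eps : lagrangian_frame Om Z -> 0 < eps < pi ->
  pencil Om X Z (slope eps) \in unitmx ->
  arc_count Om (souriau (plane X) (plane Z)) eps = ((arc_nb Z (slope eps))%:R)%:E.
Proof.
move=> lagZ heps uN; have [P dB] := eigP (cayley_sym dD Om2 OmT lagX XX lagZ uN).
have [e0 ep] := andP heps.
rewrite (arc_count_cayley dD Om2 OmT lagX XX lagZ _ heps uN dB); last by rewrite lexx ltW.
congr (_%:R%:E); apply: eq_cnt => i; rewrite /isnpos.
case: leP => //= y0; rewrite ler_pM2r ?slope_gt0 //; lra.
Qed.

Lemma arc_nb_lt Z (x x' : R) : lagrangian_frame Om Z -> 0 < x < x' ->
  pencil Om X Z x \in unitmx -> pencil Om X Z x' \in unitmx ->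
  arc_nb Z x' = (arc_nb Z x + cnt (@isneg R)
    (eig ((1 - x / x') *: cayley Om X Z x' + (x / x')%:M)))%N.
Proof.
move=> lagZ /andP[x0 xx'] uN uN'; have x0' : 0 < x' by exact: lt_trans xx'.
have symB := cayley_sym dD Om2 OmT lagX XX lagZ uN'.
have [P dB] := eigP symB.
have [eps he Ee] := slope_surj (ltW x0).
have [eps' he' Ee'] := slope_surj (ltW x0').
have e0 : 0 < eps.
  rewrite lt_neqAle; case/andP: he => -> _; rewrite andbT; apply/eqP => E.
  by move: Ee; rewrite /slope -E mul0r tan0; lra.
have ee' : eps < eps' by rewrite -slope_lt // Ee Ee'.
have heps : 0 < eps < pi by rewrite e0; case/andP: he.
have heps' : 0 < eps' < pi by rewrite (lt_trans e0 ee'); case/andP: he'.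
have := @arc_count_nb Z eps lagZ heps; rewrite Ee => /(_ uN) E1.
have uN2 : pencil Om X Z (slope eps') \in unitmx by rewrite Ee'.
have dB2 : diagonalizes (cayley Om X Z (slope eps')) P (eig (cayley Om X Z x')) by rewrite Ee'.
have := arc_count_cayley (eps := eps) dD Om2 OmT lagX XX lagZ _ heps' uN2 dB2.
rewrite E1 Ee Ee' !ltW // => /(_ isT)[/eqP]; rewrite eqr_nat => /eqP ->.
set k : R := x / x'; have k1 : k < 1 by rewrite ltr_pdivrMr // mul1r.
have k0 : 0 < k by rewrite divr_gt0.
have xE : x = k * x' by rewrite divfK // gt_eqF.
set B := cayley Om X Z x' in symB dB *.
pose M : 'M[R]_D := (1 - k) *: B + k%:M.
have symM : M^T = M by rewrite linearD linearZ /= symB tr_scalar_mx.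
have [Q dM] := eigP symM.
have dM2 : diagonalizes M P (\row_i ((1 - k) * eig B ord0 i + k)).
  have [_ uP PB] := dB; split => //.
  rewrite /M mulmxDr -scalemxAr PB scalar_mxC scalemxAl -mulmxDl; congr (_ *m _).
  by apply/matrixP => i j; rewrite !mxE; case: eqP => _; rewrite ?mulr1n // !mulr0n mulr0 addr0.
have -> : cnt (@isneg R) (eig M) = cnt (@isneg R) (\row_i ((1 - k) * eig B ord0 i + k)).
  have [eta eta0 H] := inertia_near dM; have [eta' eta0' H'] := inertia_near dM2.
  have small eta1 : 0 < eta1 -> forall i j, `|(M - M) i j| <= eta1.
    by move=> h i j; rewrite subrr mxE normr0 ltW.
  have [h1 _] := H _ _ _ dM2 (small _ eta0); have [h2 _] := H' _ _ _ dM (small _ eta0').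
  by apply/eqP; rewrite eqn_leq h1 h2.
rewrite /arc_nb -/B /cnt -big_split /=; apply: eq_bigr => i _.
rewrite mxE /isnpos /isneg; set y : R := eig B ord0 i.
rewrite xE mulrA ler_pM2r //.
case: (leP y 0) => y0 /=; last first.
  have h : 0 <= (1 - k) * y + k by nra.
  by rewrite ltNge h.
by case: leP => h1; case: ltP => h2 //; exfalso; lra.
Qed.

Lemma regular_slope Z : lagrangian_frame Om Z ->
  exists2 x, 0 < x & pencil Om X Z x \in unitmx.
Proof.
move=> lagZ; apply: (regular_pencil (frame_sym dD Om2 OmT lagX XX lagZ)).
have [_ uG] := lagZ; suff <- : Z^T *m Z = (frame_re X Z)^T *m frame_re X Z +
  (frame_im Om X Z)^T *m frame_im Om X Z by [].
have -> : Z^T *m Z = Z^T *m (frame_proj X - Om *m frame_proj X *m Om) *m Z.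
  by rewrite (frame_proj_complete dD Om2 OmT lagX) mulmx1.
rewrite /frame_proj XX invmx1 mulmx1 mulmxBr mulmxBl /frame_re /frame_im.
by rewrite [(- _)^T]linearN /= mulNmx mulmxN opprK !trmx_mul !trmxK OmT !mulNmx mulmxN !mulNmx !mulmxA.
Qed.

End flow.

Lemma mxcvg_within (R : realType) (T : Type) (Fl Gl : set_system T) m p
    (f : T -> 'M[R]_(m, p)) A : Gl `=>` Fl -> mxcvg Fl f A -> mxcvg Gl f A.
Proof.
move=> sub cf i j; apply: cvg_trans (cf i j) => P /= H; exact: sub.
Qed.

Lemma inertia_arith_up (n1 p1 z1 n2 p2 z2 D : nat) :
  (n1 + z1 + p1 = D -> n2 + z2 + p2 = D -> n1 <= n2 -> p1 <= p2 ->
   n2 + z2 <= n1 -> p1 + z1 <= p2 -> z2 = 0 /\ n1 + z1 = n2 + z2 + z1)%N.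
Proof. lia. Qed.

Lemma inertia_arith_down (n1 p1 z1 n2 p2 z2 D : nat) :
  (n1 + z1 + p1 = D -> n2 + z2 + p2 = D -> n1 <= n2 -> p1 <= p2 ->
   n1 + z1 <= n2 -> p2 + z2 <= p1 -> z2 = 0 /\ n1 + z1 = n2 + z2 + 0)%N.
Proof. lia. Qed.

Section family.
Variables (R : realType) (d D : nat) (Om : 'M[R]_d).
Hypotheses (dD : d = (D + D)%N) (Om2 : Om *m Om = - 1%:M) (OmT : Om^T = - Om).
Variable X : 'M[R]_(d, D).
Hypotheses (lagX : lagrangian_frame Om X) (XX : X^T *m X = 1%:M).

Variable Z : R -> R -> 'M[R]_(d, D).
Hypothesis lagZ : forall lam t : R, 0 < t < 2 -> lagrangian_frame Om (Z lam t).
Hypothesis cZ : forall lam t : R, 0 < t < 2 ->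
  mxcvg (nbhs ((lam, t) : R * R)) (fun p => Z p.1 p.2) (Z lam t).
Hypothesis increasing : forall lam t : R, 0 < t < 2 -> exists K : 'M[R]_D,
  [/\ K^T = K, forall x, x != 0 -> 0 < form K x &
   mxcvg (lam^') (fun mu => (mu - lam)^-1 *: ((Z lam t)^T *m Om *m Z mu t)) K].

Let cay lam t x := cayley Om X (Z lam t) x.
Let reg lam t x := pencil Om X (Z lam t) x \in unitmx.
Let nb lam t x := arc_nb Om X (Z lam t) x.
Let mult lam t := (D - \rank (frame_im Om X (Z lam t)))%N.

Lemma mxcvg_lam (lam t : R) : 0 < t < 2 -> mxcvg (nbhs lam) (fun mu => Z mu t) (Z lam t).
Proof.
move=> ht i j; apply: (@cvg_comp _ _ _ (fun mu : R => (mu, t)) (fun p : R * R => Z p.1 p.2 i j)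
  (nbhs lam) (nbhs ((lam, t) : R * R))); last exact: cZ.
move=> P /nbhs_ballP[e /= e0 H]; apply/nbhs_ballP; exists e => // s hs.
by apply: H; split => //; exact: ballxx.
Qed.

Lemma mxcvg_t (lam t : R) : 0 < t < 2 -> mxcvg (nbhs t) (Z lam) (Z lam t).
Proof.
move=> ht i j; apply: (@cvg_comp _ _ _ (fun s : R => (lam, s)) (fun p : R * R => Z p.1 p.2 i j)
  (nbhs t) (nbhs ((lam, t) : R * R))); last exact: cZ.
move=> P /nbhs_ballP[e /= e0 H]; apply/nbhs_ballP; exists e => // s hs.
by apply: H; split => //; exact: ballxx.
Qed.

Lemma reg_box (lam t x : R) : 0 < t < 2 -> reg lam t x ->
  exists2 eta, 0 < eta & forall mu s, `|mu - lam| < eta -> `|s - t| < eta -> reg mu s x.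
Proof.
move=> ht r.
have [eta eta0 H] := near_ball2 (mxcvg_unit (mxcvg_pencil (Om := Om) (X := X) (x := x) (@cZ lam t ht)) r).
by exists eta => // mu s h1 h2; exact: H.
Qed.

(* local behaviour of the count in the spectral parameter *)
Lemma flow_lam (lam t x : R) : 0 < t < 2 -> 0 < x -> reg lam t x ->
  exists2 eta, 0 < eta & forall mu, `|mu - lam| < eta -> mu != lam ->
    [/\ reg mu t x, mult mu t = 0%N &
      nb lam t x = (nb mu t x + if (lam < mu)%R then mult lam t else 0)%N].
Proof.
move=> ht x0 r; have [K [symK posK cK]] := increasing lam ht.
set N := pencil Om X (Z lam t) x in r *.
have cZl := @mxcvg_lam lam t ht.
have cp : mxcvg (nbhs lam) (fun mu => pencil Om X (Z mu t) x) N by exact: mxcvg_pencil.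
have ccay : mxcvg (nbhs lam) (fun mu => cay mu t x) (cay lam t x) by exact: mxcvg_cayley.
have symB mu : reg mu t x -> (cay mu t x)^T = cay mu t x.
  by move=> rm; exact: (cayley_sym dD Om2 OmT lagX XX (lagZ mu ht) rm).
pose Q := (invmx N)^T.
pose K' := x *: (Q *m K *m Q^T).
have symK' : K'^T = K'.
  by rewrite /K' linearZ /= !trmx_mul trmxK symK !mulmxA.
have posK' v : v != 0 -> 0 < form K' v.
  move=> v0; rewrite formZ form_congr mulr_gt0 // posK // mul_unit_neq0 //.
  by rewrite unitmx_tr unitmx_inv.
have [delta delta0 coer] := posdef_coercive symK' posK'.
have lim : mxcvg (lam^') (fun mu => (mu - lam)^-1 *: (cay mu t x - cay lam t x)) K'.
  apply: (@mxcvg_near _ _ _ _ _ _ _ (fun mu =>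
     x *: (Q *m ((mu - lam)^-1 *: ((Z lam t)^T *m Om *m Z mu t)) *m
       invmx (pencil Om X (Z mu t) x)))).
    have regd : \forall mu \near lam^', reg mu t x.
      by apply: cvg_within; exact: mxcvg_unit cp r.
    apply: filterS regd => mu rm.
    rewrite /cay (cayley_diff dD Om2 OmT lagX XX (lagZ lam ht) (lagZ mu ht) r rm).
    by rewrite -/N -/Q scalerA mulrC -scalerA -scalemxAr -scalemxAl.
  apply: mxcvgZ; first exact: cvg_cst.
  apply: mxcvg_mul.
    by apply: mxcvg_mul => //; exact: mxcvg_cst.
  rewrite trmxK; apply: (@mxcvg_within _ _ (nbhs lam)); first exact: cvg_within.
  exact: mxcvg_inv cp r.
pose eta1 := delta / (2 * D.+1%:R).
have D0 : 0 < 2 * D.+1%:R :> R by rewrite mulr_gt0.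
have eta10 : 0 < eta1 by rewrite divr_gt0.
have near1 := @mxcvg_near_le _ _ _ (dnbhs_filter lam) _ _ _ _ _ lim eta10.
rewrite near_withinE in near1.
have rnear : \forall mu \near lam, reg mu t x by exact: mxcvg_unit cp r.
have symn : \forall mu \near lam, (cay mu t x)^T = cay mu t x.
  by apply: filterS rnear => mu; exact: symB.
have near2 := near_inertia ccay (symB _ r) symn.
have FFlam : Filter (nbhs lam) by typeclasses eauto.
have {}near2 := near2 FFlam.
have [eta eta0 H] := near_ball (filterI (filterI near1 near2) rnear).
exists eta => // mu mulam munel; have [[small [lo hi]] rm] := H mu mulam.
have {}small := small munel.
have pos v : v != 0 -> 0 < form ((mu - lam)^-1 *: (cay mu t x - cay lam t x)) v.
  move=> v0; set E := _ *: _; have -> : E = K' + (E - K') by rewrite addrC subrK.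
  rewrite formD; have := form_small v small; have := coer v; have := sqn_gt0 v0.
  set q := sqn v => q0; move: (form K' v) (form (E - K') v) => f1 f2 h1.
  have : D%:R * eta1 * q < delta * q.
    rewrite ltr_pM2r // /eta1 mulrA ltr_pdivrMr // [_ * delta]mulrC.
    by rewrite ltr_pM2l // -natrM ltr_nat mul2n -addnn ltn_addr.
  by rewrite ler_norml => h2 /andP[h3 _]; lra.
have Bdiff : cay mu t x = cay lam t x + (mu - lam) *: ((mu - lam)^-1 *: (cay mu t x - cay lam t x)).
  by rewrite scalerA mulfV ?subr_eq0 // scale1r addrC subrK.
have [P dB] := eigP (symB _ r); have [P' dB'] := eigP (symB _ rm).
have z1 : cnt (@iszero R) (eig (cay lam t x)) = mult lam t.
  exact: (cayley_zero dD Om2 OmT lagX XX (lagZ lam ht) x0 r).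
have z2 : cnt (@iszero R) (eig (cay mu t x)) = mult mu t.
  exact: (cayley_zero dD Om2 OmT lagX XX (lagZ mu ht) x0 rm).
have s1 := cnt_split3 (eig (cay lam t x)); have s2 := cnt_split3 (eig (cay mu t x)).
rewrite /nb /arc_nb -!/(cay _ t x).
have [lt|gt|E] := ltgtP lam mu; last by rewrite E eqxx in munel.
  have inc v : v != 0 -> form (cay lam t x) v < form (cay mu t x) v.
    by move=> v0; rewrite Bdiff formD formZ ltrDl mulr_gt0 ?pos // subr_gt0.
  have [i1 i2] := inertia_lt dB dB' inc.
  rewrite !cnt_le0 !cnt_ge0 in i1 i2 *; rewrite -z1 -z2.
  by have [z0 E] := inertia_arith_up s1 s2 lo hi i1 i2; split.
have dec v : v != 0 -> form (cay mu t x) v < form (cay lam t x) v.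
  move=> v0; rewrite Bdiff formD formZ gtrDl -[mu - lam]opprB mulNr oppr_lt0.
  by rewrite mulr_gt0 ?subr_gt0 // opprB pos.
have [i1 i2] := inertia_lt dB' dB dec.
rewrite !cnt_le0 !cnt_ge0 in i1 i2 *; rewrite -z2.
by have [z0 E] := inertia_arith_down s1 s2 lo hi i1 i2; split.
Qed.

End family.

Section eigenvalue_count.
Variable R : realType.
Implicit Types (e : R -> nat) (lam mu : R).

Definition count_below e lam : \bar R := (\esum_(l in [set l : R | (l < lam)%R]) ((e l)%:R)%:E)%E.

Lemma count_below_split e lam mu : lam <= mu ->
  (count_below e mu = count_below e lam + \esum_(l in [set l | lam <= l < mu]%R) ((e l)%:R)%:E)%E.
Proof.
move=> lm; rewrite /count_below (esumID [set l | (l < lam)%R] [set l | (l < mu)%R]); last first.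
  by move=> i _; rewrite lee_fin.
congr (adde _ _); congr (esum _ _); apply/seteqP; split => l /=.
- by case.
- by move=> h; split => //; exact: lt_le_trans lm.
- by case=> h1 /negP; rewrite -leNgt => h2; rewrite h2 h1.
- by move=> /andP[h1 h2]; split => //; apply/negP; rewrite -leNgt.
Qed.

Lemma count_below_jump e lam mu : lam < mu -> (forall l, lam < l < mu -> e l = 0%N) ->
  (count_below e mu = count_below e lam + ((e lam)%:R)%:E)%E.
Proof.
move=> lm e0; rewrite (count_below_split e (ltW lm)); congr (adde _ _).
rewrite (esumID [set lam]); last by move=> i _; rewrite lee_fin.
rewrite [X in (_ + X)%E]esum1 ?adde0; last first.
  by move=> l [/= /andP[h1 h2] /eqP h3]; rewrite e0 // h2 andbT lt_neqAle eq_sym h3.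
have -> : [set l | lam <= l < mu] `&` [set lam] = [set lam].
  by apply/seteqP; split => [l []//|l /= ->]; split => //=; rewrite lexx.
by rewrite esum_set1 // lee_fin.
Qed.

Lemma count_below_flat e lam mu : lam <= mu -> (forall l, lam <= l < mu -> e l = 0%N) ->
  count_below e mu = count_below e lam.
Proof.
move=> lm e0; rewrite (count_below_split e lm) esum1 ?adde0 //.
by move=> l /= /e0 ->.
Qed.

Lemma count_below0 e lam : (forall l, l < lam -> e l = 0%N) -> count_below e lam = 0%E.
Proof. by move=> e0; rewrite /count_below esum1 // => l /= /e0 ->. Qed.

Definition eigen_nb e lam : R := fine (count_below e lam).

End eigenvalue_count.

Lemma natr_diff (R : realType) (n1 m1 n2 m2 c1 c2 : nat) :
  m1 = (n1 + c1)%N -> m2 = (n2 + c2)%N -> c1 = c2 -> (m1%:R - n1%:R : R) = m2%:R - n2%:R.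
Proof. by move=> -> -> ->; rewrite !natrD; ring. Qed.

Section abstract_flow.
Variables (R : realType) (nb : R -> R -> R -> nat) (reg : R -> R -> R -> bool).
Variables (e : R -> R -> nat) (laminf : R).
Hypothesis reg_ex : forall lam t : R, 0 < t <= 1 -> exists2 x, 0 < x & reg lam t x.
Hypothesis reg_open : forall lam t x : R, 0 < t <= 1 -> reg lam t x ->
  exists2 eta, 0 < eta & forall mu s, `|mu - lam| < eta -> `|s - t| < eta -> reg mu s x.
Hypothesis flow : forall lam t x : R, 0 < t <= 1 -> 0 < x -> reg lam t x ->
  exists2 eta, 0 < eta & forall mu, `|mu - lam| < eta -> mu != lam ->
    [/\ reg mu t x, e t mu = 0%N &
      nb lam t x = (nb mu t x + if (lam < mu)%R then 2 * e t lam else 0)%N].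
Hypothesis compare : forall lam t x x' : R, 0 < t <= 1 -> 0 < x < x' ->
  reg lam t x -> reg lam t x' ->
  exists2 eta, 0 < eta & forall s, `|s - t| < eta ->
    ((nb lam s x')%:R - (nb lam s x)%:R : R) = (nb lam t x')%:R - (nb lam t x)%:R.
Hypothesis base : forall t x : R, 0 < t <= 1 -> 0 < x -> reg laminf t x ->
  exists2 eta, 0 < eta & forall s, `|s - t| < eta -> nb laminf s x = nb laminf t x.
Hypothesis bottom : forall t lam : R, 0 < t <= 1 -> lam <= laminf -> e t lam = 0%N.

Let count_near (lam t : R) : 0 < t <= 1 ->
  exists2 eta, 0 < eta & forall mu, `|mu - lam| < eta ->
    (lam < mu -> count_below (e t) mu = (count_below (e t) lam + ((e t lam)%:R)%:E)%E) /\
    (mu < lam -> count_below (e t) lam = count_below (e t) mu).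
Proof.
move=> ht; have [x x0 r] := reg_ex lam ht.
have [eta eta0 H] := flow ht x0 r; exists eta => // mu hmu; split => lm.
  apply: count_below_jump => // l /andP[l1 l2].
  have [] := H l => //; last by rewrite gt_eqF.
  by move: hmu; rewrite !gtr0_norm ?subr_gt0 //; lra.
apply: count_below_flat; first exact: ltW.
move=> l /andP[l1 l2]; have [] := H l => //; last by rewrite lt_eqF.
by move: hmu; rewrite !ltr0_norm ?subr_lt0 //; lra.
Qed.

Lemma count_fin (lam t : R) : 0 < t <= 1 -> count_below (e t) lam \is a fin_num.
Proof.
move=> ht; have low mu : mu <= laminf -> count_below (e t) mu \is a fin_num.
  by move=> h; rewrite count_below0 // => l hl; apply: bottom => //; lra.
have [/low//|h] := leP lam laminf.
suff -> : (count_below (e t) lam \is a fin_num) =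
    (count_below (e t) laminf \is a fin_num) by exact: low.
apply/esym; apply: (@locally_constant R bool (fun l => count_below (e t) l \is a fin_num)).
  exact: ltW.
move=> l _; have [eta eta0 H] := count_near l ht; exists eta => // mu _ hmu.
have [H1 H2] := H mu hmu; case: (ltgtP l mu) => [/H1 ->|/H2 ->//|->//].
by rewrite fin_numD andbT.
Qed.

Definition potential lam t x : R := 2 * eigen_nb (e t) lam + (nb lam t x)%:R.

Let eigen_near (lam t : R) : 0 < t <= 1 ->
  exists2 eta, 0 < eta & forall mu, `|mu - lam| < eta ->
    (lam < mu -> eigen_nb (e t) mu = eigen_nb (e t) lam + (e t lam)%:R) /\
    (mu < lam -> eigen_nb (e t) lam = eigen_nb (e t) mu).
Proof.
move=> ht; have [eta eta0 H] := count_near lam ht; exists eta => // mu hmu.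
have [H1 H2] := H mu hmu; split => [/H1|/H2]; rewrite /eigen_nb => -> //.
by rewrite fineD ?count_fin.
Qed.

Lemma potential_lam (t x lam1 lam2 : R) : 0 < t <= 1 -> 0 < x -> lam1 <= lam2 ->
  (forall lam, lam1 <= lam <= lam2 -> reg lam t x) ->
  potential lam1 t x = potential lam2 t x.
Proof.
move=> ht x0 l12 r; apply: (@locally_constant R R (fun l => potential l t x)) => //.
move=> lam hlam; have [eta eta0 H] := flow ht x0 (r lam hlam).
have [eta' eta0' H'] := eigen_near lam ht.
exists (Num.min eta eta'); first by rewrite lt_min eta0.
move=> mu _; rewrite lt_min => /andP[h h'].
have [->//|ml] := eqVneq mu lam.
have [_ _ nE] := H mu h ml; have [E1 E2] := H' mu h'.
rewrite /potential; move: nE; move: (nb lam t x) (nb mu t x) => n1 n2.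
have [lm|lm|E] := ltgtP lam mu; last by rewrite E eqxx in ml.
  by rewrite (E1 lm) => ->; rewrite natrD natrM; lra.
by rewrite (E2 lm) => ->; rewrite addn0.
Qed.

Let stable x lam t := exists2 eta, 0 < eta & forall s, 0 < s <= 1 -> `|s - t| < eta ->
  potential lam s x = potential lam t x.

Let stable_lt x x' lam t : 0 < t <= 1 -> 0 < x < x' -> reg lam t x -> reg lam t x' ->
  stable x lam t <-> stable x' lam t.
Proof.
move=> ht xx r r'; have [eta eta0 H] := compare ht xx r r'.
split=> -[eta' eta0' H']; exists (Num.min eta eta'); rewrite ?lt_min ?eta0 // => s hs.
  rewrite lt_min => /andP[/H E /(H' s hs)]; move: E; rewrite /potential; move: (nb lam s x) (nb lam s x') (nb lam t x) (nb lam t x') => n1 n2 n3 n4; lra.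
rewrite lt_min => /andP[/H E /(H' s hs)]; move: E; rewrite /potential; move: (nb lam s x) (nb lam s x') (nb lam t x) (nb lam t x') => n1 n2 n3 n4; lra.
Qed.

Let stable_any x x' lam t : 0 < t <= 1 -> 0 < x -> 0 < x' -> reg lam t x -> reg lam t x' ->
  stable x lam t <-> stable x' lam t.
Proof.
move=> ht x0 x0' r r'; case: (ltgtP x x') => [lt|lt|->//].
  by apply: stable_lt => //; rewrite x0.
by apply: iff_sym; apply: stable_lt => //; rewrite x0'.
Qed.

Let stable_bottom x t : 0 < t <= 1 -> 0 < x -> reg laminf t x -> stable x laminf t.
Proof.
move=> ht x0 r; have [eta eta0 H] := base ht x0 r; exists eta => // s hs st.
have zero u : 0 < u <= 1 -> eigen_nb (e u) laminf = 0.
  by move=> hu; rewrite /eigen_nb count_below0 // => l hl; apply: bottom => //; exact: ltW.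
by rewrite /potential !zero // H.
Qed.

Lemma stable_all r t x : 0 < t <= 1 -> laminf <= r -> 0 < x -> reg r t x -> stable x r t.
Proof.
move=> ht lr; pose F lam := forall x, 0 < x -> reg lam t x -> stable x lam t.
suff E : F laminf = F r.
  have : F r by rewrite -E => y y0 ry; exact: stable_bottom.
  exact.
apply: (@locally_constant R Prop F) => // lam _.
have [x0 x00 r0] := reg_ex lam ht.
have [eta eta0 box] := reg_open ht r0.
have FE mu : `|mu - lam| < eta -> F mu <-> stable x0 mu t.
  move=> hmu; have rmu : reg mu t x0 by apply: box; rewrite ?subrr ?normr0.
  split=> [|sx y y0 ry]; first by apply.
  by apply/(@stable_any y x0).
exists eta => // mu _ hmu; apply/propext.
rewrite FE // FE; last by rewrite subrr normr0.
have seg u v s : `|u - lam| < eta -> `|v - lam| < eta -> u <= v -> 0 < s <= 1 ->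
    `|s - t| < eta -> potential u s x0 = potential v s x0.
  move=> hu hv uv hs st; apply: potential_lam => // w /andP[h1 h2]; apply: box => //.
  by move: hu hv; rewrite !ltr_norml => /andP[? ?] /andP[? ?]; apply/andP; split; lra.
have same s : 0 < s <= 1 -> `|s - t| < eta -> potential mu s x0 = potential lam s x0.
  move=> hs st; have l0 : `|lam - lam| < eta by rewrite subrr normr0.
  have [h|/ltW h] := leP mu lam; first exact: seg.
  by apply/esym; exact: seg.
have t0 : `|t - t| < eta by rewrite subrr normr0.
split=> -[eta' eta0' H']; exists (Num.min eta eta'); rewrite ?lt_min ?eta0 // => s hs;
  rewrite lt_min => /andP[h1 h2].
  by rewrite -!same //; exact: H'.
by rewrite !same //; exact: H'.
Qed.

Lemma potential_t r x s1 s2 : laminf <= r -> 0 < x -> 0 < s1 -> s1 <= s2 -> s2 <= 1 ->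
  (forall t, s1 <= t <= s2 -> reg r t x) -> potential r s1 x = potential r s2 x.
Proof.
move=> lr x0 s10 s12 s21 H.
apply: (@locally_constant R R (fun t => potential r t x)) => // t ht.
have ht1 : 0 < t <= 1 by case/andP: ht => ? ?; apply/andP; split; lra.
have [eta eta0 H'] := stable_all ht1 lr x0 (H t ht); exists eta => // y hy yt.
by apply: H' => //; case/andP: hy => ? ?; apply/andP; split; lra.
Qed.

End abstract_flow.

Section flow.
Variables (R : realType) (d D : nat) (Om : 'M[R]_d).
Hypotheses (dD : d = (D + D)%N) (Om2 : Om *m Om = - 1%:M) (OmT : Om^T = - Om).
Variable X : 'M[R]_(d, D).
Hypotheses (lagX : lagrangian_frame Om X) (XX : X^T *m X = 1%:M).
Variable Z : R -> R -> 'M[R]_(d, D).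
Hypothesis lagZ : forall lam t : R, 0 < t < 2 -> lagrangian_frame Om (Z lam t).
Hypothesis cZ : forall lam t : R, 0 < t < 2 ->
  mxcvg (nbhs ((lam, t) : R * R)) (fun p => Z p.1 p.2) (Z lam t).
Hypothesis increasing : forall lam t : R, 0 < t < 2 -> exists K : 'M[R]_D,
  [/\ K^T = K, forall x, x != 0 -> 0 < form K x &
   mxcvg (lam^') (fun mu => (mu - lam)^-1 *: ((Z lam t)^T *m Om *m Z mu t)) K].
Variables (e : R -> R -> nat) (laminf : R).
Hypothesis he : forall t lam : R, 0 < t <= 1 ->
  (D - \rank (frame_im Om X (Z lam t)))%N = (2 * e t lam)%N.
Hypothesis bottom : forall t lam : R, 0 < t <= 1 -> lam <= laminf -> e t lam = 0%N.

Let reg lam t x := pencil Om X (Z lam t) x \in unitmx.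
Let nb lam t x := arc_nb Om X (Z lam t) x.

Let t2 (t : R) : 0 < t <= 1 -> 0 < t < 2.
Proof. by move=> /andP[-> h]; apply: (le_lt_trans h); rewrite ltr1n. Qed.

Let flow (lam t x : R) : 0 < t <= 1 -> 0 < x -> reg lam t x ->
  exists2 eta, 0 < eta & forall mu, `|mu - lam| < eta -> mu != lam ->
    [/\ reg mu t x, e t mu = 0%N &
      nb lam t x = (nb mu t x + if (lam < mu)%R then 2 * e t lam else 0)%N].
Proof.
move=> ht x0 r.
have [eta eta0 H] := flow_lam dD Om2 OmT lagX XX lagZ cZ increasing (t2 ht) x0 r.
exists eta => // mu h1 h2; have [r' m0 n0] := H mu h1 h2.
rewrite !he // in m0 n0; split => //.
by apply/eqP; rewrite -(eqn_pmul2l (isT : 0 < 2)%N) m0.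
Qed.

Let symn (lam t x : R) : 0 < t < 2 -> reg lam t x ->
  \forall s \near t, (cayley Om X (Z lam s) x)^T = cayley Om X (Z lam s) x.
Proof.
move=> ht r; have [eta eta0 H] := reg_box cZ ht r.
have pos : \forall s \near t, 0 < s < 2.
  by apply: (@near_in_itvoo R 0 2 t); rewrite in_itv.
have rt : \forall s \near t, reg lam s x.
  exact: (mxcvg_unit (mxcvg_pencil (x := x) (@mxcvg_t _ _ _ _ cZ lam t ht)) r).
apply: filterS2 pos rt => s hs rs.
exact: (cayley_sym dD Om2 OmT lagX XX (lagZ lam hs) rs).
Qed.

(* comparison of two regular slopes: the difference of the counts is locally
   constant in t *)
Let compare (lam t x x' : R) : 0 < t < 2 -> 0 < x < x' -> reg lam t x -> reg lam t x' ->
  \forall s \near t, ((nb lam s x')%:R - (nb lam s x)%:R : R) =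
    (nb lam t x')%:R - (nb lam t x)%:R.
Proof.
move=> ht xx r r'.
have ct := @mxcvg_t _ _ _ _ cZ lam t ht.
have pos : \forall s \near t, 0 < s < 2.
  by apply: (@near_in_itvoo R 0 2 t); rewrite in_itv.
have rt : \forall s \near t, reg lam s x by exact: (mxcvg_unit (mxcvg_pencil (x := x) ct) r).
have rt' : \forall s \near t, reg lam s x' by exact: (mxcvg_unit (mxcvg_pencil (x := x') ct) r').
pose k := x / x'.
pose M s := (1 - k) *: cayley Om X (Z lam s) x' + k%:M.
have symM s : (cayley Om X (Z lam s) x')^T = cayley Om X (Z lam s) x' -> (M s)^T = M s.
  by move=> E; rewrite /M linearD linearZ /= E tr_scalar_mx.
have cM : mxcvg (nbhs t) M (M t).
  apply: mxcvgD; last exact: mxcvg_cst.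
  by apply: mxcvgZ; [exact: cvg_cst|exact: mxcvg_cayley].
have rM : \rank (M t) = D.
  have [x0 lt] := andP xx; have x0' : 0 < x' by exact: lt_trans lt.
  have := r; rewrite /reg (pencil_cayley x0' r' x) unitmx_mul => /andP[uM _].
  by apply/eqP; rewrite -/(row_free _) row_free_unit.
have symt : (M t)^T = M t.
  by apply: symM; exact: (cayley_sym dD Om2 OmT lagX XX (lagZ lam ht) r').
have symMn : \forall s \near t, (M s)^T = M s.
  by apply: filterS (symn ht r') => s; exact: symM.
have near1 : \forall s \near t, cnt (@isneg R) (eig (M s)) = cnt (@isneg R) (eig (M t)) /\
    cnt (@isnpos R) (eig (M s)) = cnt (@isnpos R) (eig (M t)).
  exact: (near_inertia_regular cM symt rM symMn).
near=> s.
have hs : 0 < s < 2 by near: s.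
have rs : reg lam s x by near: s.
have rs' : reg lam s x' by near: s.
have [E _] : cnt (@isneg R) (eig (M s)) = cnt (@isneg R) (eig (M t)) /\
    cnt (@isnpos R) (eig (M s)) = cnt (@isnpos R) (eig (M t)) by near: s.
have E1 : nb lam s x' = (nb lam s x + cnt (@isneg R) (eig (M s)))%N.
  exact: (arc_nb_lt dD Om2 OmT lagX XX (lagZ lam hs) xx rs rs').
have E2 : nb lam t x' = (nb lam t x + cnt (@isneg R) (eig (M t)))%N.
  exact: (arc_nb_lt dD Om2 OmT lagX XX (lagZ lam ht) xx r r').
exact: natr_diff E1 E2 E.
Unshelve. all: by end_near.
Qed.

Let base t x : 0 < t <= 1 -> 0 < x -> reg laminf t x ->
  exists2 eta, 0 < eta & forall s, `|s - t| < eta -> nb laminf s x = nb laminf t x.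
Proof.
move=> ht x0 r; have ht2 := t2 ht.
have symB := cayley_sym dD Om2 OmT lagX XX (lagZ laminf ht2) r.
have rB : \rank (cayley Om X (Z laminf t) x) = D.
  have z0 : (D - \rank (frame_im Om X (Z laminf t)))%N = 0%N.
    by rewrite he // bottom.
  have := cayley_zero dD Om2 OmT lagX XX (lagZ laminf ht2) x0 r.
  rewrite z0 cnt_eig_zero // => /eqP; rewrite subn_eq0 => h.
  by apply/eqP; rewrite eqn_leq rank_leq_row.
have cc : mxcvg (nbhs t) (fun s => cayley Om X (Z laminf s) x) (cayley Om X (Z laminf t) x).
  by apply: mxcvg_cayley => //; exact: (mxcvg_t cZ).
pose P s := nb laminf s x = nb laminf t x.
have near1 : \forall s \near t, P s.
  apply: filterS (near_inertia_regular cc symB rB (symn ht2 r)) => s [_ E].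
  exact: E.
exact: (@near_ball R P t near1).
Qed.

Lemma flow_potential_t r x s1 s2 : laminf <= r -> 0 < x -> 0 < s1 -> s1 <= s2 -> s2 <= 1 ->
  (forall t, s1 <= t <= s2 -> reg r t x) ->
  potential nb e r s1 x = potential nb e r s2 x.
Proof.
apply: potential_t => //.
- by move=> lam t ht; exact: (regular_slope dD Om2 OmT lagX XX (lagZ lam (t2 ht))).
- by move=> lam t y ht; exact: (reg_box cZ (t2 ht)).
- by move=> lam t y y' ht yy r1 r2; exact: near_ball (compare (t2 ht) yy r1 r2).
Qed.

Lemma flow_count_fin lam t : 0 < t <= 1 -> count_below (e t) lam \is a fin_num.
Proof.
apply: (count_fin (nb := nb) (reg := reg) (laminf := laminf)) => //.
by move=> l s hs; exact: (regular_slope dD Om2 OmT lagX XX (lagZ l (t2 hs))).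
Qed.

Section index.
Variables (r tau : R).
Hypotheses (lr : laminf <= r) (htau : 0 < tau <= 1).

Let good t eps := ~ omspec Om (souriau (plane X) (plane (Z r t))) (expi (pi + eps)).

Let goodP t eps : 0 < t < 2 -> 0 < eps < pi -> good t eps <-> reg r t (slope eps).
Proof.
move=> ht /andP[e0 ep]; rewrite /good omspec_souriau_slope //; last 2 first.
- exact: lagZ.
- by rewrite ltW.
by rewrite /reg; split => [/negP|h]; [rewrite negbK|apply/negP; rewrite negbK].
Qed.

Lemma maslov_value_unique mu :
  maslov_value Om tau 1 (fun t => plane (Z r t)) (plane X) mu ->
  mu = ((2 * (eigen_nb (e tau) r - eigen_nb (e 1) r))%:E).
Proof.
move=> [N [s [eps [s0 sN inc sgood ->]]]].
have mono i j : (i <= j)%N -> (j <= N)%N -> s i <= s j.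
  elim: j => [|j IH]; first by rewrite leqn0 => /eqP ->.
  rewrite leq_eqVlt => /predU1P[->//|]; rewrite ltnS => ij jN.
  by apply: (le_trans (IH ij (ltnW jN))); apply/ltW; have [] := inc j jN.
have sin j : (j <= N)%N -> 0 < s j <= 1.
  move=> jN; have [t0 _] := andP htau.
  rewrite -sN mono // andbT; apply: (lt_le_trans t0); rewrite -s0; exact: mono.
have step (j : 'I_N) : (arc_count Om (souriau (plane X) (plane (Z r (s j.+1)))) (eps j) -
     arc_count Om (souriau (plane X) (plane (Z r (s j)))) (eps j) =
     ((2 * eigen_nb (e (s j)) r - 2 * eigen_nb (e (s j.+1)) r)%:E))%E.
  have jN := ltn_ord j; have [lt heps] := inc j jN.
  have h1 := sin j (ltnW jN); have h2 := sin j.+1 jN.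
  have reg_t t : s j <= t <= s j.+1 -> reg r t (slope (eps j)).
    move=> ht; apply/goodP => //; last by apply: (sgood j) => //; rewrite in_itv.
    apply: t2; case/andP: ht; case/andP: h1; case/andP: h2 => ? ? ? ? ? ?.
    by apply/andP; split; lra.
  rewrite !(arc_count_nb dD Om2 OmT lagX XX) //; try exact/lagZ/t2.
  - rewrite -EFinB; congr EFin.
    have : potential nb e r (s j) (slope (eps j)) = potential nb e r (s j.+1) (slope (eps j)).
      apply: flow_potential_t => //; first exact: slope_gt0.
      + by case/andP: h1.
      + exact: ltW.
      + by case/andP: h2.
    rewrite /potential /nb; move: (arc_nb _ _ _ _) (arc_nb _ _ _ _) => n1 n2; lra.
  - by apply: reg_t; rewrite lexx ltW.
  - by apply: reg_t; rewrite lexx ltW.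
rewrite (eq_bigr _ (fun j _ => step j)) sumEFin; congr EFin.
rewrite -(big_mkord xpredT (fun j => 2 * eigen_nb (e (s j)) r - 2 * eigen_nb (e (s j.+1)) r)).
under eq_bigr do rewrite -opprB; rewrite sumrN telescope_sumr // s0 sN; ring.
Qed.

Lemma maslov_value_exists : exists mu,
  maslov_value Om tau 1 (fun t => plane (Z r t)) (plane X) mu.
Proof.
pose Part u v := exists (N : nat) (s eps : nat -> R),
  [/\ s 0%N = u, s N = v, forall j, (j < N)%N -> s j < s j.+1 /\ 0 < eps j < pi &
    forall j t, (j < N)%N -> t \in `[s j, s j.+1] -> good t (eps j)].
suff [N [s [eps [H1 H2 H3 H4]]]] : Part tau 1.
  by exists (\sum_(j < N) (arc_count Om (souriau (plane X) (plane (Z r (s j.+1)))) (eps j) -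
           arc_count Om (souriau (plane X) (plane (Z r (s j)))) (eps j)))%E; exists N, s, eps.
have [t0 t1] := andP htau.
apply: cousin => //.
  move=> x y z xy yz [N1 [s1 [e1 [a1 b1 c1 d1]]]] [N2 [s2 [e2 [a2 b2 c2 d2]]]].
  pose s j := if (j <= N1)%N then s1 j else s2 (j - N1)%N.
  pose ep j := if (j < N1)%N then e1 j else e2 (j - N1)%N.
  have s2E j : (N1 <= j)%N -> s j = s2 (j - N1)%N.
    move=> h2; rewrite /s; case: (leqP j N1) => // h1.
    have -> : j = N1 by apply/eqP; rewrite eqn_leq h1 h2.
    by rewrite subnn b1 a2.
  exists (N1 + N2)%N, s, ep; split.
  - by rewrite /s leq0n.
  - by rewrite s2E ?leq_addr // addKn.
  - move=> j jN; rewrite /ep; case: ltnP => h.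
      by rewrite /s h ltnW //; exact: c1.
    rewrite !s2E ?(leqW h) // subSn //; apply: c2.
    by rewrite ltn_subLR.
  - move=> j t jN; rewrite /ep; case: ltnP => h.
      by rewrite /s h ltnW //; exact: d1.
    rewrite !s2E ?(leqW h) // subSn //; apply: d2.
    by rewrite ltn_subLR.
move=> t /andP[h1 h2]; have ht : 0 < t <= 1 by apply/andP; split; lra.
have [x x0 rx] := regular_slope dD Om2 OmT lagX XX (lagZ r (t2 ht)).
have [ep hep Eep] := slope_surj (ltW x0).
have ep0 : 0 < ep < pi.
  case/andP: hep => h3 ->; rewrite andbT lt_neqAle h3 andbT; apply/eqP => E.
  by move: Eep; rewrite /slope -E mul0r tan0; lra.
have [eta eta0 H] := near_ball (mxcvg_unit (mxcvg_pencil (x := x) (@mxcvg_t _ _ _ _ cZ r t (t2 ht))) rx).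
exists eta => // u v tu ut uu' tv vt v1.
have [->|uv] := eqVneq u v.
  by exists 0%N, (fun=> v), (fun=> ep); split.
exists 1%N, (fun j => if j is 0 then u else v), (fun=> ep); split => //.
  move=> j; rewrite ltnS leqn0 => /eqP ->; split => //.
  by rewrite lt_neqAle uv; lra.
move=> j w; rewrite ltnS leqn0 => /eqP ->; rewrite in_itv /= => /andP[uw wv].
apply/goodP => //; first by apply: t2; apply/andP; split; lra.
by rewrite Eep; apply: H; rewrite ltr_norml; apply/andP; split; lra.
Qed.

Theorem Mas_eigen_nb :
  Mas Om tau 1 (fun t => plane (Z r t)) (plane X) =
  (2 * (eigen_nb (e tau) r - eigen_nb (e 1) r))%:E.
Proof.
have [t0 t1] := andP htau.
have [mu Hmu] := maslov_value_exists.
apply: xget_unique => [|nu [_ _ _]]; last exact: maslov_value_unique.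
rewrite -(maslov_value_unique Hmu); split => //.
- exact: (lagrangian_plane dD Om2 OmT lagX).
- move=> t; rewrite in_itv /= => /andP[h1 h2].
  apply: (lagrangian_plane dD Om2 OmT); apply: lagZ; apply: t2; apply/andP; split; lra.
- apply/subspace_continuousP => t /=; rewrite in_itv /= => /andP[h1 h2].
  have ht : 0 < t < 2 by apply: t2; apply/andP; split; lra.
  have ct := @mxcvg_t _ _ _ _ cZ r t ht.
  have cP : mxcvg (nbhs t) (fun s => frame_proj (Z r s)) (frame_proj (Z r t)).
    apply: mxcvg_mul; last exact: mxcvg_tr.
    apply: mxcvg_mul => //; apply: mxcvg_inv; last by case: (lagZ r ht).
    by apply: mxcvg_mul => //; exact: mxcvg_tr.
  have pos : \forall s \near t, 0 < s < 2.
    by apply: (@near_in_itvoo R 0 2 t); rewrite in_itv.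
  have proj s : 0 < s < 2 -> orthproj (plane (Z r s)) = frame_proj (Z r s).
    by move=> hs; exact: (orthproj_plane (lagZ r hs)).
  have cP2 : (fun s => orthproj (plane (Z r s))) s @[s --> t] --> orthproj (plane (Z r t)).
    rewrite proj //; apply/cvgrPdist_le => e0 e00.
    have small : \forall s \near t, forall i j, `|(frame_proj (Z r s) - frame_proj (Z r t)) i j| <= e0.
      exact: mxcvg_near_le cP e00.
    near=> s; have hs : 0 < s < 2 by near: s.
    have sm : forall i j, `|(frame_proj (Z r s) - frame_proj (Z r t)) i j| <= e0 by near: s.
    rewrite proj // distrC.
    by rewrite /Num.Def.normr /= mx_normrE; apply/bigmax_leP; split; [exact: ltW|move=> [i j] _; exact: sm].
  exact: cvg_within_filter cP2.
Unshelve. all: by end_near.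
Qed.

End index.
End flow.

Lemma ker_basis_rank (F : fieldType) (q m s : nat) (A : 'M[F]_(q, m))
    (K : 'M[F]_(m, s)) :
  A *m K = 0 -> (forall c : 'cV_s, K *m c = 0 -> c = 0) ->
  (forall z : 'cV_m, A *m z = 0 -> exists c, z = K *m c) ->
  (m - \rank A)%N = s.
Proof.
move=> AK Kinj Kall; rewrite -(mxrank_tr A) -mxrank_ker.
have -> : \rank (kermx A^T) = \rank K^T.
  apply: eqmx_rank; apply/andP; split.
    apply/row_subP => i; have [c zE] : exists c, (row i (kermx A^T))^T = K *m c.
      apply: Kall; apply: trmx_inj; rewrite trmx_mul trmxK trmx0.
      by apply/sub_kermxP; rewrite row_sub.
    by rewrite -[row i _]trmxK zE trmx_mul submxMl.
  by apply/sub_kermxP; rewrite -trmx_mul AK trmx0.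
rewrite mxrank_tr; apply/eqP; rewrite eqn_leq rank_leq_col /= leqNgt.
by apply/negP => /deficient_ker[c c0 /Kinj /eqP]; rewrite (negPf c0).
Qed.

Section realification.
Variable R : realType.

Definition e2 (j : 'I_2) : 'cV[R]_2 := delta_mx j 0.

Definition interleave (n : nat) (p q : 'cV[R]_n) : 'cV[R]_(n * 2) :=
  p *t e2 0 + q *t e2 1.

Lemma interleaveE n (p q : 'cV[R]_n) i (j : 'I_2) :
  interleave p q (mxtens_index (i, j)) 0 = if j == 0 then p i 0 else q i 0.
Proof.
rewrite /interleave mxE; rewrite [X in X + _]mxE [X in _ + X]mxE !mxtens_indexK !mxE /= !ord1.
by case: j => -[|[|//]] ?; rewrite /= ?mulr1 ?mulr0 ?addr0 ?add0r.
Qed.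

Lemma interleave_inj n (p q p' q' : 'cV[R]_n) :
  interleave p q = interleave p' q' -> p = p' /\ q = q'.
Proof.
move=> E; split; apply/matrixP => i j; rewrite ord1.
  by have := interleaveE p q i 0; rewrite E interleaveE.
by have := interleaveE p q i 1; rewrite E interleaveE.
Qed.

Lemma interleave_onto n (w : 'cV[R]_(n * 2)) : exists p q, w = interleave p q.
Proof.
exists (\col_i w (mxtens_index (i, 0)) 0), (\col_i w (mxtens_index (i, 1)) 0).
apply/matrixP => i j; rewrite ord1; case: (mxtens_indexP i) => {}i k.
rewrite interleaveE !mxE; case: k => -[|[|//]] h /=; congr (w (mxtens_index (_, _)) _);
  exact: val_inj.
Qed.

Definition tensv n (p : 'cV[R]_n) (e : 'cV[R]_2) : 'cV[R]_(n * 2) := p *t e.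

Lemma tens_mulv n m (A : 'M[R]_(m, n)) (B : 'M[R]_2) (p : 'cV[R]_n) (e : 'cV[R]_2) :
  (A *t B) *m tensv p e = tensv (A *m p) (B *m e).
Proof. exact (tensmx_mul A B p e). Qed.

Lemma tens_interleave n m (A : 'M[R]_(m, n)) (B : 'M[R]_2) (p q : 'cV[R]_n) :
  (A *t B) *m interleave p q = tensv (A *m p) (B *m e2 0) + tensv (A *m q) (B *m e2 1).
Proof. by rewrite /interleave -!/(tensv _ _) mulmxDr !tens_mulv. Qed.

Lemma tens1_interleave n m (A : 'M[R]_(m, n)) (p q : 'cV[R]_n) :
  (A *t (1%:M : 'M[R]_2)) *m interleave p q = interleave (A *m p) (A *m q).
Proof. by rewrite tens_interleave !mul1mx. Qed.

Lemma rotmxE (theta : R) :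
  rotmx theta = \matrix_(i, j) (if i == j then cos theta
                                else if i == 0 then - sin theta else sin theta).
Proof.
apply/matrixP => -[[|[|//]] hi] -[[|[|//]] hj]; rewrite !mxE;
  do ?(case: splitP => k; rewrite [k]ord1 //= => {k} _; rewrite !mxE);
  by rewrite ?mulr1n.
Qed.

(** Multiplication by a complex number of modulus one becomes a rotation of
    each interleaved pair. *)
Lemma rot_interleave n (theta : R) (p q : 'cV[R]_n) :
  ((1%:M : 'M[R]_n) *t rotmx theta) *m interleave p q =
  interleave (cos theta *: p - sin theta *: q) (sin theta *: p + cos theta *: q).
Proof.
rewrite tens_interleave !mul1mx; apply/matrixP => i j; rewrite ord1.
case: (mxtens_indexP i) => {}i k; rewrite interleaveE rotmxE /e2 -!colE.
rewrite mxE [X in X + _]mxE [X in _ + X]mxE !mxtens_indexK !mxE /= !ord1.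
by case: k => -[|[|//]] h; rewrite /= ?mxE /=; ring.
Qed.

Lemma rotmx_orthogonal (theta : R) : (rotmx theta)^T *m rotmx theta = 1%:M.
Proof.
apply/matrixP => i j; rewrite rotmxE !mxE !big_ord_recl big_ord0 !mxE.
have := cos2Dsin2 theta; case: i => -[|[|//]] h; case: j => -[|[|//]] h' /=; lra.
Qed.

Lemma tensmx11 (n m : nat) : (1%:M : 'M[R]_n) *t (1%:M : 'M[R]_m) = 1%:M.
Proof.
apply/matrixP => i j; case: (mxtens_indexP i) => {}i i'; case: (mxtens_indexP j) => {}j j'.
by rewrite tensmxE !mxE (can_eq (@mxtens_indexK n m)) xpair_eqE; case: eqP; case: eqP;
  rewrite /= ?mulr1 ?mulr0.
Qed.

Lemma tens_rotmx_orthogonal n (theta : R) :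
  ((1%:M : 'M[R]_n) *t rotmx theta)^T *m (1%:M *t rotmx theta) = 1%:M.
Proof. by rewrite trmx_tens tensmx_mul trmx1 mul1mx rotmx_orthogonal tensmx11. Qed.

Lemma derive_interleave n x (p q : R -> 'cV[R]_n) p' q' :
  derive_mx x p p' -> derive_mx x q q' ->
  derive_mx x (fun y => interleave (p y) (q y)) (interleave p' q').
Proof.
move=> dp dq i j; rewrite ord1; case: (mxtens_indexP i) => {}i k.
rewrite interleaveE (_ : (fun y => _) = fun y => if k == 0 then p y i 0 else q y i 0).
  by case: eqP => _; [exact: dp|exact: dq].
by apply/funext => y; rewrite interleaveE.
Qed.

Lemma within_interleave n a b (p q : R -> 'cV[R]_n) :
  within_cont_mx a b p -> within_cont_mx a b q ->
  within_cont_mx a b (fun y => interleave (p y) (q y)).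
Proof.
move=> cp cq i j; rewrite ord1; case: (mxtens_indexP i) => {}i k.
apply: (@within_ext _ _ _ _ (fun y => if k == 0 then p y i 0 else q y i 0)).
  by move=> y; rewrite interleaveE.
by case: eqP => _; [exact: cp|exact: cq].
Qed.

Lemma interleave_lin n (a b : R) (p q p' q' : 'cV[R]_n) :
  interleave (a *: p + b *: p') (a *: q + b *: q') =
  a *: interleave p q + b *: interleave p' q'.
Proof.
apply/matrixP => i j; rewrite ord1; case: (mxtens_indexP i) => {}i k.
rewrite interleaveE [RHS]mxE [X in _ = X + _]mxE [X in _ = _ + X]mxE !interleaveE.
by rewrite !mxE; case: eqP.
Qed.

Section system.
Variable n : nat.

(** The Cauchy data of a C^n-valued function with real part p and imaginary
    part q, regarded as those of an R^(2n)-valued function. *)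
Definition interleave2 (p q : 'cV[R]_(n + n)) : 'cV[R]_(n * 2 + n * 2) :=
  col_mx (interleave (usubmx p) (usubmx q)) (interleave (dsubmx p) (dsubmx q)).

Lemma interleave2_lin (a b : R) (p q p' q' : 'cV[R]_(n + n)) :
  interleave2 (a *: p + b *: p') (a *: q + b *: q') =
  a *: interleave2 p q + b *: interleave2 p' q'.
Proof.
rewrite /interleave2 !scale_col_mx add_col_mx -!interleave_lin.
by rewrite ![usubmx (_ + _)]raddfD ![dsubmx (_ + _)]raddfD /= !linearZ.
Qed.

Lemma interleave2_inj p q p' q' :
  interleave2 p q = interleave2 p' q' -> p = p' /\ q = q'.
Proof.
move=> /eq_col_mx[/interleave_inj[pu qu] /interleave_inj[pd qd]].
by rewrite -[p]vsubmxK -[q]vsubmxK pu qu pd qd !vsubmxK.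
Qed.

Lemma interleave2_onto w : exists p q, w = interleave2 p q.
Proof.
have [pu [qu Eu]] := interleave_onto (usubmx w).
have [pd [qd Ed]] := interleave_onto (dsubmx w).
exists (col_mx pu pd), (col_mx qu qd).
by rewrite /interleave2 !col_mxKu !col_mxKd -Eu -Ed vsubmxK.
Qed.

Variables (a b : R) (V : R -> 'M[R]_n).
Hypotheses (ab : a < b) (cV : within_cont_mx a b V) (symV : forall x, (V x)^T = V x).

Definition tensV (x : R) : 'M[R]_(n * 2) := V x *t (1%:M : 'M[R]_2).

Lemma tensV_sym x : (tensV x)^T = tensV x.
Proof. by rewrite /tensV trmx_tens symV trmx1. Qed.

Lemma within_tensV : within_cont_mx a b tensV.
Proof.
move=> i j; case: (mxtens_indexP i) => {}i i'; case: (mxtens_indexP j) => {}j j'.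
apply: (@within_ext _ _ _ _ (fun y => V y i j * (1%:M : 'M[R]_2) i' j')).
  by move=> y; rewrite tensmxE.
have cc := @within_cont_cst R a b ((1%:M : 'M[R]_2) i' j').
by move=> y; exact: (cvgM (@cV i j y) (@cc y)).
Qed.

Lemma schr_mx_interleave2 lam x p q :
  schr_mx tensV lam x *m interleave2 p q =
  interleave2 (schr_mx V lam x *m p) (schr_mx V lam x *m q).
Proof.
rewrite -[in RHS](vsubmxK p) -[in RHS](vsubmxK q) /schr_mx /interleave2 !mul_block_col.
rewrite !mul0mx !mul1mx !add0r !addr0 !col_mxKu !col_mxKd; congr col_mx.
rewrite mulmxBl tens1_interleave mul_scalar_mx !mulmxBl !mul_scalar_mx.
have := interleave_lin 1 (- lam) (V x *m usubmx p) (V x *m usubmx q) (usubmx p) (usubmx q).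
by rewrite !scale1r !scaleNr => ->.
Qed.

Lemma fund_interleave2 lam x p q : a <= x <= b ->
  fund a b tensV lam x *m interleave2 p q =
  interleave2 (fund a b V lam x *m p) (fund a b V lam x *m q).
Proof.
have [z1 cz dz] := fundP ab cV lam.
have [y1 cy dy] := fundP ab within_tensV lam.
pose S y := interleave2 (fund a b V lam y *m p) (fund a b V lam y *m q).
have cw (v : 'cV[R]_(n + n)) : within_cont_mx a b (fun y => fund a b V lam y *m v).
  by apply: within_cont_mul => //; exact: within_cont_mx_cst.
have dw (v : 'cV[R]_(n + n)) y : a < y < b -> derive_mx y (fun y => fund a b V lam y *m v)
    (schr_mx V lam y *m (fund a b V lam y *m v)).
  move=> yab; have := derive_mx_mul (dz y yab) (derive_mx_cst y v).
  by rewrite mulmx0 addr0 -mulmxA.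
have cu (F : R -> 'cV[R]_(n + n)) : within_cont_mx a b F ->
    within_cont_mx a b (fun y => usubmx (F y)) /\ within_cont_mx a b (fun y => dsubmx (F y)).
  move=> cF; split=> i j; [apply: within_ext (cF (lshift n i) j)|
    apply: within_ext (cF (rshift n i) j)] => y; by rewrite mxE.
have du (F : R -> 'cV[R]_(n + n)) F' y : derive_mx y F F' ->
    derive_mx y (fun y => usubmx (F y)) (usubmx F') /\
    derive_mx y (fun y => dsubmx (F y)) (dsubmx F').
  move=> dF; split=> i j; rewrite mxE.
    by rewrite (_ : (fun y => _) = fun y => F y (lshift n i) j) //; apply/funext => z; rewrite mxE.
  by rewrite (_ : (fun y => _) = fun y => F y (rshift n i) j) //; apply/funext => z; rewrite mxE.
have cS : within_cont_mx a b S.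
  have [c1 c2] := cu _ (cw p); have [c3 c4] := cu _ (cw q).
  have ci1 := within_interleave c1 c3; have ci2 := within_interleave c2 c4.
  move=> i j; rewrite /S /interleave2; have [i'|i'] := split_ordP i => ->.
    by apply: within_ext (ci1 i' j) => y; rewrite col_mxEu.
  by apply: within_ext (ci2 i' j) => y; rewrite col_mxEd.
have dS y : a < y < b -> derive_mx y S (schr_mx tensV lam y *m S y).
  move=> yab; rewrite schr_mx_interleave2.
  have [c1 c2] := du _ _ _ (dw p y yab); have [c3 c4] := du _ _ _ (dw q y yab).
  have ci1 := derive_interleave c1 c3; have ci2 := derive_interleave c2 c4.
  move=> i j; rewrite /S /interleave2; have [i'|i'] := split_ordP i => ->.
    rewrite col_mxEu; rewrite (_ : (fun y => _) = fun y => interleave (usubmx (fund a b V lam y *m p)) (usubmx (fund a b V lam y *m q)) i' j) //.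
    by apply/funext => z; rewrite col_mxEu.
  rewrite col_mxEd; rewrite (_ : (fun y => _) = fun y => interleave (dsubmx (fund a b V lam y *m p)) (dsubmx (fund a b V lam y *m q)) i' j) //.
  by apply/funext => z; rewrite col_mxEd.
have [w wE] := fund_complete ab within_tensV tensV_sym (lexx a) (lexx b) cS dS.
move=> xab; have := wE a; rewrite lexx (ltW ab) => /(_ isT).
by rewrite /S z1 y1 !mul1mx => ->; rewrite -wE.
Qed.

End system.

Definition cplx (m : nat) (p q : 'cV[R]_m) : 'cV[R[i]]_m :=
  \col_i Complex (p i 0) (q i 0).

Lemma Re_cplx m (p q : 'cV[R]_m) : map_mx (@complex.Re R) (cplx p q) = p.
Proof. by apply/matrixP => i j; rewrite !mxE ord1. Qed.

Lemma Im_cplx m (p q : 'cV[R]_m) : map_mx (@complex.Im R) (cplx p q) = q.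
Proof. by apply/matrixP => i j; rewrite !mxE ord1. Qed.

Lemma cplxK m (z : 'cV[R[i]]_m) :
  cplx (map_mx (@complex.Re R) z) (map_mx (@complex.Im R) z) = z.
Proof. by apply/matrixP => i j; rewrite !mxE ord1; case: (z i 0). Qed.

Lemma Re_lin m (a b : R) (z z' : 'cV[R[i]]_m) :
  map_mx (@complex.Re R) (a%:C%C *: z + b%:C%C *: z') =
  a *: map_mx (@complex.Re R) z + b *: map_mx (@complex.Re R) z'.
Proof.
apply/matrixP => i j; rewrite !mxE; case: (z i j) => x y; case: (z' i j) => x' y' /=.
by ring.
Qed.

Lemma Im_lin m (a b : R) (z z' : 'cV[R[i]]_m) :
  map_mx (@complex.Im R) (a%:C%C *: z + b%:C%C *: z') =
  a *: map_mx (@complex.Im R) z + b *: map_mx (@complex.Im R) z'.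
Proof.
apply/matrixP => i j; rewrite !mxE; case: (z i j) => x y; case: (z' i j) => x' y' /=.
by ring.
Qed.

Lemma cplx_lin m (a b : R) (p q p' q' : 'cV[R]_m) :
  cplx (a *: p + b *: p') (a *: q + b *: q') =
  a%:C%C *: cplx p q + b%:C%C *: cplx p' q'.
Proof. by apply/matrixP => i j; rewrite !mxE; congr Complex => /=; ring. Qed.

Lemma lin_matrix m k (f : 'cV[R]_m -> 'cV[R]_k) :
  (forall a b u v, f (a *: u + b *: v) = a *: f u + b *: f v) ->
  forall w, f w = (\matrix_(i, j) f (delta_mx j 0) i 0) *m w.
Proof.
move=> flin w.
have f0 : f 0 = 0 by have := flin 0 0 0 0; rewrite !scale0r !addr0.
have fsum (c : 'I_m -> R) (e : 'I_m -> 'cV[R]_m) :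
    f (\sum_j c j *: e j) = \sum_j c j *: f (e j).
  elim/big_ind2 : _ => // [u1 u2 v1 v2 <- <-|j _].
    by have := flin 1 1 u2 v2; rewrite !scale1r.
  by have := flin (c j) 0 (e j) 0; rewrite scaler0 scale0r !addr0.
have {1}-> : w = \sum_j w j 0 *: delta_mx j 0.
  by rewrite {1}(matrix_sum_delta w); apply: eq_bigr => j _; rewrite big_ord1.
rewrite fsum; apply/matrixP => i j; rewrite ord1 summxE mxE.
by apply: eq_bigr => l _; rewrite !mxE mulrC.
Qed.

(** A complex subspace has twice its complex dimension over the reals. *)
Lemma corank_realification n q m (B : 'M[R]_(q, n * 2 + n * 2))
    (A : 'M[R[i]]_(m, n + n)) :
  (forall p r, B *m interleave2 p r = 0 <-> A *m cplx p r = 0) ->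
  ((n * 2 + n * 2) - \rank B)%N = (2 * ((n + n) - \rank A))%N.
Proof.
move=> BA; have [K [AK Kinj Kall]] := ker_basis A.
move: (n + n - \rank A)%N K AK Kinj Kall => s K AK Kinj Kall.
pose z (w : 'cV[R]_(s + s)) := K *m cplx (usubmx w) (dsubmx w).
pose f w := interleave2 (map_mx (@complex.Re R) (z w)) (map_mx (@complex.Im R) (z w)).
have flin a b u v : f (a *: u + b *: v) = a *: f u + b *: f v.
  have zlin : z (a *: u + b *: v) = a%:C%C *: z u + b%:C%C *: z v.
    by rewrite /z [usubmx _]raddfD [dsubmx _]raddfD /= !linearZ /= cplx_lin mulmxDr -!scalemxAr.
  by rewrite /f zlin Re_lin Im_lin interleave2_lin.
rewrite mulSn mul1n; apply: (ker_basis_rank (K := \matrix_(i, j) f (delta_mx j 0) i 0)).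
- apply/matrixP => i j; rewrite [RHS]mxE.
  have Bf w : B *m f w = 0 by apply/BA; rewrite cplxK /z mulmxA AK mul0mx.
  have := Bf (delta_mx j 0); rewrite (lin_matrix flin) mulmxA -colE.
  by move=> /matrixP/(_ i 0); rewrite mxE [RHS]mxE.
- move=> c; rewrite -lin_matrix // => f0.
  have : f c = interleave2 0 0.
    have := interleave2_lin 0 0 (0 : 'cV[R]_(n + n)) 0 0 0.
    by rewrite !scale0r !addr0 => ->.
  move=> /interleave2_inj[H1 H2]; have /Kinj E : z c = 0.
    rewrite -(cplxK (z c)) H1 H2; apply/matrixP => i j; rewrite !mxE.
    by apply/eqP; rewrite eq_complex /= !eqxx.
  have : cplx (usubmx c) (dsubmx c) = cplx 0 0.
    rewrite E; apply/matrixP => i j; rewrite !mxE.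
    by apply/esym/eqP; rewrite eq_complex /= !eqxx.
  move=> E2; rewrite -[c]vsubmxK -(Re_cplx (usubmx c) (dsubmx c)).
  by rewrite -{2}(Im_cplx (usubmx c) (dsubmx c)) E2 Re_cplx Im_cplx col_mx0.
- move=> w; have [p [r ->]] := interleave2_onto w => /BA/Kall[c cE].
  exists (col_mx (map_mx (@complex.Re R) c) (map_mx (@complex.Im R) c)).
  rewrite -lin_matrix // /f /z col_mxKu col_mxKd cplxK -cE.
  by rewrite Re_cplx Im_cplx.
Qed.

(** The quasi-periodic boundary condition, before and after separating real
    and imaginary parts. *)
Lemma boundary_interleave2 n (F G : 'M[R]_(n + n)) (F2 G2 : 'M[R]_(n * 2 + n * 2))
    (theta : R) (M := (1%:M : 'M[R]_n) *t rotmx theta) :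
  (forall p q, F2 *m interleave2 p q = interleave2 (F *m p) (F *m q)) ->
  (forall p q, G2 *m interleave2 p q = interleave2 (G *m p) (G *m q)) ->
  forall p q, (F2 - block_mx M 0 0 M *m G2) *m interleave2 p q = 0 <->
    (map_mx (real_complex R) F - expi theta *: map_mx (real_complex R) G) *m cplx p q = 0.
Proof.
move=> HF HG p q; rewrite mulmxBl -mulmxA HF HG [X in block_mx _ _ _ _ *m X]/interleave2.
rewrite mul_block_col !mul0mx addr0 add0r !rot_interleave.
set Gp := G *m p; set Gq := G *m q.
have -> : (map_mx (real_complex R) F - expi theta *: map_mx (real_complex R) G) *m cplx p q =
    cplx (F *m p) (F *m q) -
    cplx (cos theta *: Gp - sin theta *: Gq) (sin theta *: Gp + cos theta *: Gq).
  apply/matrixP => i j; rewrite ord1 mulmxBl -scalemxAl.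
  rewrite mxE [X in _ + X]mxE [X in - X]mxE !complex_mulmx Re_cplx Im_cplx -/Gp -/Gq.
  by rewrite !mxE /expi; congr Complex => /=; ring.
have -> : col_mx (interleave (cos theta *: usubmx Gp - sin theta *: usubmx Gq)
      (sin theta *: usubmx Gp + cos theta *: usubmx Gq))
    (interleave (cos theta *: dsubmx Gp - sin theta *: dsubmx Gq)
      (sin theta *: dsubmx Gp + cos theta *: dsubmx Gq)) =
    interleave2 (cos theta *: Gp - sin theta *: Gq) (sin theta *: Gp + cos theta *: Gq).
  by rewrite /interleave2 !linearB !linearD /= !linearZ.
split => [/eqP|/eqP]; rewrite subr_eq0 => /eqP.
  by move=> /interleave2_inj[-> ->]; rewrite subrr.
move=> E; have E1 := congr1 (map_mx (@complex.Re R)) E.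
have E2 := congr1 (map_mx (@complex.Im R)) E.
by move: E1 E2; rewrite !Re_cplx !Im_cplx => -> ->; rewrite subrr.
Qed.

End realification.

Section stacking.
Variables (R : realType) (n : nat).
Notation k := (n * 2)%N.

Definition stack4mx p (A B C D : 'M[R]_(k, p)) : 'M[R]_(2 * (4 * n), p) :=
  castmx (stack4_dim n, erefl p) (col_mx (col_mx A B) (col_mx C D)).

Lemma stack4mx_mul p q (A B C D : 'M[R]_(k, p)) (W : 'M[R]_(p, q)) :
  stack4mx A B C D *m W = stack4mx (A *m W) (B *m W) (C *m W) (D *m W).
Proof.
rewrite /stack4mx -!mul_col_mx; move: (col_mx _ _) => Y.
by case: (2 * (4 * n))%N / (stack4_dim n); rewrite !castmx_id.
Qed.

Lemma stack4E (a b c d : 'cV[R]_k) : stack4 a b c d = stack4mx a b c d.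
Proof. by []. Qed.

Lemma stack4mx_inj p (A B C D A' B' C' D' : 'M[R]_(k, p)) :
  stack4mx A B C D = stack4mx A' B' C' D' -> [/\ A = A', B = B', C = C' & D = D'].
Proof.
rewrite /stack4mx => /(can_inj (castmxK _ _)).
by move=> /eq_col_mx[/eq_col_mx[-> ->] /eq_col_mx[-> ->]].
Qed.

Lemma stack4mx_dot p q (A B C D : 'M[R]_(k, p)) (A' B' C' D' : 'M[R]_(k, q)) :
  (stack4mx A B C D)^T *m stack4mx A' B' C' D' =
  A^T *m A' + B^T *m B' + (C^T *m C' + D^T *m D').
Proof.
have castT d (e : (k + k + (k + k) = d)%N) Y Y' :
    (castmx (e, erefl p) Y)^T *m castmx (e, erefl q) Y' = Y^T *m Y'.
  by case: d / e; rewrite !castmx_id.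
by rewrite castT !tr_col_mx !mul_row_col.
Qed.

Lemma sum_tens (m D : nat) (F : 'I_(m * D) -> R) :
  \sum_i F i = \sum_a \sum_b F (mxtens_index (a, b)).
Proof.
rewrite (reindex (@mxtens_index m D)) /=; last first.
  by exists (@mxtens_unindex m D) => x _; [exact: mxtens_indexK|exact: mxtens_unindexK].
by rewrite pair_bigA; apply: eq_bigr => -[].
Qed.

Lemma JmxE : Jmx R = \matrix_(i, j) (if i == j then 0 else if i == 0 then 1 else - 1).
Proof.
apply/matrixP => -[[|[|//]] hi] -[[|[|//]] hj]; rewrite !mxE;
  do ?(case: splitP => l; rewrite [l]ord1 //= => {l} _; rewrite !mxE);
  by rewrite ?mulr1n.
Qed.

Lemma Jmx_tens D p (e : (D + D = 2 * D)%N) (u v : 'M[R]_(D, p)) :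
  (Jmx R *t (1%:M : 'M[R]_D)) *m castmx (e, erefl p) (col_mx u v) =
  castmx (e, erefl p) (col_mx v (- u)).
Proof.
have E (i : 'I_2) j l (x y : 'M[R]_(D, p)) :
    castmx (e, erefl p) (col_mx x y) (mxtens_index (i, j)) l = if i == 0 then x j l else y j l.
  rewrite castmxE /= cast_ord_id; case: i => -[|[|//]] h /=.
    by rewrite (_ : cast_ord _ _ = lshift D j) ?col_mxEu //; apply: val_inj; rewrite /= mul0n.
  by rewrite (_ : cast_ord _ _ = rshift D j) ?col_mxEd //; apply: val_inj; rewrite /= mul1n.
apply/matrixP => i l; case: (mxtens_indexP i) => {}i j; rewrite E mxE.
rewrite sum_tens.
rewrite !big_ord_recl big_ord0 addr0.
have inner (a : 'I_2) (w : 'M[R]_(D, p)) : \sum_(b < D) (Jmx R *t (1%:M : 'M[R]_D)) (mxtens_index (i, j)) (mxtens_index (a, b)) * w b l = Jmx R i a * w j l.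
  rewrite (bigD1 j) //= tensmxE [X in _ * X * _]mxE eqxx mulr1 big1 ?addr0 // => b bj.
  by rewrite tensmxE [X in _ * X * _]mxE eq_sym (negPf bj) mulr0 mul0r.
under eq_bigr do rewrite E; under [X in _ + X]eq_bigr do rewrite E.
rewrite /= !inner JmxE !mxE.
by case: i {inner} => -[|[|//]] h /=; ring.
Qed.

Lemma Omega_stack4mx p (A B C D : 'M[R]_(k, p)) :
  Omega R n *m stack4mx A B C D = stack4mx (- C) (- D) A B.
Proof.
rewrite /Omega /stack4mx mulNmx -[in RHS]opp_col_mx.
move: (col_mx A B) (col_mx C D) => U V.
have kk : (k + k = 4 * n)%N by rewrite -mulnDr mulnC.
move: (stack4_dim n); move: (4 * n)%N kk => m kk; case: m / kk => e.
have castN' Y : - castmx (e, erefl p) Y = castmx (e, erefl p) (- Y).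
  by apply/matrixP => i j; rewrite castmxE !mxE castmxE.
by rewrite Jmx_tens castN' opp_col_mx opprK.
Qed.

Lemma Omega_sqr : Omega R n *m Omega R n = - 1%:M.
Proof.
rewrite /Omega mulmxN mulNmx opprK tensmx_mul mulmx1 -tensmx11.
have -> : Jmx R *m Jmx R = - 1%:M.
  apply/matrixP => i j; rewrite JmxE !mxE !big_ord_recl big_ord0 !mxE.
  by case: i => -[|[|//]] h; case: j => -[|[|//]] h' /=; rewrite ?mulr1n ?mulr0n; ring.
by apply/matrixP => i j; rewrite !mxE mulNr.
Qed.

Lemma Omega_tr : (Omega R n)^T = - Omega R n.
Proof.
rewrite /Omega linearN /= trmx_tens trmx1; congr (- _).
have -> : (Jmx R)^T = - Jmx R.
  apply/matrixP => i j; rewrite JmxE !mxE.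
  by case: i => -[|[|//]] h; case: j => -[|[|//]] h' /=; rewrite ?oppr0 ?opprK.
by apply/matrixP => i j; rewrite !mxE mulNr.
Qed.

Section boundary_plane.
Variable theta : R.
Let M := (1%:M : 'M[R]_n) *t rotmx theta.

Definition frameF : 'M[R]_(2 * (4 * n), k + k) :=
  (Num.sqrt 2)^-1 *: stack4mx (row_mx 1%:M 0) (row_mx M 0) (row_mx 0 (- 1%:M)) (row_mx 0 M).

Lemma planeF_plane : planeF n theta = plane frameF.
Proof.
have s0 : Num.sqrt 2 != 0 :> R by rewrite sqrtr_eq0 -ltNge.
have FE p q : frameF *m col_mx p q = (Num.sqrt 2)^-1 *: stack4 p (M *m p) (- q) (M *m q).
  rewrite /frameF -scalemxAl stack4mx_mul !mul_row_col !mul0mx !add0r !addr0.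
  by rewrite mulNmx !mul1mx.
apply/seteqP; split => [_ [p [q ->]]|_ [w _ <-]].
  exists (Num.sqrt 2 *: col_mx p q) => //.
  by rewrite -scalemxAr FE scalerA divff // scale1r.
exists ((Num.sqrt 2)^-1 *: usubmx w), ((Num.sqrt 2)^-1 *: dsubmx w).
rewrite -[w in LHS]vsubmxK FE; move: (usubmx w) (dsubmx w) => p q.
rewrite -!scalemxAr -scalerN !stack4E.
have := stack4mx_mul p (M *m p) (- q) (M *m q) ((Num.sqrt 2)^-1)%:M.
by rewrite !mul_mx_scalar.
Qed.

Lemma frameF_orthonormal : frameF^T *m frameF = 1%:M.
Proof.
rewrite /frameF [(_ *: _)^T]linearZ /= -scalemxAl -scalemxAr scalerA stack4mx_dot.
rewrite !tr_row_mx !mul_col_row !trmx0 !trmx1 !linearN /= !trmx1 !mulmx0 !mul0mx.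
rewrite ?mulNmx ?mulmxN ?mul1mx ?opprK tens_rotmx_orthogonal !add_block_mx ?oppr0 !addr0 !add0r.
rewrite scalar_mx_block scale_block_mx !scaler0 -invfM -expr2 sqr_sqrtr ?ler0n //.
have half m : 2^-1 *: (1%:M + 1%:M : 'M[R]_m) = 1%:M.
  by apply/matrixP => i j; rewrite !mxE; field.
by rewrite half.
Qed.

Lemma frameF_lagrangian : lagrangian_frame (Omega R n) frameF.
Proof.
split; last by rewrite frameF_orthonormal unitmx1.
rewrite /frameF [(_ *: _)^T]linearZ /=; set S := stack4mx _ _ _ _.
suff SOS : S^T *m (Omega R n *m S) = 0.
  by rewrite -!scalemxAl -scalemxAr -mulmxA SOS !scaler0.
rewrite /S Omega_stack4mx stack4mx_dot !opp_row_mx !opprK.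
rewrite !tr_row_mx !mul_col_row !trmx0 !trmx1 !linearN /= !trmx1 !mulmx0 !mul0mx.
by rewrite tens_rotmx_orthogonal mulNmx !mul1mx !add_block_mx ?oppr0 ?addr0 ?add0r ?subrr ?addNr block_mx0.
Qed.

End boundary_plane.

End stacking.

Lemma derive_locally_cst (R : realType) (c d x l : R) (g : R -> R) : c < x < d ->
  (forall y, c < y < d -> g y = g x) -> is_derive x 1 g l -> l = 0.
Proof.
move=> /andP[cx xd] gc /is_deriveP dg; apply/eqP; rewrite -normr_le0 leNgt; apply/negP => l0.
have [e e0 He] := dg (`|l| / 2) ltac:(lra).
pose h := Num.min (e / 2) ((d - x) / 2).
have h0 : 0 < h by rewrite lt_min; apply/andP; split; lra.
have h1 : h <= e / 2 by rewrite ge_min lexx.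
have h2 : h <= (d - x) / 2 by rewrite ge_min lexx orbT.
have := He (x + h); rewrite (addrC x) addrK (gtr0_norm h0) => /(_ ltac:(lra)).
rewrite gc; last by apply/andP; split; lra.
by rewrite subrr sub0r normrN normrM (gtr0_norm h0) mulrC ler_pM2r //; lra.
Qed.

(** Only the zero Cauchy data have a vanishing first component on an interval:
    there the derivative vanishes as well, and the fundamental matrix is
    invertible. *)
Lemma fund_unique_continuation (R : realType) (n : nat) (a b : R) (V : R -> 'M[R]_n)
    (lam c d : R) (w : 'cV[R]_(n + n)) :
  a < b -> within_cont_mx a b V -> (forall x, (V x)^T = V x) ->
  a <= c -> c < d -> d <= b ->
  (forall x, c < x < d -> usubmx (fund a b V lam x *m w) = 0) -> w = 0.
Proof.
move=> ab cV symV ac cd db u0; have [_ _ dF] := fundP ab cV lam.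
have [cm md] : c < (c + d) / 2 /\ (c + d) / 2 < d by split; lra.
set m := (c + d) / 2 in cm md.
have mab : a < m < b by apply/andP; split; lra.
have mcd : c < m < d by apply/andP.
have um : fund a b V lam m \in unitmx.
  by have /mulmx1_unit[] := fund_inv ab cV symV lam (x := m) ltac:(by rewrite !ltW //; case/andP: mab).
rewrite -(mulKmx um w) -[X in _ *m X]vsubmxK (u0 _ mcd).
suff -> : dsubmx (fund a b V lam m *m w) = 0 by rewrite col_mx0 mulmx0.
apply/matrixP => i j; rewrite [RHS]mxE.
have := derive_mx_mul (dF m mab) (derive_mx_cst m w); rewrite mulmx0 addr0 -mulmxA.
move=> /(_ (lshift n i) j); rewrite -[X in schr_mx _ _ _ *m X]vsubmxK /schr_mx mul_block_col.
rewrite mul0mx mul1mx add0r col_mxEu; apply: (derive_locally_cst mcd) => y ycd.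
have E z : c < z < d -> (fund a b V lam z *m w) (lshift n i) j = 0.
  by move=> /u0/matrixP/(_ i j); rewrite mxE [RHS]mxE.
by rewrite !E.
Qed.

Section solution_frame.
Variables (R : realType) (n : nat) (L : R) (W : R -> 'M[R]_(n * 2)).
Hypotheses (L0 : 0 < L) (cW : within_cont_mx (- (2 * L)) (2 * L) W).
Hypothesis symW : forall x, (W x)^T = W x.
Notation k := (n * 2)%N.

Let L2 : - (2 * L) < 2 * L. Proof. by have := L0; lra. Qed.
Let Phi lam := fund (- (2 * L)) (2 * L) W lam.

Let in_int (t : R) : 0 < t < 2 ->
  - (2 * L) <= - (t * L) <= 2 * L /\ - (2 * L) <= t * L <= 2 * L.
Proof.
move=> /andP[t0 t2]; have : t * L <= 2 * L by rewrite ler_pM2r // ltW.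
by have := mulr_gt0 t0 L0; move: (t * L) => s *; split; apply/andP; split; lra.
Qed.

(** The frame of the traces of the rescaled solutions y(x) = u(t x). *)
Definition frameG (lam t : R) : 'M[R]_(2 * (4 * n), k + k) :=
  stack4mx (usubmx (Phi lam (- (t * L)))) (usubmx (Phi lam (t * L)))
    (- (t *: dsubmx (Phi lam (- (t * L))))) (t *: dsubmx (Phi lam (t * L))).

Let wr lam mu x := (Phi lam x)^T *m symp_mx R k *m Phi mu x.

Let wrE lam mu x : wr lam mu x =
  (usubmx (Phi lam x))^T *m dsubmx (Phi mu x) - (dsubmx (Phi lam x))^T *m usubmx (Phi mu x).
Proof.
rewrite /wr -[X in X^T](vsubmxK (Phi lam x)) -[X in _ *m X](vsubmxK (Phi mu x)).
rewrite tr_col_mx /symp_mx mul_row_block !mulmx0 add0r addr0 mul_row_col mulmx1 mulmxN mulmx1.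
by rewrite mulNmx addrC.
Qed.

Lemma frameG_form lam mu t : (frameG lam t)^T *m Omega R n *m frameG mu t =
  t *: (wr lam mu (- (t * L)) - wr lam mu (t * L)).
Proof.
rewrite -mulmxA Omega_stack4mx stack4mx_dot !wrE.
rewrite opprK [(- _)^T]linearN /= ![(t *: _)^T]linearZ /= mulNmx mulmxN -!scalemxAl -!scalemxAr.
move: (_ *m _) (_ *m _) (_ *m _) (_ *m _) => A B C D.
by apply/matrixP => i j; rewrite !mxE; ring.
Qed.

Lemma fund_unit lam x : - (2 * L) <= x <= 2 * L -> Phi lam x \in unitmx.
Proof. by move=> hx; have /mulmx1_unit[] := fund_inv L2 cW symW lam hx. Qed.

Lemma frameG_inj lam t (w : 'cV[R]_(k + k)) : 0 < t < 2 ->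
  frameG lam t *m w = 0 -> w = 0.
Proof.
move=> ht; have /andP[t0 _] := ht; have [h1 _] := in_int ht.
have -> : 0 = stack4mx 0 0 0 0 :> 'cV[R]_(2 * (4 * n)).
  by rewrite /stack4mx !col_mx0; apply/matrixP => i j; rewrite castmxE !mxE.
rewrite stack4mx_mul => /stack4mx_inj[u0 _ d0 _].
rewrite -(mulKmx (fund_unit lam h1) w) -[X in X *m w](vsubmxK (Phi lam (- (t * L)))).
have {}d0 : dsubmx (Phi lam (- (t * L))) *m w = 0.
  apply/eqP; move/eqP: d0; rewrite mulNmx oppr_eq0 -scalemxAl scaler_eq0.
  by rewrite gt_eqF.
by rewrite mul_col_mx u0 d0 col_mx0 mulmx0.
Qed.

Lemma frameG_lagrangian lam t : 0 < t < 2 -> lagrangian_frame (Omega R n) (frameG lam t).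
Proof.
move=> ht; have [h1 h2] := in_int ht; split.
  by rewrite frameG_form /wr !fund_symplectic // subrr scaler0.
rewrite -[_ \in _]negbK; apply/negP => /singular_ker[w w0 Gw].
case/eqP: w0; apply: (frameG_inj ht (lam := lam)).
apply/eqP; rewrite -[_ == 0]negbK -trmx_eq0; apply/negP => /sqn_gt0.
rewrite /sqn /form mulmx1 trmxK trmx_mul -!mulmxA. 
by rewrite [X in _ *m X]mulmxA Gw mulmx0 mxE ltxx.
Qed.


Lemma mxcvg_fund lam t (s : R) : 0 < t < 2 -> `|s| = L ->
  mxcvg (nbhs ((lam, t) : R * R)) (fun p => Phi p.1 (p.2 * s)) (Phi lam (t * s)).
Proof.
move=> /andP[t0 t2] sL i j; have [_ _ dP] := fundP L2 cW lam.
have inI (v : R) : 0 < v < 2 -> - (2 * L) < v * s < 2 * L.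
  move=> /andP[v0 v2]; rewrite -ltr_norml normrM sL (gtr0_norm v0) ltr_pM2r //.
have [C C0 HC] := fund_lipschitz L2 cW lam.
have /cvgrPdist_lt cP := is_derive_cont (dP _ (inI t (introT andP (conj t0 t2))) i j).
apply/cvgrPdist_lt => e e0; have e20 : 0 < e / 2 by lra.
have /nbhs_ballP[d /= d0 Hd] := cP _ e20.
have dL : 0 < d / L by rewrite divr_gt0.
have eC : 0 < e / 2 / (C + 1) by rewrite divr_gt0 // ltr_wpDl.
pose r := Num.min (Num.min 1 (e / 2 / (C + 1))) (Num.min (d / L) (Num.min t (2 - t))).
have r0 : 0 < r by rewrite !lt_min ltr01 eC dL t0 subr_gt0 t2.
apply/nbhs_ballP; exists r => // -[mu v] [/= hmu hv].
move: hmu hv; rewrite /ball /= !lt_min => /andP[/andP[m1 m2] _] /andP[_ /and3P[v1 v2 v3]].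
have hv : 0 < v < 2 by move: v2 v3; rewrite !ltr_norml => /andP[? ?] /andP[? ?]; apply/andP; split; lra.
have P1 : `|Phi lam (t * s) i j - Phi lam (v * s) i j| < e / 2.
  apply: Hd; rewrite /= /ball /= -mulrBl normrM sL.
  by rewrite -ltr_pdivlMr.
have P2 : `|Phi mu (v * s) i j - Phi lam (v * s) i j| < e / 2.
  have /andP[l1 l2] := inI _ hv.
  have := HC mu; rewrite distrC (ltW m1) => /(_ isT (v * s) i j).
  rewrite (ltW l1) (ltW l2) => /(_ isT); rewrite mxE [X in _ + X]mxE => H.
  apply: (le_lt_trans H); move: m2; rewrite ltr_pdivlMr ?ltr_wpDl // => m2.
  by apply: le_lt_trans m2; rewrite mulrC ler_wpM2l // lerDl.
rewrite (_ : _ - _ = (Phi lam (t * s) i j - Phi lam (v * s) i j) -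
  (Phi mu (v * s) i j - Phi lam (v * s) i j)); last by ring.
by apply: (le_lt_trans (ler_normB _ _)); lra.
Qed.

Lemma mxcvg_usub T (Fl : set_system T) (FF : Filter Fl) m1 m2 p (f : T -> 'M[R]_(m1 + m2, p)) A :
  mxcvg Fl f A -> mxcvg Fl (fun x => usubmx (f x)) (usubmx A).
Proof. by move=> cf i j; rewrite mxE; under eq_fun do rewrite mxE; exact: cf. Qed.

Lemma mxcvg_dsub T (Fl : set_system T) (FF : Filter Fl) m1 m2 p (f : T -> 'M[R]_(m1 + m2, p)) A :
  mxcvg Fl f A -> mxcvg Fl (fun x => dsubmx (f x)) (dsubmx A).
Proof. by move=> cf i j; rewrite mxE; under eq_fun do rewrite mxE; exact: cf. Qed.

Lemma mxcvg_stack4 T (Fl : set_system T) (FF : Filter Fl) p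
    (f1 f2 f3 f4 : T -> 'M[R]_(k, p)) A B C D :
  mxcvg Fl f1 A -> mxcvg Fl f2 B -> mxcvg Fl f3 C -> mxcvg Fl f4 D ->
  mxcvg Fl (fun x => stack4mx (f1 x) (f2 x) (f3 x) (f4 x)) (stack4mx A B C D).
Proof.
move=> c1 c2 c3 c4 i j; rewrite /stack4mx castmxE; under eq_fun do rewrite castmxE.
move: (cast_ord _ i) (cast_ord _ j) => {}i {}j.
have [i'|i'] := split_ordP i => ->; have [i''|i''] := split_ordP i' => ->.
- by rewrite !col_mxEu; under eq_fun do rewrite !col_mxEu; exact: c1.
- by rewrite col_mxEu col_mxEd; under eq_fun do rewrite col_mxEu col_mxEd; exact: c2.
- by rewrite col_mxEd col_mxEu; under eq_fun do rewrite col_mxEd col_mxEu; exact: c3.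
- by rewrite !col_mxEd; under eq_fun do rewrite !col_mxEd; exact: c4.
Qed.

Lemma mxcvg_frameG lam t : 0 < t < 2 ->
  mxcvg (nbhs ((lam, t) : R * R)) (fun p => frameG p.1 p.2) (frameG lam t).
Proof.
move=> ht; have cp : mxcvg (nbhs ((lam, t) : R * R)) (fun p => Phi p.1 (p.2 * L)) (Phi lam (t * L)).
  by apply: mxcvg_fund => //; rewrite gtr0_norm.
have cm : mxcvg (nbhs ((lam, t) : R * R)) (fun p => Phi p.1 (- (p.2 * L))) (Phi lam (- (t * L))).
  have : mxcvg (nbhs ((lam, t) : R * R)) (fun p => Phi p.1 (p.2 * - L)) (Phi lam (t * - L)).
    by apply: mxcvg_fund => //; rewrite normrN gtr0_norm.
  by rewrite mulrN; apply: mxcvg_ext => p; rewrite mulrN.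
have ct : (p.2 : R) @[p --> nbhs ((lam, t) : R * R)] --> t by exact: cvg_snd.
apply: mxcvg_stack4.
- exact: mxcvg_usub.
- exact: mxcvg_usub.
- by apply: mxcvgN; apply: mxcvgZ => //; exact: mxcvg_dsub.
- by apply: mxcvgZ => //; exact: mxcvg_dsub.
Qed.

Lemma mx_primitive m a b (Q : R -> 'M[R]_m) : a < b -> within_cont_mx a b Q ->
  (forall x, (Q x)^T = Q x) ->
  exists P : R -> 'M[R]_m, [/\ forall x, (P x)^T = P x, within_cont_mx a b P &
    forall x, a < x < b -> derive_mx x P (Q x)].
Proof.
move=> ab cQ symQ.
pose prim (f : R -> R) : R -> R := get [set F : R -> R | [/\ F a = 0, {within `[a, b], continuous F} &
    forall x, a < x < b -> is_derive x 1 F (f x)]].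
have primP (f : R -> R) : {within `[a, b], continuous f} -> [/\ prim f a = 0, {within `[a, b], continuous (prim f)} &
    forall x, a < x < b -> is_derive x 1 (prim f) (f x)].
  by move=> cf; exact: (getPex (primitive ab cf)).
exists (fun x => \matrix_(i, j) prim (fun y => Q y i j) x); split.
- move=> x; apply/matrixP => i j; rewrite !mxE; congr prim.
  by apply/funext => y; rewrite -[in LHS]symQ mxE.
- move=> i j; have [_ cP _] := primP _ (@cQ i j).
  by apply: within_ext cP => x; rewrite mxE.
- move=> x xab i j; have [_ _ dP] := primP _ (@cQ i j).
  by rewrite (_ : (fun y => _) = prim (fun y => Q y i j)); [exact: dP|apply/funext => y; rewrite mxE].
Qed.


Let Q lam mu x := (Phi lam x)^T *m pos_mx R k *m Phi mu x.

Let form_Q lam x (v : 'rV[R]_(k + k)) :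
  form (Q lam lam x) v = sqn ((usubmx (Phi lam x *m v^T))^T).
Proof.
rewrite /form /sqn /form /Q mulmx1 trmxK !mulmxA.
rewrite -[v *m (Phi lam x)^T]trmxK trmx_mul trmxK -!mulmxA.
move: (Phi lam x *m v^T) => y; rewrite -{1 2}[y]vsubmxK /pos_mx mul_block_col.
by rewrite !mul0mx !addr0 mul1mx tr_col_mx mul_row_col mulmx0 addr0.
Qed.

(** The crossing form is the integral of |Y v|^2 over [-tL, tL]. *)
Lemma frameG_increasing (lam t : R) : 0 < t < 2 -> exists K : 'M[R]_(k + k),
  [/\ K^T = K, forall x, x != 0 -> 0 < form K x &
   mxcvg (lam^') (fun mu => (mu - lam)^-1 *:
      ((frameG lam t)^T *m Omega R n *m frameG mu t)) K].
Proof.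
move=> ht; have /andP[t0 _] := ht; have [h1 h2] := in_int ht.
have [_ cL dL] := fundP L2 cW lam.
have symQ x : (Q lam lam x)^T = Q lam lam x.
  rewrite /Q !trmx_mul trmxK mulmxA /pos_mx tr_block_mx !trmx0 trmx1 //.
have cpos : within_cont_mx (- (2 * L)) (2 * L) (fun x => (Phi lam x)^T *m pos_mx R k).
  apply: within_cont_mul; last exact: within_cont_mx_cst.
  exact: within_cont_tr.
have cQ : within_cont_mx (- (2 * L)) (2 * L) (Q lam lam) by exact: within_cont_mul.
have [P [symP cP dP]] := mx_primitive L2 cQ symQ.
have tL : 0 < t * L by rewrite mulr_gt0.
have [l1 l2] : - (2 * L) <= - (t * L) /\ t * L <= 2 * L by case/andP: h1; case/andP: h2.
exists (t *: (P (t * L) - P (- (t * L)))); split.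
- by rewrite [LHS]linearZ /= linearB /= !symP.
- move=> v v0; rewrite formZ formD formN mulr_gt0 //.
  rewrite ltNge; apply/negP => neg; case/eqP: v0.
  pose f y := form (P y) v.
  have df y : - (2 * L) < y < 2 * L -> is_derive y 1 f (sqn ((usubmx (Phi lam y *m v^T))^T)).
    move=> yI; have := derive_mx_mul (derive_mx_mul (derive_mx_cst y v) (dP y yI)) (derive_mx_cst y v^T).
    by move=> /(_ ord0 ord0); rewrite !mul0mx !mulmx0 !addr0 add0r -form_Q.
  have cf : {within `[- (2 * L), 2 * L], continuous f}.
    apply: (@within_cont_mul _ _ _ _ _ _ (fun y => v *m P y) (fun=> v^T)).
      by apply: (@within_cont_mul _ _ _ _ _ _ (fun=> v) P) => //; exact: within_cont_mx_cst.
    exact: within_cont_mx_cst.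
  have mono y z : - (2 * L) <= y -> y <= z -> z <= 2 * L -> f y <= f z.
    move=> ay yz zb; rewrite -subr_ge0 -(subrr (0 : R)).
    apply: (@derive_le_incr _ y z (fun=> 0) f (fun=> 0) (fun y => sqn ((usubmx (Phi lam y *m v^T))^T))) => //.
    + exact: within_cont_cst.
    + exact: within_sub cf.
    + by move=> x /andP[? ?]; apply: df; apply/andP; split; lra.
    + by move=> x _; exact: sqn_ge0.
  apply: trmx_inj; rewrite trmx0.
  apply: (fund_unique_continuation L2 cW symW l1 _ l2 (lam := lam)); first lra.
  move=> x xI; apply: trmx_inj; rewrite trmx0; apply/eqP; rewrite -[_ == _]negbK.
  apply/negP => /sqn_gt0; apply/negP; rewrite -leNgt le_eqVlt; apply/orP; left; apply/eqP.
  apply: (derive_locally_cst xI (g := f)); last first.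
    by apply: df; case/andP: xI => ? ?; apply/andP; split; lra.
  have fc y : - (t * L) < y < t * L -> f y = f (- (t * L)).
    move=> /andP[y1 y2]; apply/eqP; rewrite eq_le; apply/andP; split; last by apply: mono; lra.
    by have := mono y (t * L) ltac:(lra) ltac:(lra) ltac:(lra); move: neg; rewrite -/(f _) -/(f _); lra.
  by move=> y yI; rewrite (fc y yI) (fc x xI).
- have [M M0 HM] := within_cont_mx_bounded (ltW L2) cpos.
  have [C C0 HC] := fund_lipschitz L2 cW lam.
  pose N := (k + k)%N%:R * M * C * (t * (2 * (t * L))).
  have N0 : 0 <= N by rewrite !mulr_ge0 //; lra.
  move=> i j; apply/cvgrPdist_lt => e e0.
  have dpos : 0 < Num.min 1 (e / (N + 1)) by rewrite lt_min ltr01 divr_gt0 // ltr_wpDl.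
  apply/nbhs_ballP; exists (Num.min 1 (e / (N + 1))) => // mu; rewrite /ball /= => hmu mu_ne.
  move: hmu; rewrite distrC lt_min => /andP[m1 m2].
  have dm0 : mu - lam != 0 by rewrite subr_eq0.
  pose g y := - (mu - lam)^-1 * wr lam mu y i j - P y i j.
  have cg : {within `[- (2 * L), 2 * L], continuous g}.
    have c1 : within_cont_mx (- (2 * L)) (2 * L) (wr lam mu) by exact: within_wronskian.
    have c0 := @within_cont_cst R (- (2 * L)) (2 * L) (- (mu - lam)^-1).
    by move=> y; exact: (cvgB (cvgM (@c0 y) (@c1 i j y)) (@cP i j y)).
  have dg y : - (2 * L) < y < 2 * L -> is_derive y 1 g ((Q lam mu y - Q lam lam y) i j).
    move=> yI; have d1 := derive_wronskian L2 cW symW lam mu yI i j.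
    apply: is_derive_eq; first exact: (is_deriveB (is_deriveZ (- (mu - lam)^-1) d1) (dP y yI i j)).
    rewrite -/(Q lam mu y); move: (Q lam mu y) (Q lam lam y) => q q'.
    by rewrite /GRing.scale /= !mxE; field.
  have bg : `|g (t * L) - g (- (t * L))| <= (k + k)%N%:R * M * (C * `|mu - lam|) * (t * L) -
      (k + k)%N%:R * M * (C * `|mu - lam|) * (- (t * L)).
    apply: (@derive_abs_incr _ (- (t * L)) (t * L) g (fun y => (k + k)%N%:R * M * (C * `|mu - lam|) * y)
       (fun y => (Q lam mu y - Q lam lam y) i j) (fun=> (k + k)%N%:R * M * (C * `|mu - lam|))).
    + lra.
    + exact: within_sub cg.
    + by apply: cont_within => y _; exact: mulrl_continuous.
    + by move=> y /andP[? ?]; apply: dg; apply/andP; split; lra.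
    + by move=> y _; exact: is_derive_mul_cst.
    + move=> y /andP[y1 y2]; rewrite /Q -mulmxBr; apply: mulmx_bound.
      * exact: ltW.
      * by rewrite mulr_ge0.
      * by move=> r s; apply: HM; apply/andP; split; lra.
      * by move=> r s; apply: HC; [exact: ltW|apply/andP; split; lra].
  rewrite frameG_form scalerA.
  have -> : (t *: (P (t * L) - P (- (t * L)))) i j -
      (((mu - lam)^-1 * t) *: (wr lam mu (- (t * L)) - wr lam mu (t * L))) i j =
      - (t * (g (t * L) - g (- (t * L)))).
    rewrite /g; move: (wr lam mu _) (wr lam mu _) (P _) (P _) => A B A' B'.
    by rewrite !mxE; ring.
  rewrite normrN normrM (gtr0_norm t0).
  apply: (@le_lt_trans _ _ (N * `|mu - lam|)).
    rewrite /N; have := ler_wpM2l (ltW t0) bg; move=> H; apply: (le_trans H).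
    by rewrite le_eqVlt; apply/orP; left; apply/eqP; ring.
  move: m2; rewrite ltr_pdivlMr ?ltr_wpDl // => m2; apply: le_lt_trans m2.
  by rewrite mulrC ler_wpM2l // lerDl.
Qed.

End solution_frame.

Section entrywise.
Variable R : realType.

Lemma mx_norm_le m p (A : 'M[R]_(m, p)) e : 0 <= e ->
  (`|A| <= e <-> forall i j, `|A i j| <= e).
Proof.
move=> e0; rewrite /Num.Def.normr /= mx_normrE; split=> [/bigmax_leP[_ H] i j|H].
  exact: (H (i, j)).
by apply/bigmax_leP; split=> // -[i j] _; exact: H.
Qed.

Lemma derive_at_mx m p (a b : R) (f : R -> 'M[R]_(m, p)) x l :
  derive_at a b f x l <-> forall i j, derive_at a b (fun y => f y i j) x (l i j).
Proof.
split=> [/derive_atP H i j|H].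
  apply/derive_atP => e e0; have [d d0 Hd] := H e e0; exists d => // y yab yx.
  have e1 : 0 <= e * `|y - x| by rewrite mulr_ge0 // ltW.
  by have /(mx_norm_le _ e1)/(_ i j) := Hd y yab yx; rewrite !mxE.
apply/cvgrPdist_le => e e0.
have : mxcvg (within `[a, b] x^') (fun y => (y - x)^-1 *: (f y - f x)) l.
  move=> i j; apply: cvg_trans (H i j); apply: near_eq_cvg.
  by apply: nearW => y; rewrite !mxE.
move=> /mxcvg_near_le/(_ e0); apply: filterS => y Hy.
by apply/mx_norm_le => [|i j]; [exact: ltW|rewrite -opprB mxE normrN; exact: Hy].
Qed.

Lemma derive_mx_derive_at m p (a b : R) (f : R -> 'M[R]_(m, p)) x l :
  derive_mx x f l -> derive_at a b f x l.
Proof. by move=> df; apply/derive_at_mx => i j; apply: is_derive_derive_at. Qed.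

Lemma derive_at_derive_mx m p (a b : R) (f : R -> 'M[R]_(m, p)) x l : a < x < b ->
  derive_at a b f x l -> derive_mx x f l.
Proof. by move=> xab /derive_at_mx df i j; exact: derive_at_is_derive (df i j). Qed.

Lemma derive_on_within_mx m p (a b : R) (f f' : R -> 'M[R]_(m, p)) :
  derive_on a b f f' -> within_cont_mx a b f.
Proof.
move=> df i j; apply: (@derive_on_within _ _ a b _ (fun x => f' x i j)) => x xab.
by have /derive_at_mx := df x xab; apply.
Qed.

Lemma derive_mx_scale m p (t x : R) (F : R -> 'M[R]_(m, p)) F' :
  derive_mx (t * x) F F' -> derive_mx x (fun y => F (t * y)) (t *: F').
Proof.
move=> dF i j; rewrite mxE mulrC.
exact: (is_derive1_comp (dF i j) (is_derive_mul_cst t x)).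
Qed.

Lemma within_cont_scale m p (t a b : R) (F : R -> 'M[R]_(m, p)) : 0 < t ->
  within_cont_mx a b F -> within_cont_mx (t * a) (t * b) (fun x => F (t^-1 * x)).
Proof.
move=> t0 cF i j; apply/within_contP => x /andP[xa xb] e e0.
have sc y : t * a <= y -> y <= t * b -> a <= t^-1 * y <= b.
  by move=> ya yb; rewrite mulrC ler_pdivlMr // ler_pdivrMr // [a * t]mulrC [b * t]mulrC ya yb.
have /within_contP/(_ _ (sc x xa xb) e e0)[d d0 Hd] := cF i j.
exists (d * t) => [|y /andP[ya yb] yx]; first by rewrite mulr_gt0.
apply: Hd; first exact: sc.
by rewrite -mulrBr normrM gtr0_norm ?invr_gt0 // mulrC ltr_pdivrMr.
Qed.

End entrywise.

Lemma frame_im_ker (R : realType) d D (Om : 'M[R]_d) (X Z : 'M[R]_(d, D)) (w : 'cV[R]_D) :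
  d = (D + D)%N -> Om *m Om = - 1%:M -> Om^T = - Om -> lagrangian_frame Om X ->
  frame_im Om X Z *m w = 0 <-> plane X (Z *m w).
Proof.
move=> dD Om2 OmT lagX; rewrite /frame_im mulNmx; split => [/eqP|[v _ E]].
  rewrite oppr_eq0 => /eqP H; rewrite (lagrangian_plane dD Om2 OmT lagX) => _ [v _ <-].
  by rewrite sympl_tr trmx_mul -!mulmxA [X^T *m _]mulmxA [X^T *m Om *m _]mulmxA H mulmx0 mxE.
case: lagX => XOX _; rewrite -(mulmxA (X^T *m Om)) -E mulmxA XOX mul0mx oppr0 //.
Qed.

Section boundary_kernel.
Variables (R : realType) (n : nat) (L : R) (W : R -> 'M[R]_(n * 2)) (theta : R).
Hypotheses (L0 : 0 < L) (cW : within_cont_mx (- (2 * L)) (2 * L) W).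
Hypothesis symW : forall x, (W x)^T = W x.
Let M := (1%:M : 'M[R]_n) *t rotmx theta.
Let Phi lam := fund (- (2 * L)) (2 * L) W lam.


Lemma boundary_kernel (lam t : R) (w : 'cV[R]_(n * 2 + n * 2)) : 0 < t < 2 ->
  frame_im (Omega R n) (frameF n theta) (frameG L W lam t) *m w = 0 <->
  (Phi lam (t * L) - block_mx M 0 0 M *m Phi lam (- (t * L))) *m w = 0.
Proof.
move=> /andP[t0 _].
rewrite (frame_im_ker _ _ (esym (stack4_dim n)) (@Omega_sqr R n) (@Omega_tr R n)
  (@frameF_lagrangian R n theta)).
rewrite -planeF_plane /frameG stack4mx_mul mulmxBl -mulmxA.
rewrite -[X in _ <-> X *m w - _ = 0]vsubmxK -[X in _ <-> _ - _ *m (X *m w) = 0]vsubmxK.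
rewrite ![col_mx _ _ *m w]mul_col_mx mul_block_col !mul0mx addr0 add0r mulNmx -!scalemxAl.
set a := usubmx _ *m w; set b := usubmx _ *m w; set c := dsubmx _ *m w; set d := dsubmx _ *m w.
split=> [[p [q]]|/eqP].
  rewrite stack4E => /stack4mx_inj[<- -> /oppr_inj <- E].
  have -> : d = M *m c.
    by apply: (scalerI (lt0r_neq0 t0)); rewrite E -scalemxAr.
  by rewrite subrr.
rewrite subr_eq0 => /eqP/eq_col_mx[-> ->]; exists a, (t *: c).
by rewrite stack4E -scalemxAr.
Qed.

End boundary_kernel.

Section clamped_potential.
Variables (R : realType) (n : nat) (L : R) (V : R -> 'M[R]_n) (theta : R).
Hypotheses (L0 : 0 < L) (cV : within_cont_mx (- L) L V).
Hypothesis symV : forall x : R, x \in `[- L, L] -> (V x)^T = V x.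

Definition clamp (x : R) : R := Num.max (- L) (Num.min L x).

Let clamp_in x : - L <= clamp x <= L.
Proof. by rewrite /clamp le_max lexx ge_max ge_min lexx /= andbT; have := L0; lra. Qed.

Let clamp_id x : - L <= x <= L -> clamp x = x.
Proof. by move=> /andP[x1 x2]; rewrite /clamp min_r // max_r. Qed.

Let clamp_lip x y : `|clamp x - clamp y| <= `|x - y|.
Proof.
have E z : [\/ z <= - L /\ clamp z = - L, - L <= z <= L /\ clamp z = z | L <= z /\ clamp z = L].
  have [zL|zL] := leP z (- L).
    by constructor 1; rewrite /clamp min_r ?max_l //; have := L0; lra.
  have [Lz|Lz] := leP L z.
    by constructor 3; rewrite /clamp min_l // max_r //; have := L0; lra.
  by constructor 2; rewrite clamp_id !ltW.
have := ler_norm (x - y); have := ler_norm (y - x); rewrite (distrC y x) ler_norml.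
move: (E x) (E y) => [] [+ ->] [] [+ ->] => /=; have := L0; do ?case/andP; move=> *; apply/andP; split; lra.
Qed.

(** V extended to the whole line by its boundary values, so that the
    fundamental matrix lives on an interval containing [-L, L] in its interior. *)
Definition clampV (x : R) : 'M[R]_n := V (clamp x).

Lemma clampV_sym x : (clampV x)^T = clampV x.
Proof. by apply: symV; rewrite in_itv; exact: clamp_in. Qed.

Lemma clampV_id x : - L <= x <= L -> clampV x = V x.
Proof. by move=> /clamp_id; rewrite /clampV => ->. Qed.

Lemma within_clampV : within_cont_mx (- (2 * L)) (2 * L) clampV.
Proof.
move=> i j; apply/within_contP => x _ e e0.
have /within_contP/(_ _ (clamp_in x) e e0)[d d0 Hd] := @cV i j.
exists d => // y _ yx; apply: Hd => //; exact: le_lt_trans (clamp_lip y x) yx.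
Qed.

Let W := tensV clampV.
Let cW : within_cont_mx (- (2 * L)) (2 * L) W. Proof. exact/within_tensV/within_clampV. Qed.
Let symW x : (W x)^T = W x. Proof. exact/tensV_sym/clampV_sym. Qed.
Let L2 : - (2 * L) < 2 * L. Proof. by have := L0; lra. Qed.

Definition cfund (lam x : R) : 'M[R[i]]_(n + n) :=
  map_mx (real_complex R) (fund (- (2 * L)) (2 * L) clampV lam x).

Definition boundary_mx (t lam : R) : 'M[R[i]]_(n + n) :=
  cfund lam (t * L) - expi theta *: cfund lam (- (t * L)).

Definition multiplicity (t lam : R) : nat := (n + n - \rank (boundary_mx t lam))%N.

Lemma corank_frame_im t lam : 0 < t <= 1 ->
  (n * 2 + n * 2 - \rank (frame_im (Omega R n) (frameF n theta) (frameG L W lam t)))%N =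
  (2 * multiplicity t lam)%N.
Proof.
move=> /andP[t0 t1]; apply: corank_realification => p r.
have tL : 0 < t * L <= L by rewrite mulr_gt0 //= -[leRHS]mul1r ler_pM2r.
rewrite boundary_kernel //; last by apply/andP; split; lra.
apply: boundary_interleave2 => {}p {}r; apply: fund_interleave2 => //.
- exact: within_clampV.
- exact: clampV_sym.
- by case/andP: tL => ? ?; apply/andP; split; lra.
- exact: within_clampV.
- exact: clampV_sym.
- by case/andP: tL => ? ?; apply/andP; split; lra.
Qed.

Lemma planeG_plane (lam t : R) : 0 < t <= 1 -> planeG L V lam t = plane (frameG L W lam t).
Proof.
move=> /andP[t0 t1].
have tL : 0 < t * L <= L by rewrite mulr_gt0 //= -[leRHS]mul1r ler_pM2r.
have [_ cF dF] := fundP L2 cW lam.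
have tN0 : t != 0 by rewrite gt_eqF.
set Phi := fund _ _ _ _ in cF dF.
have tLx x : - L <= x <= L -> - (t * L) <= t * x <= t * L.
  by move=> /andP[? ?]; rewrite -mulrN !ler_pM2l //; apply/andP.
have WE x : - L <= x <= L -> W x = V x *t (1%:M : 'M[R]_2).
  by move=> /clampV_id; rewrite /W /tensV => ->.
apply/seteqP; split => [_ [y [y1 [y2 [dy dy1 eq ->]]]]|_ [w _ <-]].
  pose Y x := col_mx (y (t^-1 * x)) (t^-1 *: y1 (t^-1 * x)).
  have cY : within_cont_mx (- (t * L)) (t * L) Y.
    have c0 := within_cont_scale t0 (derive_on_within_mx dy).
    have c1 := within_cont_scale t0 (derive_on_within_mx dy1).
    rewrite -mulrN /Y => i j; have [i'|i'] := split_ordP i => ->.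
      by apply: within_ext (@c0 i' j) => x; rewrite col_mxEu.
    apply: (@within_ext _ _ _ _ (fun x => t^-1 * y1 (t^-1 * x) i' j)).
      by move=> x; rewrite col_mxEd mxE.
    have cc := @within_cont_cst R (t * - L) (t * L) t^-1.
    by move=> x; exact: (cvgM (@cc x) (@c1 i' j x)).
  have dY x : - (t * L) < x < t * L -> derive_mx x Y (schr_mx W lam x *m Y x).
    move=> /andP[x1 x2]; have sI : - L < t^-1 * x < L.
      by rewrite mulrC ltr_pdivlMr // ltr_pdivrMr // mulNr [L * t]mulrC x1.
    have sI' : t^-1 * x \in `[- L, L] by rewrite in_itv /= !ltW //; case/andP: sI.
    have d0 := derive_mx_scale (derive_at_derive_mx sI (dy _ sI')).
    have d1 := derive_mx_scale (derive_at_derive_mx sI (dy1 _ sI')).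
    rewrite /schr_mx mul_block_col !mul0mx mul1mx add0r addr0.
    rewrite (WE x); last by case/andP: tL => ? ?; apply/andP; split; lra.
    have -> : (V x *t (1%:M : 'M[R]_2) - lam%:M) *m y (t^-1 * x) =
        t^-1 *: (t^-1 *: y2 (t^-1 * x)).
      have := eq _ sI'; rewrite mulrA divff // mul1r mulmxBl mul_scalar_mx => E.
      have -> : y2 (t^-1 * x) = t ^+ 2 *: ((V x *t 1%:M) *m y (t^-1 * x)) - (t ^+ 2 * lam) *: y (t^-1 * x).
        by rewrite -E opprD opprK addrCA subrr addr0.
      move: (V x *t _ *m y (t^-1 * x)) => p; move: (y (t^-1 * x)) => q.
      by apply/matrixP => i j; rewrite !mxE; field; exact: tN0.
    move=> i j; rewrite /Y; have [i'|i'] := split_ordP i => ->.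
      rewrite col_mxEu; rewrite (_ : (fun z => _) = fun z => y (t^-1 * z) i' j); first exact: d0.
      by apply/funext => z; rewrite col_mxEu.
    rewrite col_mxEd; rewrite (_ : (fun z => _) = t^-1 \*: (fun z => y1 (t^-1 * z) i' j)).
      rewrite [X in is_derive _ _ _ X]mxE; exact: (is_deriveZ t^-1 (d1 i' j)).
    by apply/funext => z; rewrite col_mxEd mxE.
  have [w wE] := fund_complete L2 cW symW (c := - (t * L)) (d := t * L)
    ltac:(by case/andP: tL => ? ?; lra) ltac:(by case/andP: tL => ? ?; lra) cY dY.
  exists w => //; rewrite /frameG stack4mx_mul stack4E.
  have tr x : - L <= x <= L -> usubmx (Phi (t * x)) *m w = y x /\
      t *: dsubmx (Phi (t * x)) *m w = y1 x.
    move=> xI; have := wE _ (tLx x xI); rewrite /Y mulKf //.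
    rewrite -/Phi; move: (Phi (t * x)) => F; rewrite -{1}[F]vsubmxK mul_col_mx.
    move=> /eq_col_mx[<- E]; split=> //.
    by rewrite -scalemxAl -E scalerA divff // scale1r.
  have LI : - L <= L <= L by rewrite lexx andbT; have := L0; lra.
  have LN : - L <= - L <= L by rewrite lexx /=; have := L0; lra.
  have [a1 a2] := tr _ LN; have [b1 b2] := tr _ LI.
  by rewrite -[- (t * L)]mulrN mulNmx -/Phi a1 a2 b1 b2.
have tI x : - L <= x <= L -> - (2 * L) < t * x < 2 * L.
  by move=> /tLx/andP[? ?]; case/andP: tL => ? ?; apply/andP; split; lra.
pose y x := usubmx (Phi (t * x)) *m w.
pose y1 x := t *: (dsubmx (Phi (t * x)) *m w).
have dPhi x : - L <= x <= L -> derive_mx x (fun z => Phi (t * z) *m w)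
    (t *: (schr_mx W lam (t * x) *m Phi (t * x) *m w)).
  move=> /tI xI; have := derive_mx_mul (derive_mx_scale (dF _ xI)) (derive_mx_cst x w).
  by rewrite mulmx0 addr0 -scalemxAl.
have split_d x : schr_mx W lam (t * x) *m Phi (t * x) *m w =
    col_mx (dsubmx (Phi (t * x)) *m w) ((W (t * x) - lam%:M) *m (usubmx (Phi (t * x)) *m w)).
  rewrite -[X in _ *m X *m _]vsubmxK /schr_mx mul_block_col !mul0mx mul1mx add0r addr0.
  by rewrite mul_col_mx mulmxA.
have u_d x (F : R -> 'M[R]_(n * 2 + n * 2)) : usubmx (F x) *m w = usubmx (F x *m w) /\
    dsubmx (F x) *m w = dsubmx (F x *m w).
  by rewrite -{2 4}[F x]vsubmxK mul_col_mx col_mxKu col_mxKd.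
exists y, y1, (fun x => t ^+ 2 *: ((W (t * x) - lam%:M) *m y x)); split.
- move=> x; rewrite in_itv => /dPhi dx; apply: derive_mx_derive_at => i j.
  have := dx (lshift _ i) j; rewrite split_d scale_col_mx col_mxEu.
  rewrite (_ : (fun z => y z i j) = fun z => (Phi (t * z) *m w) (lshift _ i) j) //.
  by apply/funext => z; rewrite /y (u_d (t * z) Phi).1 mxE.
- move=> x; rewrite in_itv => /dPhi dx; apply: derive_mx_derive_at => i j.
  have := dx (rshift _ i) j; rewrite split_d scale_col_mx col_mxEd => dx1.
  rewrite (_ : (fun z => y1 z i j) = t \*: (fun z => (Phi (t * z) *m w) (rshift _ i) j)).
    have H := is_deriveZ t dx1; apply: (is_derive_eq H).
    by rewrite !mxE /GRing.scale /= mulrA -expr2.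
  by apply/funext => z; rewrite /y1 (u_d (t * z) Phi).2 2!mxE.
- move=> x; rewrite in_itv => xI.
  rewrite -WE; last by have /andP[? ?] := tLx _ xI; case/andP: tL => ? ?; apply/andP; split; lra.
  rewrite mulmxBl mul_scalar_mx; move: (W (t * x) *m y x) => p; move: (y x) => q.
  by apply/matrixP => i j; rewrite !mxE; ring.
- by rewrite /frameG stack4mx_mul stack4E /y /y1 mulrN mulNmx -!scalemxAl.
Qed.

End clamped_potential.

Section absolutely_continuous.
Variable R : realType.
Implicit Types (a b : R).

Lemma AC_on_mx m p a b (f : R -> 'M[R]_(m, p)) i j :
  AC_on a b f -> AC_on a b (fun x => f x i j).
Proof.
move=> acf e /acf[d d0 Hd]; exists d => // N l u lu tr lt.
apply: le_lt_trans (Hd N l u lu tr lt); apply: ler_sum => s _.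
have /(mx_norm_le _ (normr_ge0 _))/(_ i j) := lexx `|f (u s) - f (l s)|.
by rewrite !mxE.
Qed.

Lemma AC_on_B a b (f g : R -> R) : AC_on a b f -> AC_on a b g ->
  AC_on a b (fun x => f x - g x).
Proof.
move=> acf acg e e0; have e2 : 0 < e / 2 by lra.
have [d1 d10 H1] := acf _ e2; have [d2 d20 H2] := acg _ e2.
exists (Num.min d1 d2); first by rewrite lt_min d10.
move=> N l u lu tr; rewrite lt_min => /andP[l1 l2].
have := H1 N l u lu tr l1; have := H2 N l u lu tr l2.
have : \sum_i `|f (u i) - g (u i) - (f (l i) - g (l i))| <=
    \sum_i `|f (u i) - f (l i)| + \sum_i `|g (u i) - g (l i)|.
  rewrite -big_split /=; apply: ler_sum => i _; apply: le_trans (ler_normB _ _).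
  by rewrite le_eqVlt; apply/orP; left; apply/eqP; congr `|_|; ring.
lra.
Qed.

Lemma lipschitz_AC (T : normedModType R) a b (f : R -> T) M : 0 <= M ->
  (forall x y, a <= x -> x <= y -> y <= b -> `|f y - f x| <= M * (y - x)) ->
  AC_on a b f.
Proof.
move=> M0 lip e e0; have M1 : 0 < M + 1 by rewrite ltr_wpDl.
exists (e / (M + 1)) => [|N l u lu tr]; first by rewrite divr_gt0.
rewrite ltr_pdivlMr // => lt; apply: le_lt_trans lt.
rewrite mulr_suml; apply: ler_sum => i _; have [al [le ub]] := lu i.
apply: (le_trans (lip _ _ al le ub)); rewrite mulrC ler_wpM2l ?subr_ge0 //.
by rewrite lerDl.
Qed.

Lemma derive_AC_mx m p a b (f f' : R -> 'M[R]_(m, p)) : a <= b ->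
  (forall x, a <= x <= b -> derive_at a b f x (f' x)) ->
  within_cont_mx a b f' -> AC_on a b f.
Proof.
move=> ab df cf'; have [M M0 HM] := within_cont_mx_bounded ab cf'.
apply: (lipschitz_AC (ltW M0)) => x y ax xy yb.
apply/mx_norm_le => [|i j]; first by rewrite mulr_ge0 ?subr_ge0 // ltW.
rewrite mxE [X in _ + X]mxE.
apply: (@derive_on_Lipschitz _ a b (fun x => f x i j) (fun x => f' x i j)) => // z zI.
  by have /derive_at_mx := df z zI; apply.
exact: HM.
Qed.


Lemma ae_impl2 (P Q S : R -> Prop) : (forall x, P x -> Q x -> S x) ->
  {ae lebesgue_measure, forall x : R, P x} -> {ae lebesgue_measure, forall x : R, Q x} ->
  {ae lebesgue_measure, forall x : R, S x}.
Proof.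
move=> PQS aeP aeQ.
have FF := @ae_filter_ringOfSetsType _ _ R (@lebesgue_measure R).
exact: (@filterS2 _ _ FF _ _ _ PQS aeP aeQ).
Qed.

Lemma ae_neq (c : R) : {ae lebesgue_measure, forall x : R, x != c}.
Proof.
exists [set c]; split => //; first exact: lebesgue_measure_set1.
by move=> x /= /negP; rewrite negbK => /eqP.
Qed.

Lemma ae_zero_cont a b (f : R -> R) : {within `[a, b], continuous f} ->
  {ae lebesgue_measure, forall x : R, x \in `[a, b] -> f x = 0} ->
  forall x, a < x < b -> f x = 0.
Proof.
move=> /within_contP cf [A [mA A0 HA]] x /andP[ax xb].
apply/eqP; rewrite -normr_le0 leNgt; apply/negP => fx0.
have xab : a <= x <= b by rewrite !ltW.
have [d d0 Hd] := cf x xab _ fx0.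
pose h := Num.min d (b - x).
have h0 : 0 < h by rewrite lt_min d0 subr_gt0.
have h1 : h <= d by rewrite ge_min lexx.
have h2 : h <= b - x by rewrite ge_min lexx orbT.
pose I : set R := `]x, x + h[%classic.
have sub : I `<=` A.
  move=> y; rewrite /I /= in_itv /= => /andP[xy yh]; apply: HA => /= H.
  have yab : a <= y <= b by apply/andP; split; lra.
  have := Hd y yab; rewrite ger0_norm ?subr_ge0 ?(ltW xy) // => /(_ ltac:(lra)).
  by rewrite H ?in_itv // sub0r normrN ltxx.
have : (lebesgue_measure I <= lebesgue_measure A)%E.
  by apply: le_measure => //; rewrite inE //; exact: measurable_itv.
rewrite A0 [lebesgue_measure I]lebesgue_measure_itv /= lte_fin ltrDl h0 -EFinD lee_fin.
lra.
Qed.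

End absolutely_continuous.

Section square_integrable.
Variables (R : realType) (n : nat) (a b : R).
Hypothesis ab : a <= b.

Lemma within_L2 (u : R -> 'cV[R[i]]_n) :
  within_cont_mx a b (realv u) -> within_cont_mx a b (imagv u) -> L2 a b u.
Proof.
move=> cr ci; have meas (f : R -> R) : {within `[a, b], continuous f} -> measurable_fun `[a, b] f.
  by move=> cf; exact: (@measurable_realfun.subspace_continuous_measurable_fun R `[a, b]%classic f (measurable_itv _) cf).
split; first by move=> j; split; apply: meas; [exact: (@cr j 0)|exact: (@ci j 0)].
pose g x := sqnorm (u x).
have cg : {within `[a, b], continuous g}.
  rewrite (_ : g = fun x => \sum_j (realv u x j 0 * realv u x j 0 + imagv u x j 0 * imagv u x j 0)).
    move=> x; apply: cvg_sumr => j.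
    exact: (cvgD (cvgM (@cr j 0 x) (@cr j 0 x)) (cvgM (@ci j 0 x) (@ci j 0 x))).
  by apply/funext => x; apply: eq_bigr => j _; rewrite !mxE !expr2.
have [M M0 HM] := within_bounded ab cg.
have g0 x : 0 <= g x by apply: sumr_ge0 => j _; rewrite addr_ge0 ?sqr_ge0.
apply: (@le_lt_trans _ _ (\int[lebesgue_measure]_(x in `[a, b]) (cst M%:E x))%E).
  apply: ge0_le_integral => //.
  - by move=> x _; rewrite lee_fin; exact: g0.
  - by apply/measurable_realfun.measurable_EFinP; exact: meas.
  - by move=> x xI; rewrite lee_fin; apply: (le_trans (ler_norm _)); apply: HM; move: xI; rewrite /= in_itv.
rewrite integral_cst //= [lebesgue_measure _]lebesgue_measure_itv /=.
by case: ifP => _; rewrite ?mule0 -?EFinD -?EFinM ltry.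
Qed.

End square_integrable.

Lemma within_eq_on (R : realType) (a b : R) (f g : R -> R) :
  (forall x, a <= x <= b -> f x = g x) ->
  {within `[a, b], continuous g} -> {within `[a, b], continuous f}.
Proof.
move=> fg /within_contP cg; apply/within_contP => x xI e e0.
by have [d d0 Hd] := cg x xI e e0; exists d => // y yI yx; rewrite !fg //; exact: Hd.
Qed.

Section eigenfunctions.
Variables (R : realType) (n : nat) (L : R) (V : R -> 'M[R]_n) (theta : R).
Hypotheses (L0 : 0 < L) (cV : within_cont_mx (- L) L V).
Hypothesis symV : forall x : R, x \in `[- L, L] -> (V x)^T = V x.
Variable t : R.
Hypothesis ht : 0 < t <= 1.

Let a := - (t * L).
Let b := t * L.
Let F lam := fund (- (2 * L)) (2 * L) (clampV L V) lam.
Let W lam x : 'M[R]_n := clampV L V x - lam%:M.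

Let L2 : - (2 * L) < 2 * L. Proof. by have := L0; lra. Qed.
Let b0 : 0 < b <= L.
Proof. by rewrite /b; have /andP[t0 t1] := ht; rewrite mulr_gt0 //= -[leRHS]mul1r ler_pM2r. Qed.
Let ab : a < b. Proof. by have /andP[? _] := b0; rewrite /a -/b; lra. Qed.
Let aL : - (2 * L) <= a. Proof. by have /andP[? ?] := b0; rewrite /a -/b; lra. Qed.
Let bL : b <= 2 * L. Proof. by have /andP[? ?] := b0; lra. Qed.
Let inL x : a <= x <= b -> - L <= x <= L.
Proof. by have := b0; rewrite /a -/b => /andP[? ?] /andP[? ?]; apply/andP; split; lra. Qed.
Let inL2 x : a <= x <= b -> - (2 * L) < x < 2 * L.
Proof. by move=> /inL; have := L0 => ? /andP[? ?]; apply/andP; split; lra. Qed.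

Let cW lam : within_cont_mx a b (W lam).
Proof.
apply: within_cont_sub; last exact: within_cont_mx_cst.
by move=> i j; apply: (within_sub aL bL); exact: within_clampV.
Qed.

(** An absolutely continuous derivative that satisfies the equation almost
    everywhere is a primitive of a continuous function, so the solution is
    classical. *)
Lemma weak_solution lam (U U1 U2 : R -> 'cV[R]_n) :
  AC_on a b U1 -> derive_on a b U U1 ->
  {ae lebesgue_measure, forall x : R, x \in `[a, b] -> derive_at a b U1 x (U2 x)} ->
  {ae lebesgue_measure, forall x : R, x \in `[a, b] -> U2 x = W lam x *m U x} ->
  exists w, forall x, a <= x <= b -> col_mx (U x) (U1 x) = F lam x *m w.
Proof.
move=> acU1 dU dU1 eq; have cU := derive_on_within_mx dU.
have cWU : within_cont_mx a b (fun x => W lam x *m U x) by exact: within_cont_mul.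
have prim i : exists G : R -> R, [/\ {within `[a, b], continuous G},
    forall x, a < x < b -> is_derive x 1 G ((W lam x *m U x) i 0) &
    forall x, a <= x <= b -> U1 x i 0 = G x].
  have [G [Ga cG dG]] := primitive ab (@cWU i 0).
  have [M M0 HM] := within_bounded (ltW ab) (@cWU i 0).
  have acG : AC_on a b G.
    apply: (lipschitz_AC (ltW M0)) => x y ax xy yb; rewrite mulrBr.
    apply: (@derive_abs_incr _ x y G (fun z => M * z) (fun z => (W lam z *m U z) i 0) (fun=> M)) => //.
    - exact: within_sub cG.
    - by apply: cont_within => z _; exact: mulrl_continuous.
    - by move=> z /andP[? ?]; apply: dG; apply/andP; split; lra.
    - by move=> z _; exact: is_derive_mul_cst.
    - by move=> z /andP[? ?]; apply: HM; apply/andP; split; lra.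
  have acD := AC_on_B (AC_on_mx i 0 acU1) acG.
  have dD : {ae lebesgue_measure, forall x : R, x \in `[a, b] ->
      derive_at a b (fun x => U1 x i 0 - G x) x 0}.
    have nab : {ae lebesgue_measure, forall x : R, x != a /\ x != b}.
      by apply: ae_impl2 (ae_neq a) (ae_neq b) => x h1 h2.
    apply: (ae_impl2 _ nab); last by apply: (ae_impl2 _ dU1 eq) => x h1 h2; exact: (conj h1 h2).
    move=> x [xa xb] [d1 e1] xI.
    have xab : a < x < b.
      by move: xI; rewrite in_itv /= !le_eqVlt => /andP[/orP[/eqP E|->] /orP[/eqP E'|->]] //;
        [move: xa; rewrite -E eqxx|move: xa; rewrite -E eqxx|move: xb; rewrite E' eqxx].
    have /derive_at_mx/(_ i 0) := d1 xI; rewrite e1 // => /(derive_at_is_derive xab) dx.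
    apply: is_derive_derive_at; rewrite -(subrr ((W lam x *m U x) i 0)).
    exact: is_deriveB dx (dG x xab).
  have H := AC_derive0_const (ltW ab) acD dD.
  exists (fun x => G x + U1 a i 0); split.
  - have cc := @within_cont_cst R a b (U1 a i 0).
    by move=> x; exact: (cvgD (cG x) (@cc x)).
  - move=> x xI; rewrite -[X in is_derive _ _ _ X]addr0.
    have H1 := dG x xI; exact: is_deriveD.
  - by move=> x /H; rewrite Ga subr0 => <-; rewrite addrC subrK.
have cU1 : within_cont_mx a b U1.
  move=> i j; rewrite ord1; have [G [cG _ GE]] := prim i.
  exact: (within_eq_on GE cG).
have dU1' x : a < x < b -> derive_mx x U1 (W lam x *m U x).
  move=> xI i j; rewrite ord1; have [G [_ dG GE]] := prim i.
  apply: (@near_eq_is_derive _ _ _ G); last exact: dG.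
  have /andP[ax xb] := xI; near=> y; apply/esym/GE.
  by rewrite !ltW //; near: y; [exact: num_topology.lt_nbhsl|exact: num_topology.lt_nbhsr].
apply: (@fund_complete _ _ _ _ _ L2 (within_clampV L0 cV) (clampV_sym L0 symV) lam a b _ aL bL).
- move=> i j; have [i'|i'] := split_ordP i => ->.
    by apply: within_ext (@cU i' j) => x; rewrite col_mxEu.
  by apply: within_ext (@cU1 i' j) => x; rewrite col_mxEd.
- move=> x xI; rewrite /schr_mx mul_block_col !mul0mx mul1mx add0r addr0.
  have d0 := derive_at_derive_mx xI (dU x ltac:(by rewrite in_itv /= !ltW //; case/andP: xI)).
  move=> i j; have [i'|i'] := split_ordP i => ->.
    rewrite col_mxEu; rewrite (_ : (fun z => _) = fun z => U z i' j); first exact: d0.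
    by apply/funext => z; rewrite col_mxEu.
  rewrite col_mxEd; rewrite (_ : (fun z => _) = fun z => U1 z i' j); first exact: dU1'.
  by apply/funext => z; rewrite col_mxEd.
Unshelve. all: by end_near.
Qed.


Definition solution (lam : R) (z : 'cV[R[i]]_(n + n)) (x : R) : 'cV[R[i]]_n :=
  usubmx (cfund L V lam x *m z).
Definition solution_derive (lam : R) (z : 'cV[R[i]]_(n + n)) (x : R) : 'cV[R[i]]_n :=
  dsubmx (cfund L V lam x *m z).

Lemma Re_cfund lam x (z : 'cV[R[i]]_(n + n)) :
  map_mx (@complex.Re R) (cfund L V lam x *m z) = F lam x *m map_mx (@complex.Re R) z.
Proof. by apply/matrixP => i j; rewrite ord1 mxE complex_mulmx. Qed.

Lemma Im_cfund lam x (z : 'cV[R[i]]_(n + n)) :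
  map_mx (@complex.Im R) (cfund L V lam x *m z) = F lam x *m map_mx (@complex.Im R) z.
Proof. by apply/matrixP => i j; rewrite ord1 mxE complex_mulmx. Qed.

Lemma boundary_mxE lam (z : 'cV[R[i]]_(n + n)) : boundary_mx L V theta t lam *m z = 0 <->
  solution lam z b = expi theta *: solution lam z a /\
  solution_derive lam z b = expi theta *: solution_derive lam z a.
Proof.
rewrite /boundary_mx mulmxBl -scalemxAl /solution /solution_derive -/a -/b.
move: (cfund L V lam b *m z) (cfund L V lam a *m z) => p q; split => [/eqP|[H1 H2]].
  by rewrite subr_eq0 => /eqP ->; rewrite !linearZ.
by rewrite -[p]vsubmxK -[q]vsubmxK H1 H2 scale_col_mx subrr.
Qed.

Lemma solutionD lam k (c : 'I_k -> R[i]) (z : 'I_k -> 'cV[R[i]]_(n + n)) :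
  \sum_i c i *: solution lam (z i) = solution lam (\sum_i c i *: z i).
Proof.
apply/funext => x; rewrite fct_sumE /solution mulmx_sumr linear_sum /=.
by apply: eq_bigr => i _; rewrite -scalemxAr linearZ.
Qed.

Lemma solution_ae_eq0 lam z : ae_eq_on a b (solution lam z) 0 -> z = 0.
Proof.
move=> ae0; have [_ cFl _] := fundP L2 (within_clampV L0 cV) lam.
have part (v : 'cV[R]_(n + n)) :
    {ae lebesgue_measure, forall x : R, x \in `[a, b] -> usubmx (F lam x *m v) = 0} -> v = 0.
  move=> aev; apply: (fund_unique_continuation L2 (within_clampV L0 cV)
    (clampV_sym L0 symV) aL ab bL (lam := lam)) => x xI.
  apply/matrixP => i j; rewrite [RHS]mxE.
  apply: (@ae_zero_cont R a b (fun x => usubmx (F lam x *m v) i j)) xI.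
    have cv : within_cont_mx (- (2 * L)) (2 * L) (fun x => F lam x *m v).
      by apply: within_cont_mul => //; exact: within_cont_mx_cst.
    apply: (@within_ext _ _ _ _ (fun x => (F lam x *m v) (lshift n i) j)).
      by move=> y; rewrite mxE.
    by apply: (within_sub aL bL); exact: cv.
  apply: (ae_impl2 _ aev aev) => y H _ /H ->; by rewrite mxE.
have Re0 : map_mx (@complex.Re R) z = 0.
  apply: part; apply: (ae_impl2 _ ae0 ae0) => y H _ /H E.
  by rewrite -Re_cfund -map_usubmx -/(solution lam z y) E map_mx0.
have Im0 : map_mx (@complex.Im R) z = 0.
  apply: part; apply: (ae_impl2 _ ae0 ae0) => y H _ /H E.
  by rewrite -Im_cfund -map_usubmx -/(solution lam z y) E map_mx0.
rewrite -(cplxK z) Re0 Im0; apply/matrixP => i j; rewrite !mxE.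
by apply/eqP; rewrite eq_complex /= !eqxx.
Qed.

Lemma eigenfunction_solution lam (u : R -> 'cV[R[i]]_n) :
  H_theta L V theta t u (lam%:C%C *: u) ->
  exists2 z, boundary_mx L V theta t lam *m z = 0 &
    forall x, x \in `[a, b] -> u x = solution lam z x.
Proof.
move=> [u1 [u2 [[acr aci dr di] [ac1r ac1i dae] L2u2 [bc bc1] [_ eq]]]].
have VE x : a <= x <= b -> clampV L V x = V x by move=> /inL; exact: clampV_id.
have mapV x : map_mx (fun y => y%:C%C) (V x) *m u x =
    cplx (V x *m realv u x) (V x *m imagv u x).
  by apply/matrixP => i j; rewrite ord1 [RHS]mxE; exact: complex_mulmx.
have eqr : {ae lebesgue_measure, forall x : R, x \in `[a, b] ->
    realv u2 x = W lam x *m realv u x}.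
  apply: (ae_impl2 _ eq eq) => x H _ xI; have {}H := H xI.
  have xI' : a <= x <= b by move: xI; rewrite in_itv.
  rewrite /W VE // mulmxBl mul_scalar_mx; apply/matrixP => i j; rewrite ord1.
  have := congr1 (fun v : 'cV[R[i]]_n => complex.Re (v i 0)) H.
  rewrite mapV /= ![in LHS]mxE.
  move: (V x *m realv u x) => p.
  rewrite !mxE; case: (u x i 0) => ur ui; case: (u2 x i 0) => wr wi /=; lra.
have eqi : {ae lebesgue_measure, forall x : R, x \in `[a, b] ->
    imagv u2 x = W lam x *m imagv u x}.
  apply: (ae_impl2 _ eq eq) => x H _ xI; have {}H := H xI.
  have xI' : a <= x <= b by move: xI; rewrite in_itv.
  rewrite /W VE // mulmxBl mul_scalar_mx; apply/matrixP => i j; rewrite ord1.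
  have := congr1 (fun v : 'cV[R[i]]_n => complex.Im (v i 0)) H.
  rewrite mapV /= ![in LHS]mxE.
  move: (V x *m imagv u x) => p.
  rewrite !mxE; case: (u x i 0) => ur ui; case: (u2 x i 0) => wr wi /=; lra.
have [p pE] := @weak_solution lam (realv u) (realv u1) (realv u2) ac1r dr
  ltac:(by apply: (ae_impl2 _ dae dae) => x H _ /H[]) eqr.
have [q qE] := @weak_solution lam (imagv u) (imagv u1) (imagv u2) ac1i di
  ltac:(by apply: (ae_impl2 _ dae dae) => x H _ /H[]) eqi.
have sol x : a <= x <= b -> u x = solution lam (cplx p q) x /\
    u1 x = solution_derive lam (cplx p q) x.
  move=> xI; suff E : cfund L V lam x *m cplx p q = col_mx (u x) (u1 x).
    by rewrite /solution /solution_derive E col_mxKu col_mxKd.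
  rewrite -[LHS]cplxK Re_cfund Im_cfund Re_cplx Im_cplx -pE // -qE //.
  apply/matrixP => i j; rewrite mxE ord1; have [i'|i'] := split_ordP i => ->.
    by rewrite !col_mxEu !mxE; case: (u x i' 0).
  by rewrite !col_mxEd !mxE; case: (u1 x i' 0).
exists (cplx p q); last by move=> x xI; apply: (sol _ _).1; move: xI; rewrite in_itv.
have [sb1 sb2] := sol b ltac:(by rewrite lexx andbT ltW).
have [sa1 sa2] := sol a ltac:(by rewrite lexx ltW).
by apply/boundary_mxE; rewrite -sb1 -sb2 -sa1 -sa2.
Qed.

Lemma solution_eigenfunction lam z : boundary_mx L V theta t lam *m z = 0 ->
  H_theta L V theta t (solution lam z) (lam%:C%C *: solution lam z).
Proof.
move=> /boundary_mxE[bc bc1].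
have [_ cFl dFl] := fundP L2 (within_clampV L0 cV) lam.
pose rc := map_mx (real_complex R).
pose u2 x := rc n n (W lam x) *m solution lam z x.
have ReE x : realv (solution lam z) x = usubmx (F lam x *m map_mx (@complex.Re R) z).
  by rewrite /realv /solution map_usubmx Re_cfund.
have ImE x : imagv (solution lam z) x = usubmx (F lam x *m map_mx (@complex.Im R) z).
  by rewrite /imagv /solution map_usubmx Im_cfund.
have Re1E x : realv (solution_derive lam z) x = dsubmx (F lam x *m map_mx (@complex.Re R) z).
  by rewrite /realv /solution_derive map_dsubmx Re_cfund.
have Im1E x : imagv (solution_derive lam z) x = dsubmx (F lam x *m map_mx (@complex.Im R) z).
  by rewrite /imagv /solution_derive map_dsubmx Im_cfund.
have Re2E x : realv u2 x = W lam x *m usubmx (F lam x *m map_mx (@complex.Re R) z).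
  rewrite -ReE; apply/matrixP => i j; rewrite ord1 /u2 /rc [LHS]mxE.
  by rewrite complex_mulmx /=.
have Im2E x : imagv u2 x = W lam x *m usubmx (F lam x *m map_mx (@complex.Im R) z).
  rewrite -ImE; apply/matrixP => i j; rewrite ord1 /u2 /rc [LHS]mxE.
  by rewrite complex_mulmx /=.
have main (v : 'cV[R]_(n + n)) :
    [/\ within_cont_mx a b (fun x => usubmx (F lam x *m v)),
        within_cont_mx a b (fun x => dsubmx (F lam x *m v)),
        within_cont_mx a b (fun x => W lam x *m usubmx (F lam x *m v)),
        forall x, a <= x <= b -> derive_at a b (fun x => usubmx (F lam x *m v)) x
          (dsubmx (F lam x *m v)) &
        forall x, a <= x <= b -> derive_at a b (fun x => dsubmx (F lam x *m v)) x
          (W lam x *m usubmx (F lam x *m v))].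
  have cv : within_cont_mx a b (fun x => F lam x *m v).
    apply: within_cont_mul; last exact: within_cont_mx_cst.
    by move=> i j; apply: (within_sub aL bL); exact: cFl.
  have cu : within_cont_mx a b (fun x => usubmx (F lam x *m v)).
    by move=> i j; apply: within_ext (@cv (lshift n i) j) => x; rewrite mxE.
  have dv x : a <= x <= b -> derive_mx x (fun x => F lam x *m v)
      (col_mx (dsubmx (F lam x *m v)) (W lam x *m usubmx (F lam x *m v))).
    move=> /inL2 xI; have := derive_mx_mul (dFl x xI) (derive_mx_cst x v).
    rewrite mulmx0 addr0 -mulmxA -/(F lam x); move: (F lam x *m v) => y.
    by rewrite -{1}[y]vsubmxK /schr_mx mul_block_col !mul0mx mul1mx add0r addr0.
  split => //.
  - by move=> i j; apply: within_ext (@cv (rshift n i) j) => x; rewrite mxE.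
  - exact: within_cont_mul.
  - move=> x /dv dx; apply: derive_mx_derive_at => i j.
    have := dx (lshift n i) j; rewrite col_mxEu.
    have -> : (fun y => usubmx (F lam y *m v) i j) = fun y => (F lam y *m v) (lshift n i) j.
      by apply/funext => y; rewrite mxE.
    by [].
  - move=> x /dv dx; apply: derive_mx_derive_at => i j.
    have := dx (rshift n i) j; rewrite col_mxEd.
    have -> : (fun y => dsubmx (F lam y *m v) i j) = fun y => (F lam y *m v) (rshift n i) j.
      by apply/funext => y; rewrite mxE.
    by [].
have [cr0 cr1 cr2 dr0 dr1] := main (map_mx (@complex.Re R) z).
have [ci0 ci1 ci2 di0 di1] := main (map_mx (@complex.Im R) z).
have ReZ (w : R[i]) : complex.Re (lam%:C%C * w) = lam * complex.Re w.
  by case: w => ? ? /=; ring.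
have ImZ (w : R[i]) : complex.Im (lam%:C%C * w) = lam * complex.Im w.
  by case: w => ? ? /=; ring.
have ae_all (P : R -> Prop) : (forall x, x \in `[a, b] -> P x) ->
    {ae lebesgue_measure, forall x : R, x \in `[a, b] -> P x}.
  by move=> HP; apply: (ae_impl2 _ (ae_neq a) (ae_neq a)) => x _ _; exact: HP.
have ab' := ltW ab; have inI x : x \in `[a, b] -> a <= x <= b by rewrite in_itv.
exists (solution_derive lam z), u2; split.
- rewrite (funext ReE) (funext ImE) (funext Re1E) (funext Im1E); split.
  + exact: derive_AC_mx dr0 cr1.
  + exact: derive_AC_mx di0 ci1.
  + by move=> x /inI; exact: dr0.
  + by move=> x /inI; exact: di0.
- rewrite (funext Re1E) (funext Im1E); split.
  + exact: derive_AC_mx dr1 cr2.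
  + exact: derive_AC_mx di1 ci2.
  + by apply: ae_all => x /inI xI; rewrite Re2E Im2E; split; [exact: dr1|exact: di1].
- by apply: within_L2 => //; rewrite ?(funext Re2E) ?(funext Im2E).
- by [].
- split.
    apply: within_L2 => //.
      rewrite (_ : realv _ = fun x => lam *: usubmx (F lam x *m map_mx (@complex.Re R) z)).
        move=> i j; apply: (@within_ext _ _ _ _ (fun x => lam * usubmx (F lam x *m map_mx (@complex.Re R) z) i j)).
          by move=> x; rewrite mxE.
        have cc := @within_cont_cst R a b lam.
        by move=> x; exact: (cvgM (@cc x) (@cr0 i j x)).
      apply/funext => x; rewrite -ReE; apply/matrixP => i j; rewrite [LHS]mxE [RHS]mxE [X in _ = _ * X]mxE -ReZ.
      by congr complex.Re; exact: mxE.
    rewrite (_ : imagv _ = fun x => lam *: usubmx (F lam x *m map_mx (@complex.Im R) z)).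
      move=> i j; apply: (@within_ext _ _ _ _ (fun x => lam * usubmx (F lam x *m map_mx (@complex.Im R) z) i j)).
        by move=> x; rewrite mxE.
      have cc := @within_cont_cst R a b lam.
      by move=> x; exact: (cvgM (@cc x) (@ci0 i j x)).
    apply/funext => x; rewrite -ImE; apply/matrixP => i j; rewrite [LHS]mxE [RHS]mxE [X in _ = _ * X]mxE -ImZ.
    by congr complex.Im; exact: mxE.
  apply: ae_all => x /inI/inL xI.
  rewrite /u2 /W /rc clampV_id // map_mxB map_scalar_mx mulmxBl mul_scalar_mx.
  by rewrite opprB addrNK.
Qed.

End eigenfunctions.

Section eigenvalues.
Variables (R : realType) (n : nat) (L : R) (V : R -> 'M[R]_n) (theta : R).
Hypotheses (L0 : 0 < L) (cV : within_cont_mx (- L) L V).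
Hypothesis symV : forall x : R, x \in `[- L, L] -> (V x)^T = V x.
Variable t : R.
Hypothesis ht : 0 < t <= 1.

Lemma eigendim_multiplicity (lam : R) :
  eigendim (- (t * L)) (t * L) (H_theta L V theta t) lam%:C%C =
  (multiplicity L V theta t lam)%:R%:E.
Proof.
pose B := boundary_mx L V theta t lam.
pose D (u : R -> 'cV[R[i]]_n) := [set z | B *m z = 0 /\
  forall x, x \in `[- (t * L), t * L] -> u x = solution L V lam z x].
pose data u := xget 0 (D u).
have dataP u : H_theta L V theta t u (lam%:C%C *: u) -> D u (data u).
  move=> /(eigenfunction_solution L0 cV symV ht)[z Bz uz].
  by apply: (@xgetPex _ 0 (D u)); exists z.
apply: (cdim_kernel (data := data) (sol := solution L V lam)).
- by move=> u /dataP[].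
- move=> k e c eE sum0; apply: (ae_impl2 _ (ae_neq 0) (ae_neq 0)) => x _ _ xI.
  rewrite fct_sumE.
  transitivity (solution L V lam (\sum_i c i *: data (e i)) x).
    rewrite -solutionD fct_sumE; apply: eq_bigr => i _.
    by have [_ H] := dataP _ (eE i); congr (_ *: _); exact: H.
  by rewrite sum0 /solution mulmx0 linear0.
- by move=> z; exact: (solution_eigenfunction L0 cV ht).
- by move=> k z c _; rewrite solutionD; exact: (solution_ae_eq0 L0 cV symV ht).
Qed.

(** A point of the resolvent set is not an eigenvalue: the equation with zero
    right-hand side has only one solution. *)
Lemma multiplicity_resolvent (lam : R) :
  resolvent_set (- (t * L)) (t * L) (H_theta L V theta t) lam%:C%C ->
  multiplicity L V theta t lam = 0%N.
Proof.
move=> [M /(_ 0)]; have L20 : L2 (- (t * L)) (t * L) (0 : R -> 'cV[R[i]]_n).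
  have tL : 0 < t * L by rewrite mulr_gt0 //; case/andP: ht.
  by apply: within_L2; [lra| |] => i j; apply: within_ext (@within_cont_cst R _ _ 0) => x;
    rewrite !mxE.
move=> /(_ L20)[u [_ _ uniq]].
have sol0 (z : 'cV[R[i]]_(n + n)) : boundary_mx L V theta t lam *m z = 0 -> z = 0.
  move=> Bz; have Hz := solution_eigenfunction L0 cV ht Bz.
  have H0 : H_theta L V theta t (solution L V lam 0) (lam%:C%C *: solution L V lam 0).
    by apply: (solution_eigenfunction L0 cV ht); rewrite mulmx0.
  have := uniq (solution L V lam z); rewrite add0r => /(_ Hz) Ez.
  have := uniq (solution L V lam 0); rewrite add0r => /(_ H0) E0.
  apply: (solution_ae_eq0 L0 cV symV ht (lam := lam)).
  apply: (ae_impl2 _ Ez E0) => x h1 h0 xI; rewrite (h1 xI) -(h0 xI).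
  by rewrite /solution mulmx0 linear0.
apply/eqP; rewrite subn_eq0 leqNgt; apply/negP => /deficient_ker[z z0 /sol0/eqP].
by rewrite (negPf z0).
Qed.

End eigenvalues.

Lemma eq_Mas (R : realType) (d : nat) (Om : 'M[R]_d) (c e : R)
    (Y Y' : R -> set 'cV[R]_d) (X : set 'cV[R]_d) :
  (forall t, t \in `[c, e] -> Y t = Y' t) -> Mas Om c e Y X = Mas Om c e Y' X.
Proof.
pose S Z := [set mu | [/\ lagrangian Om X, forall t, t \in `[c, e] -> lagrangian Om (Z t),
  {within `[c, e], continuous (fun t => orthproj (Z t))} & maslov_value Om c e Z X mu]].
have sub (Z Z' : R -> set 'cV[R]_d) : (forall t, t \in `[c, e] -> Z t = Z' t) -> S Z `<=` S Z'.
  move=> ZZ' mu [lX lZ cZ [N [s [eps [s0 sN s1 s2 muE]]]]].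
  have inI t : c <= t <= e -> t \in `[c, e] by rewrite in_itv.
  have up i : (i <= N)%N -> c <= s i.
    elim: i => [|i IH] iN; first by rewrite s0.
    by apply: le_trans (IH (ltnW iN)) _; apply/ltW; case: (s1 i iN).
  have down i : (i <= N)%N -> s (N - i)%N <= e.
    elim: i => [|i IH] iN; first by rewrite subn0 sN.
    apply: le_trans (IH (ltnW iN)); apply/ltW.
    by have := s1 (N - i.+1)%N; rewrite -subSn // subSS => -[]; lia.
  have sI j : (j <= N)%N -> s j \in `[c, e].
    move=> jN; apply: inI; rewrite up //=.
    by have := down (N - j)%N; rewrite subKn //; apply; rewrite leq_subr.
  split; first exact: lX.
  - by move=> t tI; rewrite -ZZ'; [exact: lZ|].
  - apply/within_contP => x xI ee ee0; have /within_contP/(_ x xI ee ee0)[dd d0 Hd] := cZ.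
    by exists dd => // y yI yx; rewrite -!ZZ'; [exact: Hd|exact: inI|exact: inI].
  - exists N, s, eps; split; [exact: s0|exact: sN|exact: s1| |].
      move=> j t jN tj; rewrite -ZZ'; first exact: s2.
      have := sI j (ltnW jN); have := sI j.+1 jN; move: tj; rewrite !in_itv /=.
      by move=> /andP[? ?] /andP[? ?] /andP[? ?]; apply/andP; split; lra.
    rewrite muE; apply: eq_bigr => j _; rewrite !ZZ'; [by []|apply: sI; exact: ltnW|exact: sI].
move=> YY'; have E : S Y = S Y'.
  by rewrite eqEsubset; split; apply: sub => t tI; [exact: YY'|apply/esym; exact: YY'].
exact: (congr1 (xget 0%E) E).
Qed.

Theorem theorem4p1 (R : realType) (L : R) (n : nat) (V : R -> 'M[R]_n)
    (tau theta laminf : R)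
    (hL : 0 < L) (hn : (1 <= n)%N)
    (hV : C1_on (- L) L V)
    (hVsym : forall x : R, x \in `[- L, L] -> (V x)^T = V x)
    (htau : 0 < tau <= 1)
    (htheta : 0 <= theta < 2%:R * pi)
    (hspec : forall t : R, 0 < t <= 1 ->
       spectrum (- (t * L)) (t * L) (H_theta L V theta t) `<=`
       [set z : R[i] | complex.Im z = 0 /\ laminf < complex.Re z]) :
  forall r : R, laminf < r ->
    (eigencount L V theta r tau - eigencount L V theta r 1 =
     (2%:R^-1)%:E * Mas (Omega R n) tau 1 (fun t => planeG L V r t)
                        (planeF n theta))%E.
Proof.
move=> r lr.
have cV : within_cont_mx (- L) L V by case: hV => V' [dV _]; exact: derive_on_within_mx dV.
pose W := tensV (clampV L V).
have cW : within_cont_mx (- (2 * L)) (2 * L) W by apply: within_tensV; exact: within_clampV.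
have symW x : (W x)^T = W x by apply: tensV_sym; exact: clampV_sym.
pose e t lam := multiplicity L V theta t lam.
have he (t lam : R) : 0 < t <= 1 ->
    (n * 2 + n * 2 - \rank (frame_im (Omega R n) (frameF n theta) (frameG L W lam t)))%N =
    (2 * e t lam)%N by exact: corank_frame_im.
have bottom (t lam : R) : 0 < t <= 1 -> lam <= laminf -> e t lam = 0%N.
  move=> ht ll; apply: (multiplicity_resolvent hL cV hVsym ht).
  apply: contrapT => /(hspec t ht)/= [_]; rewrite ltNge => /negP; exact.
have countE t : 0 < t <= 1 -> eigencount L V theta r t = count_below (e t) r.
  by move=> ht; apply: eq_esum => lam _; exact: eigendim_multiplicity.
have dD := esym (stack4_dim n).
have lagZ (lam t : R) : 0 < t < 2 -> lagrangian_frame (Omega R n) (frameG L W lam t).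
  exact: frameG_lagrangian.
have cZ (lam t : R) : 0 < t < 2 ->
    mxcvg (nbhs ((lam, t) : R * R)) (fun p => frameG L W p.1 p.2) (frameG L W lam t).
  exact: mxcvg_frameG.
have inc (lam t : R) := @frameG_increasing R n L W hL cW symW lam t.
have F1 := frameF_orthonormal n theta; have FL := frameF_lagrangian n theta.
have h1 : 0 < (1 : R) <= 1 by rewrite ltr01 lexx.
have fin t ht := @flow_count_fin R _ _ _ dD (Omega_sqr R n) (Omega_tr R n) _ FL F1 _
  lagZ cZ inc e laminf he bottom r t ht.
have := @Mas_eigen_nb R _ _ _ dD (Omega_sqr R n) (Omega_tr R n) _ FL F1 _
  lagZ cZ inc e laminf he bottom r tau (ltW lr) htau.
rewrite -planeF_plane.
have -> : Mas (Omega R n) tau 1 (fun t => plane (frameG L W r t)) (planeF n theta) =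
    Mas (Omega R n) tau 1 (fun t => planeG L V r t) (planeF n theta).
  apply: eq_Mas => t; rewrite in_itv /= => /andP[t0 t1]; apply/esym/planeG_plane => //.
  by rewrite t1 andbT; apply: lt_le_trans t0; case/andP: htau.
move=> ->; rewrite (countE _ htau) (countE _ h1) -EFinM mulrA mulVf; last by rewrite pnatr_eq0.
have fineD (x y : \bar R) : x \is a fin_num -> y \is a fin_num ->
    (x - y)%E = (fine x - fine y)%:E by move=> xf yf; rewrite EFinB !fineK.
by rewrite mul1r; exact: (fineD _ _ (fin _ htau) (fin _ h1)).
Qed.
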